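(* Let $t\in\mathbb{C}$ be generic, and for each of the following planar diagram categories with parameter $t$ let $b_n$ be the number of indecomposable direct summands of $\bullet^{\otimes n}$ (counted with multiplicities), where $\bullet$ is the generating object. As $n\to\infty$: (1) for the planar partition category $\mathrm{p}\mathcal{P}\mathrm{a}_t$: $\sqrt[n]{b_n}\sim 4$; (2) for the Motzkin (planar rook-Brauer) category $\mathcal{M}\mathrm{o}_t$: $\sqrt[n]{b_n}\sim 3$; (3) for the Temperley--Lieb (planar Brauer) category $\mathcal{TL}_t$: $\sqrt[n]{b_n}\sim 2$; (4) for the planar rook category $\mathrm{p}\mathcal{R}\mathrm{o}_t$: $\sqrt[n]{b_n}\sim 2$; (5) for the planar symmetric category $\mathrm{p}\mathcal{S}_t$: $\sqrt[n]{b_n}\sim 1$.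
   Context: $f(n)\sim g(n)$ means $f(n)/g(n)\to1$ as $n\to\infty$. The partition category $\mathcal{P}\mathrm{a}_t$ is the $\mathbb{C}$-linear strict monoidal category with objects $\bullet^{\otimes n}$, $n\in\mathbb{Z}_{\geq0}$, where $\mathrm{Hom}(\bullet^{\otimes m},\bullet^{\otimes n})$ has as basis the set partitions of the disjoint union of $m$ bottom points and $n$ top points (drawn as diagrams in a horizontal strip, blocks being connected components). Composition is vertical stacking of diagrams: form the connected components, restrict to the outer bottom and top points, and multiply by $t^{c}$, where $c$ is the number of components touching neither the outer bottom nor the outer top. The tensor product is horizontal juxtaposition. A diagram is planar if it can be drawn in the strip (bottom points on the lower boundary line, top points on the upper boundary line, both in order) without crossings of different blocks. The categories in the claim are the monoidal subcategories of $\mathcal{P}\mathrm{a}_t$ with the same objects and Hom-spaces spanned by the following planar diagrams: planar partition: all planar diagrams; Motzkin: planar diagrams with all blocks of size $1$ or $2$; Temperley--Lieb: planar diagrams with all blocks of size $2$; planar rook: planar diagrams with all blocks of size $1$ or $2$ and each block having at most one bottom point and at most one top point; planar symmetric: planar permutation diagrams, i.e. only identity diagrams. Generic $t$ means that the category is semisimple, i.e. all endomorphism algebras of the objects $\bullet^{\otimes n}$ are semisimple. Direct summands are taken in the additive Karoubi envelope. *)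

(* Defs.v *)
From HB Require Import structures.
From mathcomp Require Import all_boot all_order all_algebra.
From mathcomp Require Import zify.
From mathcomp Require Import classical_sets reals topology normedtype sequences exp.
From mathcomp.real_closed Require Import complex.

Set Implicit Arguments.
Unset Strict Implicit.
Unset Printing Implicit Defensive.

Import Order.TTheory GRing.Theory Num.Theory.
Import numFieldNormedType.Exports.

Local Open Scope ring_scope.

(* [inl i] is the i-th bottom point and [inr j] the j-th top point, both
   counted from the left. *)
Definition points (m n : nat) : finType := ('I_m + 'I_n)%type.

Definition diagram (m n : nat) : finType :=
  {P : {set {set points m n}} | finset.partition P [set: points m n]}.

Definition blocks m n (D : diagram m n) : {set {set points m n}} := val D.

Definition fiber_diagram m n (T : finType) (f : points m n -> T) :
    diagram m n :=
  exist (fun P : {set {set points m n}} => finset.partition P [set: points m n])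
    (preim_partition f [set: points m n])
    (preim_partitionP f [set: points m n]).

Definition id_diagram n : diagram n n :=
  fiber_diagram (fun x : points n n => match x with inl i => i | inr i => i end).

Section Stacking.
Variables m n k : nat.

(* The points of Q drawn on top of P: the top points of P and the bottom points
   of Q are glued to the n middle points. *)
Definition stacked_points : finType := ('I_m + 'I_n + 'I_k)%type.

Definition lower (x : points m n) : stacked_points := inl x.

Definition upper (x : points n k) : stacked_points :=
  match x with inl j => inl (inr j) | inr l => inr l end.

Definition outer (x : points m k) : stacked_points :=
  match x with inl i => inl (inl i) | inr l => inr l end.

Variables (Q : diagram n k) (P : diagram m n).

Definition stacked_edge : rel stacked_points := fun x y =>
  [exists B in blocks P, (x \in lower @: B) && (y \in lower @: B)] ||
  [exists B in blocks Q, (x \in upper @: B) && (y \in upper @: B)].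

Definition component (x : stacked_points) : {set stacked_points} :=
  [set y | connect stacked_edge x y].

Definition stack : diagram m k := fiber_diagram (fun x => component (outer x)).

Definition closed_components : {set {set stacked_points}} :=
  [set C in [set component x | x : stacked_points]
    | [forall x : points m k, outer x \notin C]].

End Stacking.

(* The boundary of the strip, traversed through the bottom points from left to
   right and then through the top points from right to left. *)
Definition boundary_pos m n (x : points m n) : nat :=
  match x with inl i => i | inr j => (m + (n - j.+1))%N end.

Definition planar m n (D : diagram m n) : bool :=
  [forall B in blocks D, forall C in blocks D, (B != C) ==>
    ~~ [exists a in B, exists b in C, exists c in B, exists d in C,
          [&& boundary_pos a < boundary_pos b,
              boundary_pos b < boundary_pos c &
              boundary_pos c < boundary_pos d]%N]].

Definition bottom_size m n (B : {set points m n}) : nat :=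
  #|[set i : 'I_m | inl i \in B]|.

Definition top_size m n (B : {set points m n}) : nat :=
  #|[set j : 'I_n | inr j \in B]|.

(* A class of diagrams spanning the Hom-spaces of a subcategory of the partition
   category with the same objects. *)
Record diagram_class := DiagramClass {
  class_mem :> forall m n, pred (diagram m n);
  class_id : forall n, class_mem (id_diagram n)
}.

Section IdDiagram.
Variable n : nat.

Lemma id_blockP (B : {set points n n}) : B \in blocks (id_diagram n) ->
  exists i : 'I_n, B = [set inl i; inr i].
Proof.
move=> /imsetP[x _ ->].
exists (match x with inl i => i | inr i => i end).
by apply/setP => -[j|j]; rewrite !inE /= ?orbF; case: x => i /=;
   rewrite eq_sym.
Qed.

Lemma id_block_sizes (B : {set points n n}) : B \in blocks (id_diagram n) ->
  [/\ #|B| = 2, bottom_size B = 1 & top_size B = 1]%N.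
Proof.
case/id_blockP => i ->; split; first by rewrite cards2.
- rewrite /bottom_size -(cards1 i); congr #|pred_of_set _|.
  by apply/setP => j; rewrite !inE orbF.
- rewrite /top_size -(cards1 i); congr #|pred_of_set _|.
  by apply/setP => j; rewrite !inE.
Qed.

Lemma id_planar : planar (id_diagram n).
Proof.
apply/forall_inP => B /id_blockP[i ->]; apply/forall_inP => C /id_blockP[j ->].
apply/implyP => neBC; apply/negP.
case/exists_inP => a aB /exists_inP[b bC /exists_inP[c cB /exists_inP[d dC]]].
have := ltn_ord i; have := ltn_ord j.
by move: aB bC cB dC; rewrite !inE => /orP[] /eqP -> /orP[] /eqP ->
   /orP[] /eqP -> /orP[] /eqP -> /=; lia.
Qed.

End IdDiagram.

Definition motzkin_mem m n (D : diagram m n) : bool :=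
  planar D && [forall B in blocks D, (#|B| == 1)%N || (#|B| == 2)%N].

Definition temperley_lieb_mem m n (D : diagram m n) : bool :=
  planar D && [forall B in blocks D, #|B| == 2]%N.

Definition planar_rook_mem m n (D : diagram m n) : bool :=
  planar D && [forall B in blocks D,
    [&& (#|B| == 1) || (#|B| == 2), bottom_size B <= 1 & top_size B <= 1]%N].

Definition planar_symmetric_mem m n (D : diagram m n) : bool :=
  planar D && [forall B in blocks D, (bottom_size B == 1) && (top_size B == 1)]%N.

Lemma motzkin_id n : motzkin_mem (id_diagram n).
Proof.
rewrite /motzkin_mem id_planar; apply/forall_inP => B /id_block_sizes[-> _ _].
by [].
Qed.

Lemma temperley_lieb_id n : temperley_lieb_mem (id_diagram n).
Proof.
rewrite /temperley_lieb_mem id_planar.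
by apply/forall_inP => B /id_block_sizes[-> _ _].
Qed.

Lemma planar_rook_id n : planar_rook_mem (id_diagram n).
Proof.
rewrite /planar_rook_mem id_planar.
by apply/forall_inP => B /id_block_sizes[-> -> ->].
Qed.

Lemma planar_symmetric_id n : planar_symmetric_mem (id_diagram n).
Proof.
rewrite /planar_symmetric_mem id_planar.
by apply/forall_inP => B /id_block_sizes[_ -> ->].
Qed.

Definition planar_partition := DiagramClass id_planar.
Definition motzkin := DiagramClass motzkin_id.
Definition temperley_lieb := DiagramClass temperley_lieb_id.
Definition planar_rook := DiagramClass planar_rook_id.
Definition planar_symmetric := DiagramClass planar_symmetric_id.

Section PartitionCategory.
Variable F : fieldType.

(* Hom(m, n) in the partition category; a morphism is given by its coefficients
   on the diagrams. *)
Definition hom (m n : nat) : vectType F := {ffun diagram m n -> F^o}.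

Definition diagram_hom m n (D : diagram m n) : hom m n :=
  [ffun D' => (D' == D)%:R].

Definition id_hom n : hom n n := diagram_hom (id_diagram n).

Variable t : F.

(* [comp g f] is g after f: diagrams of g are drawn above those of f. *)
Definition comp m n k (g : hom n k) (f : hom m n) : hom m k :=
  \sum_(Q : diagram n k) \sum_(P : diagram m n)
    (g Q * f P * t ^+ #|closed_components Q P|) *: diagram_hom (stack Q P).

Lemma comp_diagram_hom m n k (Q : diagram n k) (P : diagram m n) :
  comp (diagram_hom Q) (diagram_hom P) =
  t ^+ #|closed_components Q P| *: diagram_hom (stack Q P).
Proof.
rewrite /comp (bigD1 Q) //= [X in _ + X]big1 => [|Q' /negPf neQ]; last first.
  by rewrite big1 // => P' _; rewrite ffunE neQ !mul0r scale0r.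
rewrite addr0 (bigD1 P) //= big1 => [|P' /negPf neP].
  by rewrite addr0 !ffunE !eqxx !mul1r.
by rewrite !ffunE neP mulr0 mul0r scale0r.
Qed.

Section IdComp.
Variable n : nat.

Let level (x : stacked_points n n n) : 'I_n :=
  match x with inl (inl i) => i | inl (inr i) => i | inr i => i end.

Lemma stacked_id_level (x y : stacked_points n n n) :
  connect (stacked_edge (id_diagram n) (id_diagram n)) x y =
  (level x == level y).
Proof.
apply/idP/eqP.
  case/connectP => p + ->; elim: p x => //= z p IHp x /andP[exz /IHp <-].
  case/orP: exz => /exists_inP[B /id_blockP[i ->]];
    by case/andP => /imsetP[a + ->] /imsetP[b + ->];
      rewrite !inE => /orP[] /eqP -> /orP[] /eqP ->.
have blockI (i : 'I_n) :
    [set inl i; inr i] \in blocks (id_diagram n).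
  apply/imsetP; exists (inl i) => //.
  by apply/setP => -[j|j]; rewrite !inE /= ?orbF eq_sym.
have lo (i : 'I_n) (a b : points n n) :
    a \in [set inl i; inr i] -> b \in [set inl i; inr i] ->
    connect (stacked_edge (id_diagram n) (id_diagram n)) (lower n a) (lower n b).
  move=> ai bi; apply/connect1/orP; left; apply/exists_inP.
  by exists [set inl i; inr i]; rewrite ?blockI // !imset_f.
have up (i : 'I_n) (a b : points n n) :
    a \in [set inl i; inr i] -> b \in [set inl i; inr i] ->
    connect (stacked_edge (id_diagram n) (id_diagram n)) (upper n a) (upper n b).
  move=> ai bi; apply/connect1/orP; right; apply/exists_inP.
  by exists [set inl i; inr i]; rewrite ?blockI // !imset_f.
have toM z : connect (stacked_edge (id_diagram n) (id_diagram n)) z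
    (inl (inr (level z))).
  case: z => [[i|i]|i] /=; last 1 first.
  - by apply: (up i (inr i) (inl i)); rewrite !inE eqxx ?orbT.
  - by apply: (lo i (inl i) (inr i)); rewrite !inE eqxx ?orbT.
  - exact: connect0.
have fromM z : connect (stacked_edge (id_diagram n) (id_diagram n))
    (inl (inr (level z))) z.
  case: z => [[i|i]|i] /=; last 1 first.
  - by apply: (up i (inl i) (inr i)); rewrite !inE eqxx ?orbT.
  - by apply: (lo i (inr i) (inl i)); rewrite !inE eqxx ?orbT.
  - exact: connect0.
by move=> exy; apply: connect_trans (toM x) _; rewrite exy.
Qed.

Lemma stack_id : stack (id_diagram n) (id_diagram n) = id_diagram n.
Proof.
apply: val_inj; apply: eq_imset => x; apply/setP => y.
rewrite !inE /=; apply/eqP/eqP => [exy|exy].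
  have: outer n y \in component (id_diagram n) (id_diagram n) (outer n x).
    by rewrite exy inE.
  by rewrite inE stacked_id_level; case: x y {exy} => [i|i] [j|j] /= /eqP.
apply/setP => z; rewrite !inE !stacked_id_level.
by case: x y exy => [i|i] [j|j] /= ->.
Qed.

Lemma closed_components_id :
  closed_components (id_diagram n) (id_diagram n) = finset.set0.
Proof.
apply/setP => C; rewrite !inE; apply/negP => /andP[/imsetP[x _ ->]].
move=> /forallP /(_ (inl (level x))).
by rewrite inE stacked_id_level eqxx.
Qed.

Lemma comp_id_hom : comp (id_hom n) (id_hom n) = id_hom n.
Proof.
by rewrite comp_diagram_hom stack_id closed_components_id cards0 expr0 scale1r.
Qed.

End IdComp.

Variable K : diagram_class.

Definition hom_space m n : {vspace hom m n} :=
  <<[seq diagram_hom D | D <- enum (@class_mem K m n)]>>%VS.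

Lemma id_hom_in n : id_hom n \in hom_space n n.
Proof. by apply/memv_span/map_f; rewrite mem_enum; apply: class_id. Qed.

Definition left_ideal n (U : {vspace hom n n}) : Prop :=
  (U <= hom_space n n)%VS /\
  forall a u, a \in hom_space n n -> u \in U -> comp a u \in U.

(* The left regular module of the endomorphism algebra of the n-th tensor power
   is semisimple: every submodule is a direct summand. *)
Definition semisimple_end n : Prop :=
  forall U : {vspace hom n n}, left_ideal U ->
  exists V : {vspace hom n n},
    [/\ left_ideal V, (U :&: V = 0)%VS & (U + V = hom_space n n)%VS].

Definition generic : Prop := forall n, semisimple_end n.

Definition mx_hom k l (s : 'I_k -> nat) (s' : 'I_l -> nat) : Type :=
  forall i j, hom (s i) (s' j).

Definition mx_comp k l p (s : 'I_k -> nat) (s' : 'I_l -> nat) (s'' : 'I_p -> nat)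
    (g : mx_hom s' s'') (f : mx_hom s s') : mx_hom s s'' :=
  fun i j => \sum_(h < l) comp (g h j) (f i h).

(* Objects of the additive Karoubi envelope: idempotent matrices of morphisms
   on finite formal direct sums of objects of the category spanned by K.
   The identity of such an object is its idempotent. *)
Record kar_obj := KarObj {
  kar_len : nat;
  kar_sum : 'I_kar_len -> nat;
  kar_idem : mx_hom kar_sum kar_sum;
  kar_idem_in : forall i j, kar_idem i j \in hom_space (kar_sum i) (kar_sum j);
  kar_idemP : forall i j, mx_comp kar_idem kar_idem i j = kar_idem i j
}.

Definition kar_hom (X Y : kar_obj) (f : mx_hom (@kar_sum X) (@kar_sum Y)) : Prop :=
  (forall i j, f i j \in hom_space (kar_sum i) (kar_sum j)) /\
  (forall i j, mx_comp (@kar_idem Y) (mx_comp f (@kar_idem X)) i j = f i j).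

Definition kar_zero (X : kar_obj) : Prop := forall i j, @kar_idem X i j = 0.

(* X is a direct sum (biproduct) of the family Y, with injections [inj] and
   projections [prj]. *)
Definition direct_sum (X : kar_obj) (b : nat) (Y : 'I_b -> kar_obj) : Prop :=
  exists (inj : forall a, mx_hom (@kar_sum (Y a)) (@kar_sum X))
         (prj : forall a, mx_hom (@kar_sum X) (@kar_sum (Y a))),
  [/\ (forall a, kar_hom (inj a)) /\ (forall a, kar_hom (prj a)),
      (forall a i j, mx_comp (prj a) (inj a) i j = @kar_idem (Y a) i j),
      (forall a c, a != c ->
         forall i j, mx_comp (prj c) (inj a) i j = 0)
    & (forall i j, \sum_(a < b) mx_comp (inj a) (prj a) i j = @kar_idem X i j)].

Definition indecomposable (X : kar_obj) : Prop :=
  ~ kar_zero X /\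
  forall Y : 'I_2 -> kar_obj, direct_sum X Y -> exists a, kar_zero (Y a).

Lemma tensor_power_idem n (i j : 'I_1) :
  @mx_comp 1 1 1 (fun=> n) (fun=> n) (fun=> n)
    (fun _ _ => id_hom n) (fun _ _ => id_hom n) i j = id_hom n.
Proof. by rewrite /mx_comp big_ord1 comp_id_hom. Qed.

(* The n-th tensor power of the generating object, which is the n-th object of
   the category. *)
Definition tensor_power n : kar_obj :=
  @KarObj 1 (fun=> n) (fun _ _ => id_hom n)
    (fun _ _ => id_hom_in n) (tensor_power_idem n).

Definition splits_into n b : Prop :=
  exists Y : 'I_b -> kar_obj,
    (forall a, indecomposable (Y a)) /\ direct_sum (tensor_power n) Y.

(* b n is the number of indecomposable direct summands of the n-th tensor power,
   counted with multiplicities: such a decomposition exists and all of them have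
   b n terms. *)
Definition summand_count (b : nat -> nat) : Prop :=
  forall n k, splits_into n k <-> k = b n.

End PartitionCategory.

Definition asymptotic (R : realType) (f g : nat -> R) : Prop :=
  (f n / g n @[n --> \oo] --> (1 : R))%classic.

Definition nth_root (R : realType) (n : nat) (x : R) : R := (x `^ n%:R^-1)%R.

(* Main.v *)
(** In a semisimple algebra A = End(n) over C, with simple blocks of sizes d_i,
    the number of primitive summands of the identity is b = sum d_i, so that
    dim A <= b ^ 2 <= N dim A where N is the number of blocks. Every planar
    endomorphism other than an identity factors through fewer points, so the
    isomorphism class of a primitive idempotent of End(n) is determined by the
    least j such that it factors through the j-th object, and N <= n + 1. Hence
    b has the growth rate of the square root of dim A, the number of planar
    diagrams of the class on 2n points. Such a diagram is determined by telling
    for each point whether its block goes on to the left and to the right of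
    it, which bounds the dimension above by 16^n, 9^n, 4^n, 4^n and 1; by
    rotating balanced words to ballot words, a fraction of them which is
    polynomial in 1/n does come from diagrams.

    Colorings of the points by two colors, constant on blocks, turn stacking
    into matrix multiplication, up to powers of 2; associativity and unit laws
    of stacking, with the count of closed components, follow from those of
    matrices. *)

From HB Require Import structures.
From mathcomp Require boolp.
From mathcomp Require Import classical_sets reals topology normedtype sequences exp.
From mathcomp Require Import all_boot all_order all_algebra.
From mathcomp Require Import zify ring lra.
From mathcomp.real_closed Require Import complex.
Require Import Defs.

Set Implicit Arguments.
Unset Strict Implicit.
Unset Printing Implicit Defensive.

Import Order.TTheory GRing.Theory Num.Theory.
Import numFieldNormedType.Exports.

(** * Blocks and stacking *)

(** Semisimplicity enters through one consequence: every x in End(n) has a y with x y x = x. For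
    primitive idempotents e and f this makes the nonzero elements of e End(n) f invertible, which is
    Schur's lemma, and no Wedderburn decomposition is needed. The dimensions of these Peirce
    components, all 0 or 1, carry the whole count; they also show that the number of summands does
    not depend on the decomposition.

    Nothing but semisimplicity is assumed about t, so powers of t cannot be divided out. The
    factorizations through fewer points are therefore built without closed components.

    Planarity is the absence of crossings in the boundary order. For its stability under stacking, a
    count modulo 2 takes the place of the Jordan curve theorem.

    In the lower bound for planar partitions the obstacle is the middle points of blocks: they do
    not change the height and could occur at height 0, where no block is open. Enclosing a word
    between one opening and one closing letter repairs this at the cost of a constant factor. *)

Section SameBlock.
Variables m n : nat.
Implicit Types (D E : diagram m n) (x y z : points m n).

Definition same_block D : rel (points m n) :=
  fun x y => y \in pblock (blocks D) x.

Lemma same_block_equivalence D : equivalence_rel (same_block D).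
Proof.
move=> x y z.
by apply: (pblock_equivalence (valP D)); rewrite inE.
Qed.

Lemma same_block_refl D x : same_block D x x.
Proof. by case: (same_block_equivalence D x x x). Qed.

Lemma same_block_trans D y x z :
  same_block D x y -> same_block D y z -> same_block D x z.
Proof. by move=> xy yz; case: (same_block_equivalence D x y z) => _ ->. Qed.

Lemma same_block_sym D x y : same_block D x y = same_block D y x.
Proof.
apply/idP/idP => xy.
  case: (same_block_equivalence D x y x) => _ /(_ xy) <-.
  exact: same_block_refl.
case: (same_block_equivalence D y x y) => _ /(_ xy) <-.
exact: same_block_refl.
Qed.

Lemma same_block_inj D E : same_block D =2 same_block E -> D = E.
Proof.
move=> eqDE; apply: val_inj => /=.
rewrite -(equivalence_partition_pblock (valP D)).
rewrite -(equivalence_partition_pblock (valP E)).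
by apply: eq_imset => x; apply/setP => y; rewrite !inE; apply: eqDE.
Qed.

Lemma same_block_fiber (T : finType) (f : points m n -> T) x y :
  same_block (fiber_diagram f) x y = (f x == f y).
Proof.
rewrite /same_block /blocks /= /preim_partition pblock_equivalence_partition ?inE //.
by move=> a b c _ _ _; split=> // /eqP ->.
Qed.

Lemma same_blockP D B x y : B \in blocks D -> x \in B ->
  same_block D x y = (y \in B).
Proof.
move=> BD xB; rewrite /same_block (def_pblock _ BD xB) //.
by case/and3P: (valP D).
Qed.

Lemma block_of_in D x : pblock (blocks D) x \in blocks D.
Proof. by rewrite pblock_mem // (cover_partition (valP D)) inE. Qed.

Lemma mem_block_of D x : x \in pblock (blocks D) x.
Proof. exact: same_block_refl. Qed.

Lemma block_nonempty D B : B \in blocks D -> exists x, x \in B.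
Proof.
move=> BD; apply/set0Pn; apply/eqP => B0.
by case/and3P: (valP D) => _ _; rewrite -B0 -/(blocks D) BD.
Qed.

Definition coloring D (c : points m n -> bool) : bool :=
  [forall x, forall y, same_block D x y ==> (c x == c y)].

Lemma coloringP D (c : points m n -> bool) :
  reflect (forall x y, same_block D x y -> c x = c y) (coloring D c).
Proof.
apply: (iffP forallP) => [Dc x y xy|Dc x].
  by apply/eqP; move/forallP: (Dc x) => /(_ y) /implyP /(_ xy).
by apply/forallP => y; apply/implyP => /Dc ->.
Qed.

Lemma eq_coloring D (c c' : points m n -> bool) : c =1 c' -> coloring D c = coloring D c'.
Proof.
by move=> cc'; apply: eq_forallb => x; apply: eq_forallb => y; rewrite !cc'.
Qed.

(** The indicator function of a block of one diagram is one of its colorings, hence also a coloring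
    of the other diagram; so each block of either diagram lies in a block of the other. *)
Lemma coloring_inj D E : (forall c, coloring D c = coloring E c) -> D = E.
Proof.
move=> eqc; apply: same_block_inj => x y.
have col D' z : coloring D' (same_block D' z).
  apply/coloringP => a b ab; apply/idP/idP => zx.
    exact: same_block_trans zx ab.
  by apply: same_block_trans zx _; rewrite same_block_sym.
apply/idP/idP => xy.
  move: (col E x); rewrite -eqc => /coloringP /(_ _ _ xy).
  by rewrite same_block_refl.
move: (col D x); rewrite eqc => /coloringP /(_ _ _ xy).
by rewrite same_block_refl.
Qed.

Definition glue (a : 'I_m -> bool) (b : 'I_n -> bool) (x : points m n) : bool :=
  match x with inl i => a i | inr j => b j end.

Lemma coloring_false D : coloring D (glue (fun=> false) (fun=> false)).
Proof. by apply/coloringP => -[i|i] [j|j]. Qed.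

End SameBlock.

Section StackColoring.
Variables (m n k : nat) (Q : diagram n k) (P : diagram m n).

Lemma stacked_edgeP (x y : stacked_points m n k) :
  reflect ((exists u v, [/\ x = lower k u, y = lower k v & same_block P u v]) \/
           (exists u v, [/\ x = upper m u, y = upper m v & same_block Q u v]))
    (stacked_edge Q P x y).
Proof.
apply: (iffP orP) => [[]|[]].
- case/exists_inP => B BP /andP[/imsetP[u uB ->] /imsetP[v vB ->]].
  by left; exists u, v; rewrite (same_blockP _ BP).
- case/exists_inP => B BP /andP[/imsetP[u uB ->] /imsetP[v vB ->]].
  by right; exists u, v; rewrite (same_blockP _ BP).
- case=> u [v [-> -> uv]]; left; apply/exists_inP.
  exists (pblock (blocks P) u); first exact: block_of_in.
  by rewrite !imset_f //; apply: same_block_refl.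
- case=> u [v [-> -> uv]]; right; apply/exists_inP.
  exists (pblock (blocks Q) u); first exact: block_of_in.
  by rewrite !imset_f //; apply: same_block_refl.
Qed.

Lemma stacked_edge_sym : symmetric (stacked_edge Q P).
Proof.
move=> x y; apply/stacked_edgeP/stacked_edgeP.
  by case=> -[u [v [-> -> uv]]]; [left|right]; exists v, u; rewrite same_block_sym.
by case=> -[u [v [-> -> uv]]]; [left|right]; exists v, u; rewrite same_block_sym.
Qed.

Lemma connect_stacked_sym : connect_sym (stacked_edge Q P).
Proof. exact: sym_connect_sym stacked_edge_sym. Qed.

Lemma component_eq (x y : stacked_points m n k) :
  (component Q P x == component Q P y) = connect (stacked_edge Q P) x y.
Proof.
apply/eqP/idP => [exy|cxy].
  have: y \in component Q P y by rewrite inE connect0.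
  by rewrite -exy inE.
apply/setP => z; rewrite !inE.
exact: (same_connect connect_stacked_sym).
Qed.

Lemma same_block_stack x y :
  same_block (stack Q P) x y = connect (stacked_edge Q P) (outer n x) (outer n y).
Proof. by rewrite /stack same_block_fiber component_eq. Qed.

Definition stacked_color (a : 'I_m -> bool) (b : 'I_n -> bool) (c : 'I_k -> bool)
    (x : stacked_points m n k) : bool :=
  match x with inl (inl i) => a i | inl (inr j) => b j | inr l => c l end.

(** An edge of the stacked graph lies in a block of [P] or in a block of [Q], so constancy on
    components splits into one condition per diagram, coupled by the common middle colors [b]. *)
Lemma stacked_coloringP (a : 'I_m -> bool) (b : 'I_n -> bool) (c : 'I_k -> bool) :
  reflect (forall x y, connect (stacked_edge Q P) x y ->
             stacked_color a b c x = stacked_color a b c y)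
    (coloring P (glue a b) && coloring Q (glue b c)).
Proof.
have lo u : stacked_color a b c (lower k u) = glue a b u by case: u.
have up u : stacked_color a b c (upper m u) = glue b c u by case: u.
apply: (iffP andP) => [[/coloringP cP /coloringP cQ] x y|con].
  case/connectP => p + ->; elim: p x => //= z p IHp x /andP[exz /IHp <-].
  case/stacked_edgeP: exz => -[u [v [-> -> uv]]]; first by rewrite !lo; apply: cP.
  by rewrite !up; apply: cQ.
split; apply/coloringP => u v uv.
  rewrite -!lo; apply/con/connect1/stacked_edgeP; left; by exists u, v.
rewrite -!up; apply/con/connect1/stacked_edgeP; right; by exists u, v.
Qed.

(* Counting the colorings of the middle points turns stacking into a product of
   matrices, from which associativity and unit laws are inherited. *)
Lemma card_middle_coloring (a : {ffun 'I_m -> bool}) (c : {ffun 'I_k -> bool}) :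
  #|[set b : {ffun 'I_n -> bool} | coloring P (glue a b) && coloring Q (glue b c)]| =
  (coloring (stack Q P) (glue a c) * 2 ^ #|closed_components Q P|)%N.
Proof.
have outE (b : 'I_n -> bool) o : stacked_color a b c (outer n o) = glue a c o by case: o.
case: coloringP => [colS|ncol]; last first.
  rewrite mul0n; apply/eqP; rewrite cards_eq0; apply/eqP/setP => b.
  rewrite !inE; apply/negP => /stacked_coloringP con; apply: ncol => x y.
  by rewrite same_block_stack => /con; rewrite !outE.
(* The power of 2 counts the sets [S] of closed components. In [W S] a component reaching the outer
   points inherits their color, and a closed one is colored true exactly when it belongs to [S]; [M]
   is the resulting bijection onto the middle colorings. *)
rewrite mul1n -card_powerset.
pose W (S : {set {set stacked_points m n k}}) u :=
  if [pick o | outer n o \in component Q P u] is Some o then glue a c o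
  else component Q P u \in S.
pose M S := [ffun j => W S (inl (inr j))].
have Wout S o : W S (outer n o) = glue a c o.
  rewrite /W; case: pickP => [o'|/(_ o)]; last by rewrite inE connect0.
  by rewrite inE -same_block_stack => /colS.
have WM S u : stacked_color a (M S) c u = W S u.
  case: u => [[i|j]|l] /=; last 1 first.
  - exact/esym/(Wout S (inr l)).
  - exact/esym/(Wout S (inl i)).
  - by rewrite ffunE.
rewrite -(@card_in_imset _ _ M (powerset _)); last first.
  suff sub (S S' : {set {set stacked_points m n k}}) : S \subset closed_components Q P -> M S = M S' -> S \subset S'.
    move=> S S'; rewrite !inE => cS cS' eM.
    by apply/eqP; rewrite eqEsubset (sub S S') // (sub S' S).
  move=> cS eM; apply/subsetP => C CS.
  have := subsetP cS C CS; rewrite inE => /andP[/imsetP[u _ eC] /forallP cl].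
  case: u => [[i|j]|l] in eC.
  - by have := cl (inl i); rewrite eC inE connect0.
  - have := congr1 (fun f : {ffun _ -> bool} => f j) eM; rewrite !ffunE /W.
    case: pickP => [o|_]; first by rewrite -eC (negPf (cl o)).
    by rewrite -eC CS => <-.
  - by have := cl (inr l); rewrite eC inE connect0.
congr #|pred_of_set _|; apply/setP => b; rewrite inE.
apply/stacked_coloringP/imsetP => [con|[S _ ->] x y cxy]; last first.
  rewrite !WM; move: cxy; rewrite -component_eq /W => /eqP ->.
  by [].
exists [set C in closed_components Q P |
         [exists u, (C == component Q P u) && stacked_color a b c u]].
  by rewrite inE; apply/subsetP => C; rewrite !inE => /andP[].
apply/ffunP => j; rewrite ffunE /W.
case: pickP => [o|nopick].
  by rewrite inE => /con /= ->; rewrite outE.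
rewrite !inE imset_f // andTb.
have -> : [forall o, outer n o \notin component Q P (inl (inr j))].
  by apply/forallP => o; rewrite nopick.
apply/idP/existsP => [bj|[u /andP[]]].
  by exists (inl (inr j)); rewrite eqxx.
by rewrite component_eq => /con /= ->.
Qed.

End StackColoring.

(** The 0-1 matrix of a diagram, with rows indexed by bottom colorings and columns by top
    colorings. *)
Definition weight m n (D : diagram m n) (x : {ffun 'I_m -> bool})
    (y : {ffun 'I_n -> bool}) : nat := coloring D (glue x y).

Lemma weight_stack m n k (Q : diagram n k) (P : diagram m n) x y :
  (\sum_z weight P x z * weight Q z y =
   weight (stack Q P) x y * 2 ^ #|closed_components Q P|)%N.
Proof.
rewrite /weight -card_middle_coloring -sum1_card [RHS]big_mkcond /=.
apply: eq_bigr => z _.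
by rewrite inE; case: (coloring P _); case: (coloring Q _).
Qed.

Lemma weight_false m n (D : diagram m n) :
  weight D [ffun=> false] [ffun=> false] = 1%N.
Proof.
rewrite /weight -[RHS]/(nat_of_bool true); congr nat_of_bool.
apply: etrans (coloring_false D).
by apply: eq_coloring => -[i|i] /=; exact: ffunE.
Qed.

(** The entry at the two all-false colorings is always 1, so it isolates the power of 2; once this
    is cancelled, the matrix determines the diagram. *)
Lemma weight_inj m n (D E : diagram m n) c d :
  (forall x y, weight D x y * 2 ^ c = weight E x y * 2 ^ d)%N -> D = E /\ c = d.
Proof.
move=> eqw.
have ec : c = d.
  have := eqw [ffun=> false] [ffun=> false]; rewrite !weight_false !mul1n => /eqP.
  by rewrite eqn_exp2l // => /eqP.
split=> //; apply: coloring_inj => f.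
pose x := [ffun i => f (inl i)]; pose y := [ffun j => f (inr j)].
have ef : f =1 glue x y by case=> i; rewrite /= ffunE.
rewrite !(eq_coloring _ ef).
have := eqw x y; rewrite ec => /eqP; rewrite eqn_pmul2r ?expn_gt0 // /weight.
by do 2!case: (coloring _ _).
Qed.

Lemma stack_unique m n k (Q : diagram n k) (P : diagram m n) (D : diagram m k) c :
  (forall x y, \sum_z weight P x z * weight Q z y = weight D x y * 2 ^ c)%N ->
  stack Q P = D /\ #|closed_components Q P| = c.
Proof. by move=> eqw; apply: weight_inj => x y; rewrite -weight_stack. Qed.

Lemma stack_assoc m n k l (R : diagram k l) (Q : diagram n k) (P : diagram m n) :
  stack R (stack Q P) = stack (stack R Q) P /\
  (#|closed_components Q P| + #|closed_components R (stack Q P)| =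
   #|closed_components R Q| + #|closed_components (stack R Q) P|)%N.
Proof.
apply: weight_inj => x y.
transitivity (\sum_z \sum_w weight P x w * weight Q w z * weight R z y)%N.
  rewrite addnC expnD mulnA -weight_stack big_distrl /=; apply: eq_bigr => z _.
  by rewrite mulnAC -weight_stack big_distrl.
rewrite addnC expnD mulnA -weight_stack big_distrl exchange_big /=.
apply: eq_bigr => w _; rewrite -mulnA -(weight_stack R Q) big_distrr /=.
by apply: eq_bigr => z _; rewrite mulnA.
Qed.

Lemma same_block_id n (x y : points n n) :
  same_block (id_diagram n) x y =
  (match x with inl i => i | inr i => i end == match y with inl i => i | inr i => i end).
Proof. exact: same_block_fiber. Qed.

Lemma coloring_id n (a b : {ffun 'I_n -> bool}) :
  coloring (id_diagram n) (glue a b) = (a == b).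
Proof.
apply/coloringP/eqP => [col|-> x y].
  by apply/ffunP => i; apply: (col (inl i) (inr i)); rewrite same_block_id.
by rewrite same_block_id; case: x y => i [] j /= /eqP ->.
Qed.

Lemma stack_idl m n (P : diagram m n) :
  stack (id_diagram n) P = P /\ #|closed_components (id_diagram n) P| = 0%N.
Proof.
apply: stack_unique => x y; rewrite muln1 (bigD1 y) //= big1 ?addn0.
  by rewrite /weight coloring_id eqxx muln1.
by move=> z /negPf nzy; rewrite /weight coloring_id nzy muln0.
Qed.

Lemma stack_idr m n (P : diagram m n) :
  stack P (id_diagram m) = P /\ #|closed_components P (id_diagram m)| = 0%N.
Proof.
apply: stack_unique => x y; rewrite muln1 (bigD1 x) //= big1 ?addn0.
  by rewrite /weight coloring_id eqxx mul1n.
by move=> z /negPf nzy; rewrite /weight coloring_id eq_sym nzy.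
Qed.

(** * Closure under stacking *)

Lemma xor_delta (T : finType) (p : pred T) (u : T) :
  \big[addb/false]_(y | p y) (y == u) = p u.
Proof.
rewrite big_mkcond (bigD1 u) //= eqxx big1 ?addbF; first by case: (p u).
by move=> y /negPf ->; case: ifP.
Qed.

Lemma boundary_pos_inj m n : injective (@boundary_pos m n).
Proof.
move=> [i|i] [j|j] /=; have := ltn_ord i; have := ltn_ord j.
- by move=> _ _ ?; congr inl; apply: val_inj.
- by lia.
- by lia.
- by move=> ? ? ?; congr inr; apply: val_inj => /=; lia.
Qed.

(** * Parity of sets of points along the boundary *)

Section EvenOn.
Variables (m n : nat).
Implicit Types (D : diagram m n) (f : points m n -> bool) (x y : points m n).

(** Sets meeting every block evenly: over F_2, the boundaries of families of arcs drawn inside the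
    blocks. *)
Definition even_on D f : Prop :=
  forall x, \big[addb/false]_(y | same_block D x y) f y = false.

Lemma even_on_zero D : even_on D (fun=> false).
Proof. by move=> x; rewrite big1. Qed.

Lemma even_on_add D f g : even_on D f -> even_on D g ->
  even_on D (fun x => f x (+) g x).
Proof. by move=> ef eg x; rewrite big_split /= ef eg. Qed.

Lemma even_on_arc D u v : same_block D u v ->
  even_on D (fun x => (x == u) (+) (x == v)).
Proof.
move=> uv x; rewrite big_split /= !xor_delta.
case: (boolP (same_block D x u)) => [xu|/negP xu].
  by rewrite (same_block_trans xu uv).
case: (boolP (same_block D x v)) => // xv; case: xu.
by apply: same_block_trans xv _; rewrite same_block_sym.
Qed.

Lemma even_on_total D f : even_on D f -> \big[addb/false]_x f x = false.
Proof.
move=> ef; rewrite (partition_big (pblock (blocks D)) predT) //= big1 // => B _.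
case: (pickP (fun x => pblock (blocks D) x == B)) => [x /eqP xB|no].
  rewrite -[RHS](ef x); apply: eq_bigl => y.
  rewrite -xB eq_sym eq_pblock //; first by case/and3P: (valP D).
  by rewrite (cover_partition (valP D)) inE.
by rewrite big_pred0.
Qed.

Lemma planarP D :
  reflect (forall a b c d, boundary_pos a < boundary_pos b ->
     boundary_pos b < boundary_pos c -> boundary_pos c < boundary_pos d ->
     same_block D a c -> same_block D b d -> same_block D a b)%N
    (planar D).
Proof.
apply: (iffP forall_inP) => [pl a b c d ab bc cd ac bd|pl B BD].
  have /forall_inP/(_ _ (block_of_in D b)) := pl _ (block_of_in D a).
  case: (eqVneq (pblock (blocks D) a) (pblock (blocks D) b)) => [e _|_ /negP[]].
    by rewrite /same_block e mem_block_of.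
  apply/exists_inP; exists a; first exact: mem_block_of.
  apply/exists_inP; exists b; first exact: mem_block_of.
  apply/exists_inP; exists c => //.
  by apply/exists_inP; exists d => //; rewrite ab bc cd.
apply/forall_inP => C CD; apply/implyP => neBC; apply/negP.
case/exists_inP => a aB /exists_inP[b bC /exists_inP[c cB /exists_inP[d dC]]].
case/and3P => ab bc cd; case/negP: neBC.
have := pl a b c d ab bc cd.
rewrite (same_blockP _ BD aB) cB (same_blockP _ CD bC) dC => /(_ isT isT).
rewrite (same_blockP _ BD aB) => bB.
have tr : trivIset (blocks D) by case/and3P: (valP D).
by rewrite -(def_pblock tr BD bB) (def_pblock tr CD bC).
Qed.

(** By planarity, a block other than that of x and y lies either entirely between x and y or
    entirely outside. It thus contributes an even number of points between them, and the block of x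
    and y contributes none. *)
Lemma planar_parity D f x y : planar D -> even_on D f -> same_block D x y ->
    (forall v, same_block D x v -> f v = false) ->
  \big[addb/false]_(v | boundary_pos v < boundary_pos x) f v =
  \big[addb/false]_(v | boundary_pos v < boundary_pos y) f v.
Proof.
wlog ltxy : x y / (boundary_pos x <= boundary_pos y)%N => [wl|] pl ef xy fx.
  case: (leqP (boundary_pos x) (boundary_pos y)) => le; first exact: wl.
  apply/esym/wl => //; first exact: ltnW.
    by rewrite same_block_sym.
  by move=> v yv; apply: fx; apply: same_block_trans xy yv.
have add_eq0 (p q : bool) : p (+) q = false -> p = q by case: p q => [] [].
apply: add_eq0.
pose f' v := f v && (boundary_pos x < boundary_pos v < boundary_pos y)%N.
suff ef' : even_on D f'.
  rewrite -[RHS](even_on_total ef') [X in X (+) _]big_mkcond [X in _ (+) X]big_mkcond.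
  rewrite -big_split /=; apply: eq_bigr => v _.
  rewrite /f'; case: (ltngtP (boundary_pos v) (boundary_pos x)) => vx /=.
  - by rewrite (leq_trans vx ltxy) addbb andbF.
  - by case: ifP => //; rewrite ?andbT ?andbF.
  - have -> : f v = false.
      by rewrite (boundary_pos_inj vx) fx // same_block_refl.
    by case: ifP.
move=> z; case: (boolP (same_block D x z)) => [xz|nxz].
  by rewrite big1 // => w zw; rewrite /f' fx //; apply: same_block_trans xz zw.
case: (pickP (fun w => same_block D z w && (boundary_pos x < boundary_pos w < boundary_pos y)%N)); last first.
  by move=> no; rewrite big1 // => w zw; move: (no w); rewrite zw /f' /= => ->; rewrite andbF.
move=> w0 /andP[zw0 /andP[xw0 w0y]].
rewrite -[RHS](ef z); apply: eq_bigr => w zw; rewrite /f'.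
suff -> : (boundary_pos x < boundary_pos w < boundary_pos y)%N by rewrite andbT.
have w0w : same_block D w0 w by apply: same_block_trans zw; rewrite same_block_sym.
have xw : ~~ same_block D x w.
  apply: contra nxz => xw; apply: same_block_trans xw _; by rewrite same_block_sym.
have xw0n : ~~ same_block D x w0.
  apply: contra nxz => xw'; apply: same_block_trans xw' _; by rewrite same_block_sym.
apply/andP; split; rewrite ltnNge; apply/negP => le.
  case: (ltngtP (boundary_pos w) (boundary_pos x)) le => // wx _; last first.
    by move: xw; rewrite (boundary_pos_inj wx) same_block_refl.
  case/negP: xw; rewrite same_block_sym; move/planarP: pl; apply; [exact: wx|exact: xw0|exact: w0y| |by []].
  by rewrite same_block_sym.
case: (ltngtP (boundary_pos w) (boundary_pos y)) le => // wy _; last first.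
  by move: xw; rewrite (boundary_pos_inj wy) xy.
case/negP: xw0n; move/planarP: pl; apply; [exact: xw0|exact: w0y|exact: wy| |by []].
by [].
Qed.

End EvenOn.

Section Shapes.
Variables (m n : nat) (D : diagram m n).

Definition no_three : Prop := forall x y z,
  same_block D x y -> same_block D x z -> [|| x == y, x == z | y == z].

Definition no_single : Prop := forall x, exists2 y, y != x & same_block D x y.

Definition no_same_bottom : Prop :=
  forall i j : 'I_m, same_block D (inl i) (inl j) -> i = j.

Definition no_same_top : Prop :=
  forall i j : 'I_n, same_block D (inr i) (inr j) -> i = j.

Lemma no_same_side_no_three : no_same_bottom -> no_same_top -> no_three.
Proof.
move=> nb nt x y z xy xz.
have yz : same_block D y z by apply: same_block_trans xz; rewrite same_block_sym.
case: x xy xz yz => i; case: y => j; case: z => l xy xz yz;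
  by rewrite ?(nb _ _ xy) ?(nb _ _ xz) ?(nb _ _ yz) ?(nt _ _ xy) ?(nt _ _ xz)
    ?(nt _ _ yz) !eqxx ?orbT.
Qed.

(** An even subset of a block with at most two points is empty or the whole block, hence constant on
    it. *)
Lemma even_on_coloring f : no_three -> even_on D f -> coloring D f.
Proof.
move=> n3 ef; apply/coloringP => x y xy.
case: (eqVneq x y) => [-> //|xney].
have := ef x; rewrite (bigD1 x) ?same_block_refl //= (bigD1 y) /=; last first.
  by rewrite xy eq_sym.
rewrite big1 ?addbF; first by case: (f x); case: (f y).
move=> z /andP[/andP[xz zx] zy]; move: (n3 _ _ _ xy xz).
by rewrite (negPf xney) eq_sym (negPf zx) eq_sym (negPf zy).
Qed.

Lemma coloring_even_on f : no_three -> no_single -> coloring D f -> even_on D f.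
Proof.
move=> n3 n1 /coloringP cf x; have [y yx xy] := n1 x.
rewrite (bigD1 x) ?same_block_refl //= (bigD1 y) /=; last by rewrite xy yx.
rewrite big1 ?addbF; first by rewrite (cf _ _ xy) addbb.
move=> z /andP[/andP[xz zx] zy]; move: (n3 _ _ _ xy xz).
by rewrite eq_sym (negPf yx) eq_sym (negPf zx) eq_sym (negPf zy).
Qed.

(** The only bottom point of a block has nothing on the bottom to cancel against. *)
Lemma even_on_bottom f : no_same_bottom -> even_on D f ->
  (forall j, f (inr j) = false) -> forall i, f (inl i) = false.
Proof.
move=> nb ef ft i; have := ef (inl i).
rewrite (bigD1 (inl i)) ?same_block_refl //= big1 ?addbF // => -[j|j] //.
by case/andP => /nb ->; rewrite eqxx.
Qed.

Lemma even_on_top f : no_same_top -> even_on D f ->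
  (forall i, f (inl i) = false) -> forall j, f (inr j) = false.
Proof.
move=> nt ef fb i; have := ef (inr i).
rewrite (bigD1 (inr i)) ?same_block_refl //= big1 ?addbF // => -[j|j] //.
by case/andP => /nt ->; rewrite eqxx.
Qed.

End Shapes.

Lemma xor_left_of_bottom m n (F : points m n -> bool) (i : 'I_m) :
  \big[addb/false]_(v | boundary_pos v < boundary_pos (inl i : points m n)) F v =
  \big[addb/false]_(i' : 'I_m | i' < i) F (inl i').
Proof.
rewrite big_sumType /= [X in _ (+) X]big_pred0 ?addbF // => j.
by have := ltn_ord i; lia.
Qed.

Lemma xor_left_of_top m n (F : points m n -> bool) (j : 'I_n) :
  \big[addb/false]_(v | boundary_pos v < boundary_pos (inr j : points m n)) F v =
  \big[addb/false]_(i : 'I_m) F (inl i) (+)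
    \big[addb/false]_(j' : 'I_n | j < j') F (inr j').
Proof.
rewrite big_sumType /=; congr (_ (+) _); apply: eq_bigl => i.
  by have := ltn_ord i; lia.
by have := ltn_ord i; have := ltn_ord j; lia.
Qed.

Section StackShapes.
Variables (m n k : nat) (Q : diagram n k) (P : diagram m n).
Notation connected := (connect (stacked_edge Q P)).

(** The boundary of a pair of chains, one per strip: at a glued middle point both contributions add
    modulo 2. *)
Definition glued_sum (f : points m n -> bool) (g : points n k -> bool)
    (x : stacked_points m n k) : bool :=
  match x with
  | inl (inl i) => f (inl i)
  | inl (inr j) => f (inr j) (+) g (inl j)
  | inr l => g (inr l)
  end.

(* Chains with coefficients in F_2: a path from a to b is a sum of arcs inside
   the blocks of P and Q, with boundary a + b. *)
Lemma connect_chain a b : connected a b ->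
  exists f g, [/\ even_on P f, even_on Q g,
    glued_sum f g =1 (fun x => (x == a) (+) (x == b)),
    forall u, f u -> connected a (lower k u)
    & forall u, g u -> connected a (upper m u)].
Proof.
case/connectP => p + ->; elim/last_ind: p => [|p c IHp] /= pth.
  exists (fun=> false), (fun=> false); split=> //; try exact: even_on_zero.
  by move=> x; rewrite addbb; case: x => [[]|].
move: pth; rewrite rcons_path last_rcons => /andP[pth ebc].
have [f [g [ef eg bfg sf sg]]] := IHp pth.
have cab : connected a (last a p) by apply/connectP; exists p.
move: (last a p) cab ebc bfg => b' cab ebc bfg {IHp pth p}.
have cac : connected a c by apply: connect_trans cab (connect1 ebc).
case/stacked_edgeP: ebc => -[u [v [eb ec uv]]].
  exists (fun x => f x (+) ((x == u) (+) (x == v))), g; split=> //.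
  - exact/even_on_add/even_on_arc.
  - move=> x; transitivity (glued_sum f g x (+) ((x == b') (+) (x == c))).
      rewrite eb ec.
      by case: x => [[i|j]|l]; case: u {eb uv} => u; case: v {ec} => v /=;
        rewrite ?addbF // addbAC.
    by rewrite bfg; case: (x == b'); case: (x == a); case: (x == c).
  move=> x; case fx: (f x) => /=; first by move=> _; apply: sf.
  case: (eqVneq x u) => [-> _|_]; first by rewrite -eb.
  by case: (eqVneq x v) => [-> _|//]; rewrite -ec.
exists f, (fun x => g x (+) ((x == u) (+) (x == v))); split=> //.
- exact/even_on_add/even_on_arc.
- move=> x; transitivity (glued_sum f g x (+) ((x == b') (+) (x == c))).
    rewrite eb ec.
    by case: x => [[i|j]|l]; case: u {eb uv} => u; case: v {ec} => v /=;
      rewrite ?addbF ?addbA.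
  by rewrite bfg; case: (x == b'); case: (x == a); case: (x == c).
move=> x; case gx: (g x) => /=; first by move=> _; apply: sg.
case: (eqVneq x u) => [-> _|_]; first by rewrite -eb.
by case: (eqVneq x v) => [-> _|//]; rewrite -ec.
Qed.

Lemma outer_eq (x y : points m k) : (outer n x == outer n y) = (x == y).
Proof. by case: x y => [i|i] [j|j]. Qed.

(** A path from x to y gives even sets with boundary {x, y}. In blocks of at most two points these
    are colorings, and they agree on the middle, where the boundary vanishes. Together they are
    constant on the component, yet true at x and false at any third outer point z. *)
Lemma no_three_stack : no_three P -> no_three Q -> no_three (stack Q P).
Proof.
move=> n3P n3Q x y z; rewrite !same_block_stack => cxy cxz.
apply/negPn/negP; rewrite !negb_or => /and3P[xy xz yz].
have [f [g [ef eg bfg _ _]]] := connect_chain cxy.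
have mid j : f (inr j) = g (inl j).
  have := bfg (inl (inr j)); case: (x) => a; case: (y) => b /=;
  by case: (f _); case: (g _).
pose w := stacked_color (fun i => f (inl i)) (fun j => f (inr j)) (fun l => g (inr l)).
have := @stacked_coloringP m n k Q P (fun i => f (inl i)) (fun j => f (inr j))
  (fun l => g (inr l)).
rewrite (@eq_coloring _ _ _ _ f); last by case.
rewrite (even_on_coloring n3P ef) (@eq_coloring _ _ _ _ g); last by case.
rewrite (even_on_coloring n3Q eg) => /elimT/(_ isT _ _ cxz).
have wE o : w (outer n o) = glued_sum f g (outer n o) by case: o.
rewrite -/w !wE !bfg !outer_eq eqxx (negPf xy) eq_sym (negPf xz).
by rewrite eq_sym (negPf yz).
Qed.

(** With blocks of exactly two points, the indicator of a component is even in both strips. The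
    middle points are counted twice and cancel, so a component has an even number of outer
    points. *)
Lemma no_single_stack : no_three P -> no_single P -> no_three Q -> no_single Q ->
  no_single (stack Q P).
Proof.
move=> n3P n1P n3Q n1Q x.
case: (pickP (fun y => (y != x) && same_block (stack Q P) x y)) => [y|alone].
  by case/andP; exists y.
pose h := connected (outer n x).
have hedge u v : stacked_edge Q P u v -> h u = h v.
  move=> uv; apply/idP/idP => hu; apply: connect_trans hu _; last first.
    by rewrite connect_stacked_sym; apply: connect1.
  exact: connect1.
have hP : even_on P (fun u => h (lower k u)).
  apply: coloring_even_on => //; apply/coloringP => u v uv.
  by apply/hedge/stacked_edgeP; left; exists u, v.
have hQ : even_on Q (fun u => h (upper m u)).
  apply: coloring_even_on => //; apply/coloringP => u v uv.
  by apply/hedge/stacked_edgeP; right; exists u, v.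
have tot : \big[addb/false]_(o : points m k) h (outer n o) = false.
  have := even_on_total hP; have := even_on_total hQ; rewrite !big_sumType /=.
  by do 3!case: (\big[_/_]_i _).
move: tot; rewrite (bigD1 x) //= {1}/h connect0 big1 //.
move=> y yx; move: (alone y); rewrite yx /= same_block_stack.
by rewrite /h => ->.
Qed.

(** A chain joining two bottom points has no boundary on the top of [Q], hence none on the middle
    points and then none on the bottom of [P]: the two points coincide. *)
Lemma no_same_bottom_stack : no_same_bottom P -> no_same_bottom Q ->
  no_same_bottom (stack Q P).
Proof.
move=> nP nQ a b; rewrite same_block_stack => /connect_chain.
case=> f [g [ef eg bfg _ _]].
have g0 j : g (inl j) = false.
  by apply: (even_on_bottom nQ eg) => l; apply: (bfg (inr l)).
have f0 := even_on_bottom nP ef.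
have := bfg (inl (inl a)); rewrite /= f0 ?eqxx => [|j].
  by case: (eqVneq (inl (inl a) : stacked_points m n k) (inl (inl b))) => // -[].
by have := bfg (inl (inr j)); rewrite /= g0 addbF.
Qed.

Lemma no_same_top_stack : no_same_top P -> no_same_top Q ->
  no_same_top (stack Q P).
Proof.
move=> nP nQ a b; rewrite same_block_stack => /connect_chain.
case=> f [g [ef eg bfg _ _]].
have f0 j : f (inr j) = false.
  by apply: (even_on_top nP ef) => l; apply: (bfg (inl (inl l))).
have g0 := even_on_top nQ eg.
have := bfg (inr a); rewrite /= g0 ?eqxx => [|j].
  by case: (eqVneq (inr a : stacked_points m n k) (inr b)) => // -[].
by have := bfg (inl (inr j)); rewrite /= f0.
Qed.

(* Two crossing components are separated by a parity: the number of ends, to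
   the left of a point, of the arcs of a path joining two points of the other
   component. *)
Lemma planar_stack : planar P -> planar Q -> planar (stack Q P).
Proof.
move=> plP plQ; apply/planarP => a b c d ab bc cd.
rewrite !same_block_stack => cac cbd; apply/negPn/negP => nab.
have [f [g [ef eg bfg sf sg]]] := connect_chain cac.
have off y : connected (outer n b) y -> ~~ connected (outer n a) y.
  move=> cby; apply: contra nab => cay; apply: connect_trans cay _.
  by rewrite connect_stacked_sym.
pose sP (u : points m n) : bool := \big[addb/false]_(v | boundary_pos v < boundary_pos u) f v.
pose sQ (u : points n k) : bool := \big[addb/false]_(v | boundary_pos v < boundary_pos u) g v.
pose S (x : stacked_points m n k) : bool :=
  match x with inl (inl i) => sP (inl i) | inl (inr j) => sP (inr j)
  | inr l => sQ (inr l) end.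
have bmid j : f (inr j) = g (inl j).
  have := bfg (inl (inr j)); case: (a) => a'; case: (c) => c' /=;
  by case: (f _); case: (g _).
have totf : \big[addb/false]_i f (inl i) = \big[addb/false]_j f (inr j).
  have := even_on_total ef; rewrite big_sumType /=.
  by do 2!case: (\big[_/_]_i _).
(* The two strips traverse the middle line in opposite directions. As [f] has even total, counting
   from either side gives the same parity at a middle point off the path. *)
have mid j : connected (outer n b) (inl (inr j)) -> sQ (inl j) = sP (inr j).
  move=> /off nj.
  have fj : f (inr j) = false by apply/negP => /sf; apply/negP.
  rewrite /sQ /sP xor_left_of_bottom xor_left_of_top totf.
  rewrite [LHS](eq_bigr (fun l => f (inr l))) => [|l _]; last by rewrite bmid.
  rewrite [in RHS](bigID (fun l : 'I_n => l < j)) /= -addbA.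
  rewrite [X in _ = _ (+) (X (+) _)](bigD1 j) ?ltnn //= fj addFb.
  rewrite [X in _ = _ (+) (X (+) _)](eq_bigl (fun l : 'I_n => j < l)).
    by rewrite addbb addbF.
  by move=> l; rewrite -leqNgt [RHS]ltn_neqAle andbC eq_sym.
have Slow u : S (lower k u) = sP u by case: u.
have Sup u : connected (outer n b) (upper m u) -> S (upper m u) = sQ u.
  by case: u => //= j /mid.
(* The chain lives on the component of a, so it vanishes on every block met by the component of b,
   and the parity is transported along each edge. *)
have Scon y : connected (outer n b) y -> S y = S (outer n b).
  case/connectP => p + ->; elim/last_ind: p => //= p z IHp.
  rewrite rcons_path last_rcons => /andP[pth e]; rewrite -(IHp pth).
  have cb : connected (outer n b) (last (outer n b) p) by apply/connectP; exists p.
  have cz : connected (outer n b) z by apply: connect_trans cb (connect1 e).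
  move: (last _ p) cb e {pth IHp} => y' cb e.
  case/stacked_edgeP: (e) => -[u [v [eb ec uv]]].
    rewrite eb ec !Slow; apply: esym; apply: (planar_parity plP ef uv) => w uw.
    apply/negP => /sf; apply/negP/off; apply: connect_trans cb (connect1 _).
    by rewrite eb; apply/stacked_edgeP; left; exists u, w.
  rewrite eb ec !Sup -?eb -?ec //; apply: esym; apply: (planar_parity plQ eg uv) => w uw.
  apply/negP => /sg; apply/negP/off; apply: connect_trans cb (connect1 _).
  by rewrite eb; apply/stacked_edgeP; right; exists u, w.
pose e o := glued_sum f g (outer n o).
have Sout o : S (outer n o) =
    \big[addb/false]_(o' | boundary_pos o' < boundary_pos o) e o'.
  case: o => [i|l]; rewrite /S /= /sP /sQ ?xor_left_of_bottom ?xor_left_of_top //.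
  congr (_ (+) _); rewrite -[RHS]/(\big[addb/false]_i f (inl i)) totf.
  exact/esym/eq_bigr.
have Sdelta o : S (outer n o) =
    (boundary_pos a < boundary_pos o) (+) (boundary_pos c < boundary_pos o).
  rewrite Sout (eq_bigr (fun o' => (o' == a) (+) (o' == c))).
    by rewrite big_split /= !xor_delta.
  by move=> o' _; rewrite /e bfg !outer_eq.
(* The parity is odd at b, which lies between a and c, and even at d, which lies beyond both. *)
have := Scon _ cbd; rewrite !Sdelta ab (ltn_trans ab (ltn_trans bc cd)).
by rewrite cd ltnNge (ltnW bc).
Qed.

End StackShapes.

(** * The five classes in terms of related points *)

Lemma class_no_three m n (D : diagram m n) :
  [forall B in blocks D, (#|B| == 1) || (#|B| == 2)] <-> no_three D.
Proof.
split=> [/forall_inP sz x y z xy xz|n3].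
  apply/negPn/negP; rewrite !negb_or => /and3P[nxy nxz nyz].
  have := sz _ (block_of_in D x).
  suff : 2 < #|pblock (blocks D) x| by case: #|_| => [|[|[]]].
  by apply/card_gt2P; exists x, y, z; split; split; rewrite ?mem_block_of // eq_sym.
apply/forall_inP => B BD; have [x xB] := block_nonempty BD.
have : 0 < #|B| by apply/card_gt0P; exists x.
case: (leqP #|B| 2); first by case: #|_| => [|[|[]]].
case/card_gt2P => a [b [c [[aB bB cB] [ab bc ca]]]].
have := n3 a b c; rewrite !(same_blockP _ BD aB) => /(_ bB cB).
by rewrite (negPf ab) (negPf bc) eq_sym (negPf ca).
Qed.

Lemma class_no_same_bottom m n (D : diagram m n) :
  [forall B in blocks D, bottom_size B <= 1] <-> no_same_bottom D.
Proof.
split=> [/forall_inP sz i j ij|nb].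
  have /card_le1_eqP := sz _ (block_of_in D (inl i)).
  by apply; rewrite inE // mem_block_of.
apply/forall_inP => B BD; apply/card_le1_eqP => i j; rewrite !inE => iB jB.
by apply/esym/nb; rewrite (same_blockP _ BD iB).
Qed.

Lemma class_no_same_top m n (D : diagram m n) :
  [forall B in blocks D, top_size B <= 1] <-> no_same_top D.
Proof.
split=> [/forall_inP sz i j ij|nb].
  have /card_le1_eqP := sz _ (block_of_in D (inr i)).
  by apply; rewrite inE // mem_block_of.
apply/forall_inP => B BD; apply/card_le1_eqP => i j; rewrite !inE => iB jB.
by apply/esym/nb; rewrite (same_blockP _ BD iB).
Qed.

Lemma class_no_single m n (D : diagram m n) :
  [forall B in blocks D, 2 <= #|B|] <-> no_single D.
Proof.
split=> [/forall_inP sz x|n1].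
  have := sz _ (block_of_in D x); rewrite (cardsD1 x) mem_block_of add1n ltnS.
  by case/card_gt0P => y; rewrite !inE => /andP[yx xy]; exists y.
apply/forall_inP => B BD; have [x xB] := block_nonempty BD.
have [y yx xy] := n1 x; apply/card_gt1P; exists x, y; split=> //.
  by rewrite -(same_blockP _ BD xB).
by rewrite eq_sym.
Qed.

Lemma forall_blocks_and m n (D : diagram m n) (p q : pred {set points m n}) :
  [forall B in blocks D, p B && q B] =
  [forall B in blocks D, p B] && [forall B in blocks D, q B].
Proof.
apply/forall_inP/andP => [pq|[/forall_inP p' /forall_inP q'] B BD].
  by split; apply/forall_inP => B /pq /andP[].
by rewrite p' // q'.
Qed.

Lemma motzkinP m n (D : diagram m n) : motzkin _ _ D <-> planar D /\ no_three D.
Proof.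
rewrite /motzkin /= /motzkin_mem -class_no_three.
by split=> [/andP[]|[-> ->]].
Qed.

Lemma temperley_liebP m n (D : diagram m n) :
  temperley_lieb _ _ D <-> [/\ planar D, no_three D & no_single D].
Proof.
rewrite /temperley_lieb /= /temperley_lieb_mem.
split=> [/andP[-> /forall_inP sz]|].
  split=> //; [apply/class_no_three|apply/class_no_single];
    by apply/forall_inP => B /sz /eqP ->.
case=> -> /class_no_three/forall_inP sz1 /class_no_single/forall_inP sz2.
apply/forall_inP => B BD.
by have := sz1 _ BD; have := sz2 _ BD; case: #|B| => [|[|]].
Qed.

Lemma planar_rookP m n (D : diagram m n) :
  planar_rook _ _ D <-> [/\ planar D, no_same_bottom D & no_same_top D].
Proof.
rewrite /planar_rook /= /planar_rook_mem !forall_blocks_and.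
split=> [/and4P[-> _ /class_no_same_bottom nb /class_no_same_top nt]|[-> nb nt]] //.
apply/and4P; split=> //; [|exact/class_no_same_bottom|exact/class_no_same_top].
exact/class_no_three/no_same_side_no_three.
Qed.

Lemma planar_symmetricP m n (D : diagram m n) : planar_symmetric _ _ D <->
  [/\ planar D, no_same_bottom D, no_same_top D & no_single D].
Proof.
rewrite /planar_symmetric /= /planar_symmetric_mem !forall_blocks_and.
split=> [/and3P[-> /forall_inP sb /forall_inP st]|[-> nb nt n1]].
  split=> //.
  - by apply/class_no_same_bottom/forall_inP => B /sb /eqP ->.
  - by apply/class_no_same_top/forall_inP => B /st /eqP ->.
  apply/class_no_single/forall_inP => B BD.
  have /cards1P[i /setP/(_ i)] := sb _ BD; rewrite !inE eqxx => iB.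
  have /cards1P[j /setP/(_ j)] := st _ BD; rewrite !inE eqxx => jB.
  by apply/card_gt1P; exists (inl i), (inr j).
have bt B : B \in blocks D -> (bottom_size B <= 1) && (top_size B <= 1).
  move=> BD; move/class_no_same_bottom/forall_inP: nb => -> //.
  by move/class_no_same_top/forall_inP: nt => ->.
have pos B : B \in blocks D -> (0 < bottom_size B) && (0 < top_size B).
  move=> BD; move/class_no_single/forall_inP: n1 => /(_ _ BD) /card_gt1P.
  move=> [x [y [xB yB xy]]].
  have xy' : same_block D x y by rewrite (same_blockP _ BD xB).
  case: x xB xy xy' => i iB xy xy'; case: y yB xy xy' => j jB xy xy'.
  - by rewrite (nb _ _ xy') eqxx in xy.
  - by apply/andP; split; apply/card_gt0P; [exists i|exists j]; rewrite inE.
  - by apply/andP; split; apply/card_gt0P; [exists j|exists i]; rewrite inE.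
  - by rewrite (nt _ _ xy') eqxx in xy.
apply/and3P; split=> //; apply/forall_inP => B BD;
  by move: (bt _ BD) (pos _ BD) => /andP[? ?] /andP[? ?]; rewrite eqn_leq; apply/andP.
Qed.

Definition stack_closed (K : diagram_class) : Prop :=
  forall m n k (Q : diagram n k) (P : diagram m n), K _ _ Q -> K _ _ P -> K _ _ (stack Q P).

Lemma planar_partition_stack : stack_closed planar_partition.
Proof. by move=> m n k Q P plQ plP; exact: planar_stack plP plQ. Qed.

Lemma motzkin_stack : stack_closed motzkin.
Proof.
move=> m n k Q P /motzkinP[? ?] /motzkinP[? ?]; apply/motzkinP.
by split; [apply: planar_stack|apply: no_three_stack].
Qed.

Lemma temperley_lieb_stack : stack_closed temperley_lieb.
Proof.
move=> m n k Q P /temperley_liebP[? ? ?] /temperley_liebP[? ? ?].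
apply/temperley_liebP.
by split; [apply: planar_stack|apply: no_three_stack|apply: no_single_stack].
Qed.

Lemma planar_rook_stack : stack_closed planar_rook.
Proof.
move=> m n k Q P /planar_rookP[? ? ?] /planar_rookP[? ? ?]; apply/planar_rookP.
by split; [apply: planar_stack|apply: no_same_bottom_stack|apply: no_same_top_stack].
Qed.

Lemma planar_symmetric_stack : stack_closed planar_symmetric.
Proof.
move=> m n k Q P /planar_symmetricP[? bQ tQ ?] /planar_symmetricP[? bP tP ?].
apply/planar_symmetricP; split; [exact: planar_stack| | |].
- exact: no_same_bottom_stack.
- exact: no_same_top_stack.
by apply: no_single_stack => //; apply: no_same_side_no_three.
Qed.

(** * Factoring a diagram through fewer points *)

Section Factor.
Variables (k' k l : nat) (D : diagram k l).
Variables (h : 'I_k' -> 'I_k) (rho : 'I_k -> 'I_k).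
Hypothesis h_mono : forall i j : 'I_k', i < j -> h i < h j.
Hypothesis rho_mono : forall i j : 'I_k, i <= j -> rho i <= rho j.
Hypothesis rho_h : forall j, rho (h j) = h j.
Hypothesis rho_idem : forall i, rho (rho i) = rho i.

(** The map [rho] retracts the bottom points to representatives inside their blocks, and [h] lists
    in increasing order those which stay connected upwards. The instances are the deletion of an
    isolated point, the merging of two neighbours, and the removal of a block formed by two
    neighbours. *)
Definition bottom_map (x : points k k') : 'I_k :=
  match x with inl i => rho i | inr j => h j end.

Definition bottom_factor : diagram k k' := fiber_diagram bottom_map.

Definition top_map (x : points k' l) : points k l :=
  match x with inl j => inl (h j) | inr j => inr j end.

Definition top_factor : diagram k' l :=
  fiber_diagram (fun x => pblock (blocks D) (top_map x)).

Lemma same_block_bottom_factor x y :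
  same_block bottom_factor x y = (bottom_map x == bottom_map y).
Proof. exact: same_block_fiber. Qed.

Lemma same_block_top_factor x y :
  same_block top_factor x y = same_block D (top_map x) (top_map y).
Proof.
rewrite same_block_fiber eq_pblock //; first by case/and3P: (valP D).
by rewrite (cover_partition (valP D)) inE.
Qed.

Lemma h_inj : injective h.
Proof.
move=> i j /(congr1 val) /= hij; apply: val_inj.
by case: (ltngtP i j) => // /h_mono; rewrite hij ltnn.
Qed.

Lemma top_map_inj : injective top_map.
Proof. by move=> [i|i] [j|j] //= [] => [/h_inj|] ->. Qed.

Lemma planar_bottom_factor : planar bottom_factor.
Proof.
have h_le (i j : 'I_k') : i <= j -> h i <= h j.
  by rewrite leq_eqVlt => /predU1P[/val_inj -> //|/h_mono /ltnW].
have up (i j : 'I_k) : i < j -> rho i <= rho j by move/ltnW/rho_mono.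
have dn (i j : 'I_k') : k + (k' - i.+1) < k + (k' - j.+1) -> h j <= h i.
  by move=> ij; apply: h_le; have := ltn_ord i; have := ltn_ord j; lia.
apply/planarP => a b c d ab bc cd; rewrite !same_block_bottom_factor.
move=> /eqP ac /eqP bd; rewrite -val_eqE /= eqn_leq.
case: b ab bc bd => b ab bc bd.
  case: a ac ab => a ac ab; last by move: ab => /=; have := ltn_ord b; lia.
  rewrite [X in X && _](up _ _ ab) andTb.
  case: c ac bc cd => c ac bc cd; first by rewrite ac; apply: up.
  case: d bd cd => d bd cd; first by move: cd => /=; have := ltn_ord d; lia.
  by rewrite ac bd; apply: dn.
case: c ac bc cd => c ac bc cd; first by move: bc => /=; have := ltn_ord c; lia.
case: d bd cd => d bd cd; first by move: cd => /=; have := ltn_ord d; lia.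
by rewrite ac [X in X && _](dn _ _ bc) bd andTb; apply: dn.
Qed.

Lemma planar_top_factor : planar D -> planar top_factor.
Proof.
move=> /planarP pl; apply/planarP => a b c d ab bc cd.
rewrite !same_block_top_factor.
have mono x y : boundary_pos x < boundary_pos y ->
    boundary_pos (top_map x) < boundary_pos (top_map y).
  case: x y => [i|i] [j|j] /=; have := ltn_ord i; have := ltn_ord j; last 1 first.
  - by lia.
  - by move=> _ _; apply: h_mono.
  - by have := ltn_ord (h i); lia.
  - by lia.
by apply: pl; apply: mono; eassumption.
Qed.

Lemma no_three_top_factor : no_three D -> no_three top_factor.
Proof.
move=> n3 x y z; rewrite !same_block_top_factor => xy xz.
by have := n3 _ _ _ xy xz; rewrite !(inj_eq top_map_inj).
Qed.

Lemma no_same_bottom_top_factor : no_same_bottom D -> no_same_bottom top_factor.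
Proof. by move=> nb i j; rewrite same_block_top_factor => /nb /h_inj. Qed.

Lemma no_same_top_top_factor : no_same_top D -> no_same_top top_factor.
Proof. by move=> nt i j; rewrite same_block_top_factor => /nt. Qed.

Hypothesis D_rho : forall i, same_block D (inl i) (inl (rho i)).
Hypothesis D_lost : forall i, rho i \notin codom h ->
  forall y, same_block D (inl i) y -> exists2 i', y = inl i' & rho i' = rho i.

Lemma stack_factor :
  stack top_factor bottom_factor = D /\
  #|closed_components top_factor bottom_factor| = 0.
Proof.
apply: stack_unique => a b; pose z0 := [ffun j => a (h j)].
rewrite muln1 (bigD1 z0) //= big1 ?addn0 => [|z /eqP nz]; last first.
  rewrite {1}/weight; case: coloringP => // col; case: nz.
  apply/ffunP => j; rewrite ffunE; apply/esym/(col (inl (h j)) (inr j)).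
  by rewrite same_block_bottom_factor /= rho_h.
rewrite /weight mulnb; congr nat_of_bool.
apply/andP/coloringP => [[/coloringP colV /coloringP colD'] u v uv|col].
  have a_rho i : a i = a (rho i).
    by apply: (colV (inl i) (inl (rho i))); rewrite same_block_bottom_factor /= rho_idem.
  (* Either x lies in a fiber of [rho] missed by [h], which is a whole block of [D], or it is
     related to a point which the top factor still sees. *)
  have good x : (exists2 i, x = inl i & rho i \notin codom h) \/
      (exists2 x', same_block D x (top_map x') & glue a b x = glue z0 b x').
    case: x => [i|j]; last by right; exists (inr j); rewrite ?same_block_refl.
    case: (boolP (rho i \in codom h)) => [/codomP[j ej]|]; last by left; exists i.
    right; exists (inl j); first by rewrite /= -ej.
    by rewrite /= ffunE -ej.
  case: (good u) => [[i eu lost]|[u' uu' ->]].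
    move: uv; rewrite eu => /(D_lost lost)[i' -> ei] /=.
    by rewrite a_rho -ei -a_rho.
  case: (good v) => [[i ev lost]|[v' vv' ->]].
    move: uv; rewrite same_block_sym ev => /(D_lost lost)[i' eu ei].
    move: uu'; rewrite eu => uu'.
    case: u' uu' => [j|j] uu'.
      have := D_lost; move=> /(_ i' _ _ uu') []; first by rewrite ei.
      by move=> i2 [<-]; rewrite rho_h ei => ej; case/codomP: lost; exists j.
    by have := D_lost; move=> /(_ i' _ _ uu') []; first by rewrite ei.
  apply: colD'; rewrite same_block_top_factor.
  apply: same_block_trans vv'; apply: same_block_trans uv.
  by rewrite same_block_sym.
split; apply/coloringP => x y.
  rewrite same_block_bottom_factor => /eqP exy.
  have val x' : glue a z0 x' = a (bottom_map x').
    by case: x' => [i|j] /=; [apply: (col _ _ (D_rho i))|rewrite ffunE].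
  by rewrite !val exy.
rewrite same_block_top_factor => /col.
have val x' : glue a b (top_map x') = glue z0 b x' by case: x' => //= j; rewrite ffunE.
by rewrite !val.
Qed.

End Factor.

(** * Factorization of non-identity endomorphisms *)

(** Excluding closed components makes the composite equal to [D] with coefficient 1, whatever the
    value of t. *)
Definition factors_through (K : diagram_class) k k' (D : diagram k k) : Prop :=
  exists (U : diagram k' k) (V : diagram k k'),
    [/\ K _ _ U, K _ _ V, stack U V = D & #|closed_components U V| = 0].

Definition thin (K : diagram_class) : Prop :=
  forall k (D : diagram k k), K _ _ D -> D <> id_diagram k ->
  exists2 k', k' < k & factors_through K k' D.

Section NonIdentity.
Variables (k : nat) (D : diagram k k).
Hypothesis plD : planar D.

Definition isolated (i : 'I_k) : Prop :=
  forall x, same_block D (inl i) x -> x = inl i.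

Definition adjacent (i j : 'I_k) : Prop :=
  (j = i.+1 :> nat) /\ same_block D (inl i) (inl j).

(** Induction on the distance of two related bottom points i < j. The point after i is neither
    isolated nor related to i, so planarity traps its block strictly between i and j, where it
    yields a closer related pair. *)
Lemma no_same_bottom_of_no_adjacent :
  (forall i, ~ isolated i) -> (forall i j, ~ adjacent i j) -> no_same_bottom D.
Proof.
move=> niso nadj.
have ptn i : exists2 x, x != inl i & same_block D (inl i) x.
  case: (pickP (fun x => (x != inl i) && same_block D (inl i) x)) => [x /andP[? ?]|no].
    by exists x.
  case: (niso i) => x ix; apply/eqP/negPn/negP => ne.
  by move: (no x); rewrite ne ix.
suff lt d (i j : 'I_k) : j - i <= d -> i < j -> ~~ same_block D (inl i) (inl j).
  move=> i j ij; apply: val_inj => /=; case: (ltngtP i j) => // ne.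
    by move: (lt _ _ _ (leqnn _) ne); rewrite ij.
  by move: (lt _ _ _ (leqnn _) ne); rewrite same_block_sym ij.
elim: d i j => [|d IHd] i j; first by lia.
move=> dij ltij; apply/negP => ij.
have i1k : i.+1 < k by apply: leq_ltn_trans ltij (ltn_ord j).
pose i1 : 'I_k := Ordinal i1k.
have nadj_i : ~~ same_block D (inl i) (inl i1) by apply/negP => ?; apply: (nadj i i1).
have ltj : i1 < j.
  rewrite ltn_neqAle ltij andbT; apply: contra nadj_i => /eqP e.
  by rewrite (_ : i1 = j) //; apply: val_inj.
have sj x : same_block D (inl i1) x -> ~~ same_block D (inl j) x.
  move=> ix; apply: contra nadj_i => jx; apply: same_block_trans ij _.
  by apply: same_block_trans jx _; rewrite same_block_sym.
have [x xi1 i1x] := ptn i1.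
have [lt_x|ge_x] := ltnP (boundary_pos (inl j : points k k)) (boundary_pos x).
  by case/negP: nadj_i; apply: (elimT (planarP D) plD _ _ (inl j) x) => //.
case: x xi1 i1x ge_x => x xi1 i1x ge_x; last first.
  by move: ge_x => /=; have := ltn_ord j; lia.
move: ge_x => /= xj.
have [ltx|gex] := ltnP i1 x.
  have le_d : x - i1 <= d by move: dij xj ltx => /=; lia.
  by have := IHd i1 x le_d ltx; rewrite i1x.
have xne : x != i1 by apply: contra xi1 => /eqP ->.
have ltx : x < i1 by rewrite ltn_neqAle gex andbT.
have lex : x <= i by move: ltx.
case: (ltngtP x i) lex => // [ltxi|exi] _; last first.
  by case/negP: nadj_i; rewrite same_block_sym (_ : i = x) //; apply: val_inj.
have xi : same_block D (inl x) (inl i).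
  apply: (elimT (planarP D) plD _ _ (inl i1) (inl j)) => //=.
  by rewrite same_block_sym.
by case/negP: nadj_i; rewrite same_block_sym; apply: same_block_trans i1x xi.
Qed.

Lemma increasing_ord_id (t : 'I_k -> 'I_k) :
  (forall i j : 'I_k, i < j -> t i < t j) -> forall i, t i = i.
Proof.
move=> tm.
have ge (d : nat) (i : 'I_k) : i = d :> nat -> d <= t i.
  elim: d i => // d IHd i ei.
  have dk : d < k by apply: leq_ltn_trans (ltn_ord i); rewrite ei.
  apply: leq_ltn_trans (IHd (Ordinal dk) erefl) _; apply: tm.
  by rewrite ei.
have le (d : nat) (i : 'I_k) : k - i.+1 = d -> t i + d < k.
  elim: d i => [|d IHd] i ei; first by rewrite addn0.
  have ik : i.+1 < k by lia.
  have := IHd (Ordinal ik); rewrite /= => /(_ ltac:(lia)).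
  by have : t i < t (Ordinal ik) by [apply: tm => /=]; lia.
move=> i; apply: val_inj => /=; have := ge _ i erefl; have := le _ i erefl.
by have := ltn_ord i; lia.
Qed.

(** Each bottom point is related to some top point. Planarity makes this matching strictly
    increasing, and the only strictly increasing self-map of k points is the identity. *)
Lemma planar_no_same_bottom_id :
  no_same_bottom D -> (forall i, ~ isolated i) -> D = id_diagram k.
Proof.
move=> nb niso.
have top i : exists j, same_block D (inl i) (inr j).
  case: (pickP (fun j => same_block D (inl i) (inr j))) => [j ?|no]; first by exists j.
  case: (niso i) => -[i' /nb -> //|j]; by rewrite no.
pose t i := xchoose (top i).
have tP i : same_block D (inl i) (inr (t i)) := xchooseP (top i).
have tm (i j : 'I_k) : i < j -> t i < t j.
  move=> ij; have tij : t i <> t j.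
    move=> e; have /nb eij : same_block D (inl i) (inl j).
      by apply: same_block_trans (tP i) _; rewrite e same_block_sym.
    by move: ij; rewrite eij ltnn.
  rewrite ltnNge; apply/negP; rewrite leq_eqVlt => /predU1P[e|ji].
    by case: tij; apply/esym/val_inj.
  suff /nb eij : same_block D (inl i) (inl j) by move: ij; rewrite eij ltnn.
  apply: (elimT (planarP D) plD _ _ (inr (t i)) (inr (t j))) => //=.
    by have := ltn_ord j; lia.
  by have := ltn_ord (t i); have := ltn_ord (t j); lia.
have it i : same_block D (inl i) (inr i) by rewrite -{2}(increasing_ord_id tm i).
pose lev (x : points k k) := match x with inl i => i | inr i => i end.
have toB x : same_block D x (inl (lev x)).
  by case: x => i /=; rewrite ?same_block_refl // same_block_sym.
apply: same_block_inj => x y; rewrite same_block_id -/(lev x) -/(lev y).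
apply/idP/eqP => [xy|e].
  apply: nb; apply: same_block_trans (toB y); apply: same_block_trans xy.
  by rewrite same_block_sym.
by apply: same_block_trans (toB x) _; rewrite e same_block_sym.
Qed.

Lemma non_identity_cases : D <> id_diagram k ->
  (exists i, isolated i) \/ (exists i j, adjacent i j).
Proof.
move=> Did.
pose iso i := [forall x, same_block D (inl i) x ==> (x == inl i)].
pose adj (i j : 'I_k) := (j == i.+1 :> nat) && same_block D (inl i) (inl j).
case: (pickP iso) => [i /forallP isoi|niso].
  by left; exists i => x ix; apply/eqP; move/implyP: (isoi x); apply.
case: (pickP (fun p => adj p.1 p.2)) => [[i j] /andP[/eqP ? ?]|nadj].
  by right; exists i, j.
have niso' i : ~ isolated i.
  move=> isoi; move/negP: (niso i); apply; apply/forallP => x; apply/implyP.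
  by move/isoi => ->.
case: Did; apply: planar_no_same_bottom_id => //.
apply: no_same_bottom_of_no_adjacent => // i j [eij ij].
by move: (nadj (i, j)); rewrite /adj /= eij eqxx ij.
Qed.

End NonIdentity.

Lemma lift_mono k (i : 'I_k) (a b : 'I_k.-1) : a < b -> lift i a < lift i b.
Proof. by rewrite /= /bump => ab; lia. Qed.

Lemma notin_codom_lift k (i x : 'I_k) : x \notin codom (lift i) -> x = i.
Proof.
move=> no; case: (unliftP i x) => [j ej|//].
by case/codomP: no; exists j.
Qed.

Section IsolatedFactor.
Variables (k : nat) (D : diagram k k) (i : 'I_k).
Hypothesis iso : isolated D i.

Definition delete_bottom : diagram k k.-1 := bottom_factor (lift i) id.
Definition deleted : diagram k.-1 k := top_factor D (lift i).

Lemma stack_deleted : stack deleted delete_bottom = D /\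
  #|closed_components deleted delete_bottom| = 0.
Proof.
apply: stack_factor => // [x|x /notin_codom_lift -> y /iso ->].
  exact: same_block_refl.
by exists i.
Qed.

Lemma planar_delete_bottom : planar delete_bottom.
Proof. by apply: planar_bottom_factor => //; apply: lift_mono. Qed.

Lemma no_same_bottom_delete : no_same_bottom delete_bottom.
Proof. by move=> a b; rewrite same_block_bottom_factor => /eqP. Qed.

Lemma no_same_top_delete : no_same_top delete_bottom.
Proof. by move=> a b; rewrite same_block_bottom_factor => /eqP /lift_inj. Qed.

Lemma no_three_delete : no_three delete_bottom.
Proof. exact: no_same_side_no_three no_same_bottom_delete no_same_top_delete. Qed.

Lemma isolated_factors (K : diagram_class) : K _ _ delete_bottom -> K _ _ deleted ->
  exists2 k', k' < k & factors_through K k' D.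
Proof.
move=> Kb Kt; exists k.-1; first by have := ltn_ord i; lia.
by have [eD c0] := stack_deleted; exists deleted, delete_bottom.
Qed.

End IsolatedFactor.

Section AdjacentFactor.
Variables (k : nat) (D : diagram k k) (i j : 'I_k).
Hypothesis adj : adjacent D i j.

Let eij : j = i.+1 :> nat. Proof. by case: adj. Qed.
Let Dij : same_block D (inl i) (inl j). Proof. by case: adj. Qed.

(** Bottom point i is retracted to its neighbour j, which survives; one point is saved and no block
    is lost. *)
Lemma merge_factors :
  exists k' (U : diagram k' k) (V : diagram k k'),
    [/\ k' < k, planar D -> planar U, planar V, stack U V = D &
     #|closed_components U V| = 0].
Proof.
pose rho x := if x == i then j else x.
have jh : j \in codom (lift i).
  apply/negPn/negP => /notin_codom_lift e; move: eij; rewrite e; lia.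
have rho_mono (a b : 'I_k) : a <= b -> rho a <= rho b.
  rewrite /rho; case: (eqVneq a i) => [->|ai]; case: (eqVneq b i) => [->|bi] //.
    by move: bi; rewrite eij -val_eqE /=; lia.
  by move: ai; rewrite eij -val_eqE /=; lia.
have rho_h a : rho (lift i a) = lift i a.
  by rewrite /rho eq_sym (negPf (neq_lift i a)).
have rho_idem a : rho (rho a) = rho a.
  rewrite /rho; case: (eqVneq a i) => [_|/negPf -> //].
  by case: eqP.
have D_rho a : same_block D (inl a) (inl (rho a)).
  by rewrite /rho; case: (eqVneq a i) => [->|_] //; exact: same_block_refl.
exists k.-1, (top_factor D (lift i)), (bottom_factor (lift i) rho).
have [|eD c0] := @stack_factor _ _ _ D (lift i) rho rho_h rho_idem D_rho.
  move=> a; rewrite /rho; case: (eqVneq a i) => [_|ai].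
    by rewrite jh.
  by move/notin_codom_lift => e; rewrite e eqxx in ai.
split=> //; first by have := ltn_ord i; lia.
  exact/planar_top_factor/lift_mono.
by apply: planar_bottom_factor => //; apply: lift_mono.
Qed.

Hypothesis n3D : no_three D.

(** Here i and j form a whole block. Merging them would give the lower factor a block of three
    points; instead both are dropped, and the block becomes a cap of the lower factor, whose blocks
    then all have two points. *)
Lemma cap_factors :
  exists k' (U : diagram k' k) (V : diagram k k'),
    [/\ k' < k, stack U V = D & #|closed_components U V| = 0] /\
    [/\ planar D -> planar U, no_three U, no_single D -> no_single U,
     planar V & no_three V /\ no_single V].
Proof.
have k2 : k = k.-2.+2 by have := ltn_ord j; lia.
(* From i on, [h] jumps two ahead and so skips i and its successor j, while [rho] retracts j to i:
   the fiber {i, j} is the one missed by [h]. *)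
have hlt (a : 'I_k.-2) : a + 2 * (i <= a) < k by have := ltn_ord a; lia.
pose h a := Ordinal (hlt a).
pose rho x := if x == j then i else x.
have h_mono (a b : 'I_k.-2) : a < b -> h a < h b by move=> /= ab; lia.
have hne a : (h a != i) && (h a != j).
  by rewrite -!val_eqE /=; have := eij; lia.
have codh (x : 'I_k) : x != i -> x != j -> x \in codom h.
  rewrite -!val_eqE /= eij => xi xj; apply/codomP.
  have xk : x - 2 * (i <= x) < k.-2 by have := ltn_ord x; have := ltn_ord j; lia.
  by exists (Ordinal xk); apply: val_inj => /=; lia.
have rho_mono (a b : 'I_k) : a <= b -> rho a <= rho b.
  rewrite /rho; case: (eqVneq a j) => [->|ai]; case: (eqVneq b j) => [->|bi] //.
    by rewrite eij; lia.
  by move: ai; rewrite -val_eqE /= eij; lia.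
have rho_h a : rho (h a) = h a.
  by rewrite /rho; have /andP[_ /negPf ->] := hne a.
have nij : i != j by rewrite -val_eqE /= eij; lia.
have rho_idem a : rho (rho a) = rho a.
  rewrite /rho; case: (eqVneq a j) => [_|/negPf -> //].
  by rewrite (negPf nij).
have D_rho a : same_block D (inl a) (inl (rho a)).
  by rewrite /rho; case: (eqVneq a j) => [->|_]; rewrite ?same_block_refl // same_block_sym.
have blk y : same_block D (inl i) y -> y = inl i \/ y = inl j.
  move=> iy; have := n3D Dij iy.
  by case/or3P => /eqP; [case=> e; rewrite e eqxx in nij|left|right].
exists k.-2, (top_factor D h), (bottom_factor h rho).
have [|eD c0] := @stack_factor _ _ _ D h rho rho_h rho_idem D_rho.
  move=> a lost y ay.
  have ra : rho a = i.
    apply/eqP/negPn/negP => ri; case/negP: lost; apply: codh => //.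
    by rewrite /rho; case: (eqVneq a j) => [_|//].
  have iy : same_block D (inl i) y.
    by rewrite -ra; apply: same_block_trans ay; rewrite same_block_sym.
  rewrite ra; case: (blk _ iy) => ->; [exists i|exists j] => //;
    by rewrite /rho ?eqxx // (negPf nij).
split; split=> //.
- by have := ltn_ord j; lia.
- exact: planar_top_factor.
- exact: no_three_top_factor.
- move=> n1 x; have [y yx xy] := n1 (top_map h x).
  have : exists y', y = top_map h y'.
    case: y yx xy => [y|y] yx xy; last by exists (inr y).
    case: (boolP (y \in codom h)) => [/codomP[y' ->]|no]; first by exists (inl y').
    have iy : same_block D (inl i) (inl y).
      case: (eqVneq y i) => [->|yi]; first exact: same_block_refl.
      case: (eqVneq y j) => [-> //|yj].
      by rewrite codh in no.
    have : same_block D (inl i) (top_map h x).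
      by apply: same_block_trans iy _; rewrite same_block_sym.
    by case/blk; case: (x) => // x' [ex]; have := hne x'; rewrite ex eqxx ?andbF.
  case=> y' ey; exists y'.
    by rewrite ey in yx; apply: contra yx => /eqP ->.
  by rewrite same_block_top_factor -ey.
- exact: planar_bottom_factor.
split.
  have key (x y : points k k.-2) : same_block (bottom_factor h rho) x y ->
      bottom_map h rho x = bottom_map h rho y.
    by rewrite same_block_bottom_factor => /eqP.
  have hi := h_inj h_mono.
  move=> x y z /key xy /key xz; have yz := etrans (esym xy) xz.
  have rr (a b : 'I_k) : rho a = rho b -> (a == b) || (rho a == i).
    rewrite /rho; case: (eqVneq a j) => [->|aj]; first by rewrite eqxx orbT.
    by case: (eqVneq b j) => [-> ->|_ ->]; rewrite eqxx ?orbT.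
  have ri a : rho a = i -> (a == i) || (a == j).
    by rewrite /rho; case: (eqVneq a j) => [_ _|_ ->]; rewrite ?eqxx ?orbT.
  have hr a b : rho a = h b -> (a == h b).
    rewrite /rho; case: (eqVneq a j) => [_ e|_ -> //].
    by have := hne b; rewrite -e eqxx.
  case: x xy xz => x xy xz; case: y xy yz => y xy yz; case: z xz yz => z xz yz /=;
    rewrite ?(inj_eq inl_inj) ?(inj_eq inr_inj) ?orbF ?orFb.
  - case/orP: (rr _ _ xy) => [-> //|/eqP rx].
    have := ri _ rx; have := ri _ (etrans (esym xy) rx); have := ri _ (etrans (esym xz) rx).
    by do 3!case/orP => /eqP ->; rewrite !eqxx ?orbT.
  - by rewrite (eqP (hr _ _ xz)) (eqP (hr _ _ yz)) eqxx.
  - by rewrite (eqP (hr _ _ xy)) (eqP (hr _ _ (esym yz))) eqxx ?orbT.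
  - by rewrite (hi _ _ yz) eqxx ?orbT.
  - by rewrite (eqP (hr _ _ (esym xy))) (eqP (hr _ _ (esym xz))) eqxx ?orbT.
  - by rewrite (hi _ _ xz) eqxx ?orbT.
  - by rewrite (hi _ _ xy) eqxx.
  - by rewrite (hi _ _ xy) eqxx.
move=> x; have [y [ny ey]] : exists y, y != x /\ bottom_map h rho x = bottom_map h rho y.
  case: x => [x|x]; last by exists (inl (h x)); rewrite /= rho_h.
  case: (eqVneq x i) => [->|xi].
    exists (inl j); split; first by rewrite (inj_eq inl_inj) eq_sym.
    by rewrite /= /rho eqxx (negPf nij).
  case: (eqVneq x j) => [->|xj].
    exists (inl i); split; first by rewrite (inj_eq inl_inj).
    by rewrite /= /rho eqxx (negPf nij).
  case/codomP: (codh _ xi xj) => x' ->; exists (inr x').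
  by rewrite /= rho_h.
by exists y => //; rewrite same_block_bottom_factor ey.
Qed.

End AdjacentFactor.

Lemma thin_planar_partition : thin planar_partition.
Proof.
move=> k D plD Did.
case: (non_identity_cases plD Did) => [[i iso]|[i [j adj]]].
  apply: (isolated_factors iso); first exact: planar_delete_bottom.
  exact/planar_top_factor/plD/lift_mono.
have [k' [U [V [ltk plU plV eD c0]]]] := merge_factors adj.
by exists k' => //; exists U, V; split=> //; apply: plU.
Qed.

Lemma thin_motzkin : thin motzkin.
Proof.
move=> k D /motzkinP[plD n3] Did.
case: (non_identity_cases plD Did) => [[i iso]|[i [j adj]]].
  apply: (isolated_factors iso); apply/motzkinP; split.
  - exact: planar_delete_bottom.
  - exact: no_three_delete.
  - exact/planar_top_factor/plD/lift_mono.
  - exact/no_three_top_factor/n3/lift_mono.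
have [k' [U [V [[ltk eD c0] [plU n3U _ plV [n3V _]]]]]] := cap_factors adj n3.
by exists k' => //; exists U, V; split=> //; apply/motzkinP; split=> //; apply: plU.
Qed.

Lemma thin_temperley_lieb : thin temperley_lieb.
Proof.
move=> k D /temperley_liebP[plD n3 n1] Did.
case: (non_identity_cases plD Did) => [[i iso]|[i [j adj]]].
  by have [y yi /iso ey] := n1 (inl i); rewrite ey eqxx in yi.
have [k' [U [V [[ltk eD c0] [plU n3U n1U plV [n3V n1V]]]]]] := cap_factors adj n3.
exists k' => //; exists U, V; split=> //; apply/temperley_liebP; split=> //.
  exact: plU.
exact: n1U.
Qed.

Lemma thin_planar_rook : thin planar_rook.
Proof.
move=> k D /planar_rookP[plD nb nt] Did.
case: (non_identity_cases plD Did) => [[i iso]|[i [j [eij /nb e]]]].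
  apply: (isolated_factors iso); apply/planar_rookP; split.
  - exact: planar_delete_bottom.
  - exact: no_same_bottom_delete.
  - exact: no_same_top_delete.
  - exact/planar_top_factor/plD/lift_mono.
  - exact/no_same_bottom_top_factor/nb/lift_mono.
  - exact: no_same_top_top_factor.
by move: eij; rewrite e; lia.
Qed.

(** Vacuous: an isolated bottom point and a pair of related neighbours are both excluded in this
    class, so the identity is its only endomorphism. *)
Lemma thin_planar_symmetric : thin planar_symmetric.
Proof.
move=> k D /planar_symmetricP[plD nb nt n1] Did.
case: (non_identity_cases plD Did) => [[i iso]|[i [j [eij /nb e]]]].
  by have [y yi /iso ey] := n1 (inl i); rewrite ey eqxx in yi.
by move: eij; rewrite e; lia.
Qed.

(** * The linear category *)

Local Open Scope ring_scope.

(* Locked, so that unification never unfolds a composite into a sum. *)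
Fact cmp_key : unit. Proof. exact: tt. Qed.

Definition cmp (F : fieldType) (t : F) m n k (g : hom F n k) (f : hom F m n) : hom F m k :=
  locked_with cmp_key (@comp F t m n k) g f.

Section CompLinear.
Variables (F : fieldType) (t : F).
Local Notation "g ** f" := (cmp t g f) (at level 39, left associativity).

Lemma comp_linear_r m n k (g : hom F n k) : linear (comp t g : hom F m n -> hom F m k).
Proof.
move=> a f f'; rewrite /comp scaler_sumr -big_split /=; apply: eq_bigr => Q _.
rewrite scaler_sumr -big_split /=; apply: eq_bigr => P _.
by rewrite scalerA -scalerDl !ffunE mulrDr mulrDl -!mulrA; congr ((_ + _) *: _); rewrite mulrCA.
Qed.

Lemma comp_linear_l m n k (f : hom F m n) :
  linear (fun g : hom F n k => comp t g f : hom F m k).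
Proof.
move=> a g g'; rewrite /comp scaler_sumr -big_split /=; apply: eq_bigr => Q _.
rewrite scaler_sumr -big_split /=; apply: eq_bigr => P _.
by rewrite scalerA -scalerDl !ffunE mulrDl mulrDl -!mulrA.
Qed.

Lemma cmpE m n k (g : hom F n k) (f : hom F m n) : comp t g f = g ** f.
Proof. by rewrite /cmp unlock. Qed.

Lemma cmp_diagram_hom m n k (Q : diagram n k) (P : diagram m n) :
  diagram_hom F Q ** diagram_hom F P =
  t ^+ #|closed_components Q P| *: diagram_hom F (stack Q P).
Proof. by rewrite -cmpE comp_diagram_hom. Qed.

Lemma cmp_linear_r m n k (g : hom F n k) : linear (cmp t g : hom F m n -> hom F m k).
Proof. by move=> a f f'; rewrite -!cmpE; apply: comp_linear_r. Qed.

Definition cmp_l m n k (f : hom F m n) (g : hom F n k) : hom F m k := g ** f.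

Lemma cmp_linear_l m n k (f : hom F m n) : linear (cmp_l f : hom F n k -> hom F m k).
Proof. by move=> a g g'; rewrite /cmp_l -!cmpE; apply: comp_linear_l. Qed.

HB.instance Definition _ m n k (g : hom F n k) :=
  GRing.isLinear.Build F (hom F m n) (hom F m k) _ (cmp t g) (@cmp_linear_r m n k g).

HB.instance Definition _ m n k (f : hom F m n) :=
  GRing.isLinear.Build F (hom F n k) (hom F m k) _ (cmp_l f) (@cmp_linear_l m n k f).

Lemma cmp_sumr m n k I (r : seq I) (p : pred I) (g : hom F n k) (f : I -> hom F m n) :
  g ** (\sum_(i <- r | p i) f i) = \sum_(i <- r | p i) g ** f i.
Proof. exact: linear_sum. Qed.

Lemma cmp_suml m n k I (r : seq I) (p : pred I) (g : I -> hom F n k) (f : hom F m n) :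
  (\sum_(i <- r | p i) g i) ** f = \sum_(i <- r | p i) g i ** f.
Proof. exact: (linear_sum (cmp_l f)). Qed.

Lemma cmpZr m n k a (g : hom F n k) (f : hom F m n) : g ** (a *: f) = a *: g ** f.
Proof. exact: linearZ. Qed.

Lemma cmpZl m n k a (g : hom F n k) (f : hom F m n) : (a *: g) ** f = a *: g ** f.
Proof. exact: (linearZZ (cmp_l f)). Qed.

Lemma cmpDr m n k (g : hom F n k) (f f' : hom F m n) :
  g ** (f + f') = g ** f + g ** f'.
Proof. exact: linearD. Qed.

Lemma cmpDl m n k (g g' : hom F n k) (f : hom F m n) :
  (g + g') ** f = g ** f + g' ** f.
Proof. exact: (linearD (cmp_l f)). Qed.

Lemma cmp0r m n k (g : hom F n k) : g ** (0 : hom F m n) = 0.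
Proof. exact: linear0. Qed.

Lemma cmp0l m n k (f : hom F m n) : (0 : hom F n k) ** f = 0.
Proof. exact: (linear0 (cmp_l f)). Qed.

Lemma hom_basis m n (f : hom F m n) : f = \sum_D f D *: diagram_hom F D.
Proof.
apply/ffunP => D; rewrite sum_ffunE (bigD1 D) //= big1 => [|E /negPf nED].
  by rewrite addr0 !ffunE eqxx [RHS]mulr1.
by rewrite !ffunE eq_sym nED [LHS]mulr0.
Qed.

Lemma cmp_assoc m n k l (h : hom F k l) (g : hom F n k) (f : hom F m n) :
  h ** (g ** f) = h ** g ** f.
Proof.
rewrite (hom_basis f) !cmp_sumr; apply: eq_bigr => P _.
rewrite (hom_basis g) cmp_suml !cmp_sumr cmp_suml; apply: eq_bigr => Q _.
rewrite (hom_basis h) !cmp_suml; apply: eq_bigr => R _.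
rewrite !(cmpZl, cmpZr) !cmp_diagram_hom !(cmpZl, cmpZr) !cmp_diagram_hom.
have [-> eqc] := stack_assoc R Q P.
rewrite !scalerA; congr (_ *: _).
have {}eqc : t ^+ #|closed_components Q P| * t ^+ #|closed_components R (stack Q P)| =
    t ^+ #|closed_components R Q| * t ^+ #|closed_components (stack R Q) P|.
  by rewrite -!exprD eqc.
move: (t ^+ _) (t ^+ _) (t ^+ _) (t ^+ _) eqc => a b c d eqc.
ring: eqc.
Qed.

Lemma cmp_idl m n (f : hom F m n) : id_hom F n ** f = f.
Proof.
rewrite [f in LHS]hom_basis cmp_sumr [RHS]hom_basis; apply: eq_bigr => D _.
rewrite cmpZr cmp_diagram_hom; have [-> ->] := stack_idl D.
by rewrite expr0 scale1r.
Qed.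

Lemma cmp_idr m n (f : hom F m n) : f ** id_hom F m = f.
Proof.
rewrite [f in LHS]hom_basis cmp_suml [RHS]hom_basis; apply: eq_bigr => D _.
rewrite cmpZl cmp_diagram_hom; have [-> ->] := stack_idr D.
by rewrite expr0 scale1r.
Qed.

Variable K : diagram_class.

Lemma hom_spaceP m n (f : hom F m n) :
  reflect (forall D, f D != 0 -> K _ _ D) (f \in hom_space F K m n).
Proof.
apply: (iffP idP) => [fK D|fK].
  apply: contraR => nD; apply/eqP.
  rewrite (coord_span (X := in_tuple _) fK) sum_ffunE big1 // => i _.
  have : (in_tuple [seq diagram_hom F E | E <- enum (@class_mem K m n)])`_i \in
      [seq diagram_hom F E | E <- enum (@class_mem K m n)] by apply: mem_nth.
  case/mapP => E; rewrite mem_enum => KE ->; rewrite !ffunE.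
  by case: eqP => [eDE|_]; [rewrite eDE in nD; case/negP: nD|rewrite [LHS]mulr0].
rewrite (hom_basis f); apply: memv_suml => D _.
case: (eqVneq (f D) 0) => [->|/fK KD]; first by rewrite scale0r mem0v.
by apply/memvZ/memv_span/map_f; rewrite mem_enum.
Qed.

Lemma diagram_hom_in m n (D : diagram m n) :
  K _ _ D -> diagram_hom F D \in hom_space F K m n.
Proof. by move=> KD; apply/memv_span/map_f; rewrite mem_enum. Qed.

Lemma dim_hom_space m n : \dim (hom_space F K m n) = #|@class_mem K m n|.
Proof.
suff /eqP -> : free [seq diagram_hom F D | D <- enum (@class_mem K m n)].
  by rewrite size_map -cardE.
set s := enum _; rewrite -[map _ _]/(val (in_tuple [seq diagram_hom F D | D <- s])).
apply/freeP => c c0 i.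
have ltis (j : 'I_(size [seq diagram_hom F D | D <- s])) : (j < size s)%N.
  by have := ltn_ord j; rewrite [X in (_ < X)%N -> _]size_map.
pose D0 : diagram m n := fiber_diagram (fun=> tt).
have := congr1 (fun f : hom F m n => f (nth D0 s i)) c0.
rewrite sum_ffunE (bigD1 i) //= big1 => [|j nji]; last first.
  rewrite (nth_map D0) // !ffunE nth_uniq ?enum_uniq //.
  by rewrite eq_sym val_eqE (negPf nji) [LHS]mulr0.
by rewrite (nth_map D0) // !ffunE eqxx addr0 [LHS]mulr1.
Qed.

Hypothesis Kstack : stack_closed K.

Lemma cmp_in m n k (g : hom F n k) (f : hom F m n) :
  g \in hom_space F K n k -> f \in hom_space F K m n ->
  g ** f \in hom_space F K m k.
Proof.
move=> /hom_spaceP gK /hom_spaceP fK; rewrite -cmpE; apply: memv_suml => Q _; apply: memv_suml => P _.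
case: (eqVneq (g Q) 0) => [->|/gK KQ]; first by rewrite !mul0r scale0r mem0v.
case: (eqVneq (f P) 0) => [->|/fK KP]; first by rewrite mulr0 mul0r scale0r mem0v.
exact/memvZ/diagram_hom_in/Kstack.
Qed.

End CompLinear.

(** * Primitive idempotents of a semisimple algebra *)

(** Cauchy-Schwarz for the sizes of the fibers of f. It serves for summands sorted by level and for
    words sorted by total height or by number of true letters. *)
Lemma square_card_le (T C : finType) (f : T -> C) :
  (#|T| ^ 2 <= #|C| * #|[set p : T * T | f p.1 == f p.2]|)%N.
Proof.
pose N c := #|[set x | f x == c]|.
have cT : #|T| = (\sum_c N c)%N.
  rewrite -sum1_card (partition_big f predT) //=; apply: eq_bigr => c _.
  by rewrite /N -sum1_card; apply: eq_bigl => x; rewrite inE.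
have cP : #|[set p : T * T | f p.1 == f p.2]| = (\sum_c N c ^ 2)%N.
  rewrite -sum1_card (partition_big (fun p => f p.1) predT) //=; apply: eq_bigr => c _.
  rewrite expnS expn1 -cardsX -sum1_card; apply: eq_bigl => -[x y].
  by rewrite !inE /=; case: (eqVneq (f x) c) => [->|_]; rewrite ?andbT ?andbF // eq_sym.
rewrite cT cP -(leq_pmul2l (ltn0Sn 1)) expnS expn1 big_distrl /=.
under eq_bigr do rewrite big_distrr /=.
have -> : (2 * (#|C| * \sum_c N c ^ 2) = \sum_c \sum_d (N c ^ 2 + N d ^ 2))%N.
  under [RHS]eq_bigr do rewrite big_split /=.
  rewrite big_split /= [X in (_ = _ + X)%N]exchange_big /=.
  rewrite mul2n addnn; congr _.*2; rewrite big_distrr; apply: eq_bigr => c _.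
  by rewrite sum_nat_const.
rewrite big_distrr /=; apply: leq_sum => c _; rewrite big_distrr /=.
by apply: leq_sum => d _; apply: nat_Cauchy.
Qed.

Lemma dim_projections (F : fieldType) (V : vectType F) (W : {vspace V}) k
    (p : 'I_k -> 'End(V)) :
  (forall a x, x \in W -> p a x \in W) ->
  (forall a x, x \in W -> p a (p a x) = p a x) ->
  (forall a c x, a != c -> x \in W -> p a (p c x) = 0) ->
  (forall x, x \in W -> \sum_a p a x = x) ->
  \dim W = (\sum_a \dim (p a @: W)%VS)%N.
Proof.
move=> pW pp po ps.
have -> : W = (\sum_a p a @: W)%VS.
  apply/eqP; rewrite eqEsubv; apply/andP; split; last first.
    by apply/subv_sumP => a _; apply/subvP => _ /memv_imgP[x xW ->]; apply: pW.
  apply/subvP => x xW; rewrite -(ps x xW); apply: memv_sumr => a _.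
  exact: memv_img.
rewrite {1}(_ : \dim (\sum_a p a @: W)%VS = \sum_a \dim (p a @: W)%VS)%N.
  apply: eq_bigr => a _; congr (\dim (_ @: _)%VS).
  apply/eqP; rewrite eqEsubv; apply/andP; split; last first.
    by apply/subv_sumP => b _; apply/subvP => _ /memv_imgP[x xW ->]; apply: pW.
  apply/subvP => x xW; rewrite -(ps x xW); apply: memv_sumr => b _.
  exact: memv_img.
apply/directvP/directv_sum_independent => u uP u0 a _.
have pu b c : p b (u c) = if b == c then u c else 0.
  have /memv_imgP[x xW ->] := uP c isT.
  by case: eqVneq => [->|bc]; [rewrite pp|rewrite po].
have := congr1 (p a) u0; rewrite linear_sum linear0 /= (bigD1 a) //= big1.
  by rewrite addr0 pu eqxx.
by move=> c ca; rewrite pu eq_sym (negPf ca).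
Qed.

Section SemisimpleAlgebra.
Variables (F : closedFieldType) (V : vectType F) (mul : V -> V -> V) (one : V).
Variable (H : {vspace V}).
Local Notation "x ** y" := (mul x y) (at level 39, left associativity).
Hypothesis mul_assoc : forall x y z, x ** (y ** z) = x ** y ** z.
Hypothesis mul_linear_r : forall x, linear (mul x).
Definition mul_by y x : V := x ** y.
Hypothesis mul_linear_l : forall y, linear (mul_by y).
Hypothesis one_l : forall x, one ** x = x.
Hypothesis one_r : forall x, x ** one = x.
Hypothesis one_in : one \in H.
Hypothesis mul_in : forall x y, x \in H -> y \in H -> x ** y \in H.
Hypothesis regular : forall x, x \in H -> exists2 y, y \in H & x ** y ** x = x.

HB.instance Definition _ x := GRing.isLinear.Build F V V _ (mul x) (mul_linear_r x).
HB.instance Definition _ y := GRing.isLinear.Build F V V _ (mul_by y) (mul_linear_l y).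

Let mul0 x : x ** 0 = 0. Proof. exact: linear0. Qed.
Let zmul y : 0 ** y = 0. Proof. exact: (linear0 (mul_by y)). Qed.
Let mulDr x y z : x ** (y + z) = x ** y + x ** z. Proof. exact: linearD. Qed.
Let mulDl x y z : (y + z) ** x = y ** x + z ** x.
Proof. exact: (linearD (mul_by x)). Qed.
Let mulBr x y z : x ** (y - z) = x ** y - x ** z. Proof. exact: linearB. Qed.
Let mulBl x y z : (y - z) ** x = y ** x - z ** x.
Proof. exact: (linearB (mul_by x)). Qed.
Let mulZr x a y : x ** (a *: y) = a *: (x ** y). Proof. exact: linearZ. Qed.
Let mulZl x a y : (a *: y) ** x = a *: (y ** x).
Proof. exact: (linearZZ (mul_by x)). Qed.
Let mul_sumr I (r : seq I) (p : pred I) x (f : I -> V) :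
  x ** (\sum_(i <- r | p i) f i) = \sum_(i <- r | p i) x ** f i.
Proof. exact: linear_sum. Qed.
Let mul_suml I (r : seq I) (p : pred I) x (f : I -> V) :
  (\sum_(i <- r | p i) f i) ** x = \sum_(i <- r | p i) f i ** x.
Proof. exact: (linear_sum (mul_by x)). Qed.

Definition idem_in e : Prop := e \in H /\ e ** e = e.

Definition primitive e : Prop :=
  [/\ e \in H, e ** e = e, e != 0 &
   forall g h, idem_in g -> idem_in h -> g ** h = 0 -> h ** g = 0 -> g + h = e ->
     g = 0 \/ h = 0].

Lemma primitive_idem e : primitive e -> idem_in e.
Proof. by case. Qed.

Lemma primitive_sub e g : primitive e -> idem_in g -> e ** g = g -> g ** e = g ->
  g != 0 -> g = e.
Proof.
case=> eH ee e0 ep [gH gg] eg ge g0.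
have hh : (e - g) ** (e - g) = e - g.
  by rewrite mulBl !mulBr ee eg ge gg subrr subr0.
case: (ep g (e - g)); rewrite ?mulBr ?mulBl ?eg ?ge ?gg ?subrr //.
- by split=> //; apply: memvB.
- by rewrite addrC subrK.
- by move=> ge0; rewrite ge0 eqxx in g0.
by move/eqP; rewrite subr_eq0 => /eqP.
Qed.

(** Schur's lemma. If x z x = x and y = f z e, then x y and y x are nonzero idempotents below e and
    f, and primitivity forces equality. *)
Lemma primitive_invert e f x : primitive e -> primitive f ->
  x \in H -> e ** x = x -> x ** f = x -> x != 0 ->
  exists y, [/\ y \in H, f ** y = y, y ** e = y, x ** y = e & y ** x = f].
Proof.
move=> pe pf xH ex xf x0.
have [[eH ee] [fH ff]] := (primitive_idem pe, primitive_idem pf).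
have [z zH xzx] := regular xH.
pose y := f ** z ** e.
have yH : y \in H by rewrite !mul_in.
have xyx : x ** y ** x = x.
  by rewrite /y !mul_assoc xf -!mul_assoc ex mul_assoc.
have fy : f ** y = y by rewrite /y !mul_assoc ff.
have ye : y ** e = y by rewrite /y -mul_assoc ee.
exists y; split=> //; apply: primitive_sub => //.
- by split; [apply: mul_in|rewrite mul_assoc xyx].
- by rewrite mul_assoc ex.
- by rewrite -mul_assoc ye.
- by apply: contraNneq x0 => xy0; rewrite -xyx xy0 zmul.
- by split; [apply: mul_in|rewrite -mul_assoc (mul_assoc x) xyx].
- by rewrite mul_assoc fy.
- by rewrite -mul_assoc xf.
by apply: contraNneq x0 => yx0; rewrite -xyx -mul_assoc yx0 mul0.
Qed.

(* x is a root of a polynomial which splits into linear factors x - z e, and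
   the nonzero elements of e H e are invertible. *)
Lemma primitive_scalar e x : primitive e -> x \in H -> e ** x = x -> x ** e = x ->
  exists a, x = a *: e.
Proof.
move=> pe xH ex xe; have [eH ee] := primitive_idem pe.
have e0 : e != 0 by case: pe.
(* Powers and polynomial evaluation at x are taken in the corner algebra of e, whose unit, and hence
   zeroth power, is e. *)
pose pw i := iter i (mul x) e.
pose ev (p : {poly F}) := \sum_(i < size p) p`_i *: pw i.
have evE n (p : {poly F}) : (size p <= n)%N -> ev p = \sum_(i < n) p`_i *: pw i.
  move=> sp; rewrite /ev -(big_mkord predT (fun i => p`_i *: pw i)).
  rewrite -(big_mkord predT (fun i => p`_i *: pw i)) (big_cat_nat _ sp) //=.
  rewrite [X in _ = _ + X]big1_seq ?addr0 // => i; rewrite mem_index_iota => /andP[_ /andP[spi _]].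
  by rewrite nth_default // scale0r.
have evX z (p : {poly F}) : ev (('X - z%:P) * p) = (x - z *: e) ** ev p.
  have epw i : e ** pw i = pw i.
    by case: i => [|i] /=; rewrite ?ee // mul_assoc ex.
  have sz : (size (('X - z%:P) * p)%R <= (size p).+1)%N.
    by apply: leq_trans (size_polyMleq _ _) _; rewrite size_XsubC.
  rewrite (evE _ _ sz) (evE _ _ (leqnn _)) mulBl mul_sumr mulZl mul_sumr scaler_sumr.
  rewrite big_ord_recl /= mulrBl coefB coefXM coefCM eqxx sub0r.
  under eq_bigr => i _.
    rewrite /bump leq0n add1n coefB coefXM coefCM /= scalerBl; over.
  rewrite sumrB addrCA; congr (_ + _).
    by apply: eq_bigr => i _; rewrite mulZr.
  transitivity (- (\sum_(i < (size p).+1) (z * p`_i) *: pw i)).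
    by rewrite big_ord_recl opprD scaleNr addrC.
  rewrite big_ord_recr /= nth_default // mulr0 scale0r addr0; congr (- _).
  by apply: eq_bigr => i _; rewrite mulZr epw scalerA.
have [p p0 evp] : exists2 p : {poly F}, p != 0 & ev p = 0.
  (* One vector more than the ambient dimension, so the powers of x satisfy a linear relation. *)
  pose n := (\dim {:V}).+1.
  have nfree : ~ free [tuple pw i | i < n].
    rewrite /free size_tuple => /eqP dn.
    by have := dimvS (subvf <<[tuple pw i | i < n]>>); rewrite dn ltnn.
  have [[c c0 [i ci]]|noc] := boolp.EM (exists2 c : 'I_n -> F,
      \sum_(i < n) c i *: pw i = 0 & exists i, c i != 0); last first.
    case: nfree; apply/freeP => c c0 i; apply/eqP/negPn/negP => ci.
    case: noc; exists c; last by exists i.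
    by apply: etrans c0; apply: eq_bigr => j _; rewrite (nth_map j) ?size_enum_ord // nth_ord_enum.
  have cE (j : 'I_n) : (\poly_(k < n) c (inord k))`_j = c j.
    by rewrite coef_poly ltn_ord inord_val.
  exists (\poly_(k < n) c (inord k)).
    by apply: contraNneq ci => p0; rewrite -cE p0 coef0.
  rewrite (evE n) ?size_poly //; apply: etrans c0; apply: eq_bigr => j _.
  by rewrite cE.
have ev1 : ev 1 = e by rewrite (evE 1%N) ?size_poly1 // big_ord1 coef1 scale1r.
have [rs prs] := closed_field_poly_normal p.
have lc0 : lead_coef p != 0 by rewrite lead_coef_eq0.
have {p p0 evp prs lc0} : ev (\prod_(z <- rs) ('X - z%:P)) = 0.
  set q := \prod_(z <- rs) _ in prs *.
  have evZ a : ev (a *: q) = a *: ev q.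
    rewrite (evE _ _ (size_scale_leq _ _)) /ev scaler_sumr; apply: eq_bigr => i _.
    by rewrite coefZ -scalerA.
  by move: evp; rewrite prs evZ => /eqP; rewrite scaler_eq0 (negPf lc0) => /eqP.
elim: rs => [|z rs IHrs]; first by rewrite big_nil ev1 => e00; rewrite e00 eqxx in e0.
rewrite big_cons evX; case: (eqVneq x (z *: e)) => [-> _|xz]; first by exists z.
have dH : x - z *: e \in H by rewrite memvB ?memvZ.
have [y [_ _ _ _ yd]] : exists y, [/\ y \in H, e ** y = y, y ** e = y,
    (x - z *: e) ** y = e & y ** (x - z *: e) = e].
  apply: primitive_invert => //; rewrite ?subr_eq0 //.
    by rewrite mulBr ex mulZr ee.
  by rewrite mulBl xe mulZl ee.
move/(congr1 (mul y)); rewrite mul_assoc yd mul0 => eq0; apply: IHrs.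
apply: etrans eq0; rewrite /ev mul_sumr; apply: eq_bigr => i _; rewrite mulZr.
by case: (nat_of_ord i) => [|k] /=; rewrite ?ee // mul_assoc ex.
Qed.

Definition peirce e f : {vspace V} := (linfun (mul e \o mul_by f) @: H)%VS.

Lemma peirceP e f x : idem_in e -> idem_in f ->
  reflect [/\ x \in H, e ** x = x & x ** f = x] (x \in peirce e f).
Proof.
move=> [eH ee] [fH ff]; apply: (iffP memv_imgP) => [[y yH ->]|[xH ex xf]].
  rewrite lfunE /= /mul_by; split; first by rewrite !mul_in.
    by rewrite mul_assoc ee.
  by rewrite -!mul_assoc ff.
by exists x => //; rewrite lfunE /= /mul_by xf.
Qed.

Lemma one_idem : idem_in one. Proof. by split; rewrite ?one_r. Qed.

(** If x is nonzero with inverse y, any z of the component has z y in the corner of e, which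
    consists of scalars; so z = z y x is a multiple of x. *)
Lemma dim_peirce_le1 e f : primitive e -> primitive f -> (\dim (peirce e f) <= 1)%N.
Proof.
move=> pe pf; have [ie if_] := (primitive_idem pe, primitive_idem pf).
have [->|] := eqVneq (peirce e f) 0%VS; first by rewrite dimv0.
rewrite -vpick0 => x0; set x := vpick _ in x0.
have /(peirceP _ ie if_)[xH ex xf] := memv_pick (peirce e f).
have [y [yH fy ye xy yx]] := primitive_invert pe pf xH ex xf x0.
suff /dimvS le : (peirce e f <= <[x]>)%VS.
  by apply: leq_trans le _; rewrite dim_vline leq_b1.
apply/subvP => z /(peirceP _ ie if_)[zH ez zf].
have [a za] : exists a, z ** y = a *: e.
  apply: primitive_scalar => //; first exact: mul_in.
    by rewrite mul_assoc ez.
  by rewrite -mul_assoc ye.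
by apply/vlineP; exists a; rewrite -zf -yx mul_assoc za mulZl ex.
Qed.

Lemma peirce_neq0P e f : idem_in e -> idem_in f ->
  (exists2 x, x \in H & e ** x ** f != 0) -> (0 < \dim (peirce e f))%N.
Proof.
move=> [eH ee] [fH ff] [x xH nz]; rewrite lt0n dimv_eq0; apply: contraNneq nz => p0.
have : e ** x ** f \in peirce e f.
  apply/peirceP => //; split; first by rewrite !mul_in.
    by rewrite !mul_assoc ee.
  by rewrite -!mul_assoc ff.
by rewrite p0 memv0.
Qed.

Lemma dim_peirce_gt0 e f : idem_in e -> idem_in f -> (0 < \dim (peirce e f))%N ->
  exists x, [/\ x \in H, e ** x = x, x ** f = x & x != 0].
Proof.
move=> ie if_; rewrite lt0n dimv_eq0 -vpick0 => x0; exists (vpick (peirce e f)).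
by have /(peirceP _ ie if_)[] := memv_pick (peirce e f).
Qed.

Lemma peirce_sym e f : primitive e -> primitive f ->
  \dim (peirce e f) = \dim (peirce f e).
Proof.
move=> pe pf.
suff le e' f' : primitive e' -> primitive f' ->
    (\dim (peirce e' f') <= \dim (peirce f' e'))%N.
  by apply/eqP; rewrite eqn_leq !le.
move=> pe' pf'; have [ie if_] := (primitive_idem pe', primitive_idem pf').
case: (posnP (\dim (peirce e' f'))) => [-> //|/(dim_peirce_gt0 ie if_)].
case=> x [xH ex xf x0]; have [y [yH fy ye xy yx]] := primitive_invert pe' pf' xH ex xf x0.
apply: leq_trans (dim_peirce_le1 pe' pf') _; apply: peirce_neq0P => //.
exists y => //; rewrite fy ye; case: pe' => _ _ e0 _.
by apply: contraNneq e0 => y0; rewrite -xy y0 mul0.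
Qed.

(** Left multiplication by the inverse of a nonzero element of the component embeds the right ideal
    of e into that of f; by symmetry the dimensions agree. *)
Lemma dim_peirce_one_eq e f : primitive e -> primitive f ->
  (0 < \dim (peirce e f))%N -> \dim (peirce e one) = \dim (peirce f one).
Proof.
move=> pe pf pos.
suff le e' f' : primitive e' -> primitive f' -> (0 < \dim (peirce e' f'))%N ->
    (\dim (peirce e' one) <= \dim (peirce f' one))%N.
  by apply/eqP; rewrite eqn_leq !le // peirce_sym.
move=> pe' pf'; have [ie if_] := (primitive_idem pe', primitive_idem pf').
case/(dim_peirce_gt0 ie if_) => x [xH ex xf x0].
have [y [yH fy ye xy yx]] := primitive_invert pe' pf' xH ex xf x0.
have i1 := one_idem.
rewrite -(limg_dim_eq (f := linfun (mul y))).
  apply: dimvS; apply/subvP => _ /memv_imgP[z /(peirceP _ ie i1)[zH ez _] ->].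
  by rewrite lfunE /=; apply/peirceP => //; split; rewrite ?mul_in ?one_r // mul_assoc fy.
apply/eqP; rewrite -subv0; apply/subvP => z; rewrite memv_cap => /andP[].
case/(peirceP _ ie i1) => zH ez _; rewrite memv_ker lfunE /= => /eqP yz.
by rewrite memv0 -ez -xy -mul_assoc yz mul0.
Qed.

Definition orthogonal_idems k (E : 'I_k -> V) : Prop :=
  [/\ forall a, idem_in (E a), forall a c, a != c -> E a ** E c = 0 &
   \sum_a E a = one].

Lemma dim_peirce_sum_r e k (E : 'I_k -> V) : idem_in e -> orthogonal_idems E ->
  \dim (peirce e one) = (\sum_a \dim (peirce e (E a)))%N.
Proof.
move=> ie [iE oE sE]; have i1 := one_idem.
have [eH ee] := ie.
rewrite (dim_projections (p := fun a => linfun (mul_by (E a)))).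
- apply: eq_bigr => a _; congr (\dim _); apply/vspaceP => x.
  have [aH aa] := iE a.
  apply/memv_imgP/(peirceP _ ie (iE a)) => [[y /(peirceP _ ie i1)[yH ey _] ->]|[xH ex xa]].
    rewrite lfunE /= /mul_by; split; rewrite ?mul_in //; first by rewrite mul_assoc ey.
    by rewrite -mul_assoc aa.
  exists x; first by apply/peirceP => //; split.
  by rewrite lfunE /= /mul_by xa.
- move=> a x /(peirceP _ ie i1)[xH ex _]; have [aH _] := iE a.
  rewrite lfunE /= /mul_by; apply/peirceP => //; split; rewrite ?mul_in //.
  by rewrite mul_assoc ex.
- by move=> a x _; rewrite !lfunE /= /mul_by -mul_assoc; have [_ ->] := iE a.
- move=> a c x ac _; rewrite !lfunE /= /mul_by -mul_assoc oE ?mul0 //.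
  by rewrite eq_sym.
- move=> x /(peirceP _ ie i1)[xH ex x1].
  under eq_bigr do rewrite lfunE /= /mul_by.
  by rewrite -mul_sumr sE.
Qed.

Lemma dim_peirce_sum_l k (E : 'I_k -> V) : orthogonal_idems E ->
  \dim H = (\sum_a \dim (peirce (E a) one))%N.
Proof.
move=> [iE oE sE]; have i1 := one_idem.
rewrite (dim_projections (p := fun a => linfun (mul (E a)))).
- apply: eq_bigr => a _; congr (\dim _); apply/vspaceP => x.
  have [aH aa] := iE a.
  apply/memv_imgP/(peirceP _ (iE a) i1) => [[y yH ->]|[xH ax _]].
    by rewrite lfunE /=; split; rewrite ?mul_in ?one_r // mul_assoc aa.
  by exists x => //; rewrite lfunE.
- by move=> a x xH; rewrite lfunE; have [aH _] := iE a; apply: mul_in.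
- by move=> a x _; rewrite !lfunE /= mul_assoc; have [_ ->] := iE a.
- by move=> a c x ac _; rewrite !lfunE /= mul_assoc oE ?zmul.
- move=> x xH; under eq_bigr do rewrite lfunE /=.
  by rewrite -mul_suml sE one_l.
Qed.

Definition primitive_decomposition k (E : 'I_k -> V) : Prop :=
  orthogonal_idems E /\ forall a, primitive (E a).

Lemma dim_peirce_one_gt0 e : primitive e -> (0 < \dim (peirce e one))%N.
Proof.
move=> pe; apply: peirce_neq0P (primitive_idem pe) one_idem _.
by case: pe => eH ee e0 _; exists e => //; rewrite ee one_r.
Qed.

(* Each summand E a counts for the sum over c of dim (E a H E' c) / dim (E a H),
   an expression symmetric in the two decompositions. *)
Lemma primitive_decomposition_unique k l (E : 'I_k -> V) (E' : 'I_l -> V) :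
  primitive_decomposition E -> primitive_decomposition E' -> k = l.
Proof.
move=> [oE pE] [oE' pE'].
have count p q (A : 'I_p -> V) (B : 'I_q -> V) : orthogonal_idems B ->
    (forall a, primitive (A a)) ->
    \sum_a \sum_c (\dim (peirce (A a) (B c)))%:R / (\dim (peirce (A a) one))%:R = p%:R :> rat.
  move=> oB pA; rewrite -[in RHS](card_ord p) -sumr_const; apply: eq_bigr => a _.
  rewrite -mulr_suml -natr_sum -(dim_peirce_sum_r (primitive_idem (pA a)) oB).
  by rewrite divff // pnatr_eq0 -lt0n dim_peirce_one_gt0.
apply/eqP; rewrite -(eqr_nat rat) -(count _ _ _ _ oE' pE) -(count _ _ _ _ oE pE').
rewrite exchange_big; apply/eqP; apply: eq_bigr => c _; apply: eq_bigr => a _ /=.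
rewrite [in RHS]peirce_sym //.
case: (posnP (\dim (peirce (E a) (E' c)))) => [->|pos]; first by rewrite !mul0r.
by rewrite (dim_peirce_one_eq (pE a) (pE' c) pos).
Qed.

Lemma dim_algebra k (E : 'I_k -> V) : primitive_decomposition E ->
  \dim H = (\sum_a \sum_c \dim (peirce (E a) (E c)))%N.
Proof.
move=> [oE pE]; rewrite (dim_peirce_sum_l oE); apply: eq_bigr => a _.
exact: dim_peirce_sum_r (primitive_idem (pE a)) oE.
Qed.

Lemma dim_algebra_le k (E : 'I_k -> V) : primitive_decomposition E ->
  (\dim H <= k ^ 2)%N.
Proof.
move=> dE; rewrite (dim_algebra dE); case: dE => _ pE.
apply: (@leq_trans (\sum_(a < k) \sum_(c < k) 1)%N).
  by apply: leq_sum => a _; apply: leq_sum => c _; apply: dim_peirce_le1.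
by rewrite !sum_nat_const !card_ord muln1 expnS expn1.
Qed.

(** Each pair of equal level contributes a nonzero Peirce component to [H], and by Cauchy-Schwarz at
    least k^2 / N pairs have equal level. *)
Lemma dim_algebra_ge k (E : 'I_k -> V) N (lev : 'I_k -> 'I_N) :
  primitive_decomposition E ->
  (forall a c, lev a = lev c -> exists2 x, x \in H & E a ** x ** E c != 0) ->
  (k ^ 2 <= N * \dim H)%N.
Proof.
move=> dE levE; rewrite (dim_algebra dE); case: dE => _ pE.
have := square_card_le lev; rewrite !card_ord => /leq_trans -> //.
rewrite leq_mul2l; apply/orP; right.
rewrite -sum1_card pair_big /= [X in (X <= _)%N]big_mkcond /=.
apply: leq_sum => -[a c] _ /=; rewrite inE /=; case: eqP => // eac.
by apply: peirce_neq0P (levE a c eac); apply: primitive_idem.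
Qed.

(** Splitting a non-primitive idempotent strictly lowers the dimension of the right ideals, so
    repeated splitting stops. Lists serve to concatenate the two halves. *)
Lemma primitive_decomposition_exists :
  exists k (E : 'I_k -> V), primitive_decomposition E.
Proof.
pose orth (s : seq V) := pairwise (fun x y => (x ** y == 0) && (y ** x == 0)) s.
suff main d e : idem_in e -> (\dim (peirce e one) <= d)%N ->
    exists s : seq V, [/\ forall x, x \in s -> primitive x, orth s & \sum_(x <- s) x = e].
  have [s [ps os ss]] := main _ _ one_idem (leqnn _).
  exists (size s), (tnth (in_tuple s)); split; last first.
    by move=> a; apply: ps; apply: mem_tnth.
  split.
  - by move=> a; apply/primitive_idem/ps/mem_tnth.
  - move=> a c ac; rewrite !(tnth_nth 0) /=.
    have /(pairwiseP 0) os' := os.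
    have [ltac'|ltca|eac] := ltngtP a c.
    + by have /andP[/eqP] := os' a c (ltn_ord a) (ltn_ord c) ltac'.
    + by have /andP[_ /eqP] := os' c a (ltn_ord c) (ltn_ord a) ltca.
    + by case/eqP: ac; apply: val_inj.
  - by rewrite -[RHS]ss [RHS]big_tnth.
elim: d e => [|d IHd] e ie dim_e.
  exists [::]; split=> //; rewrite big_nil; apply/eqP; rewrite eq_sym.
  apply/negPn/negP => e0; move: dim_e; rewrite leqn0 => /eqP d0.
  have [eH ee] := ie; suff : (0 < \dim (peirce e one))%N by rewrite d0.
  by apply: peirce_neq0P one_idem _ => //; exists e => //; rewrite ee one_r.
have [e0|e0] := eqVneq e 0; first by exists [::]; split; rewrite ?big_nil.
have [pe|npe] := boolp.EM (primitive e).
  by exists [:: e]; split=> //; [move=> x; rewrite inE => /eqP ->|rewrite big_seq1].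
have [eH ee] := ie.
have [g [h [ig ih gh hg [sgh g0 h0]]]] : exists g h, [/\ idem_in g, idem_in h,
    g ** h = 0, h ** g = 0 & [/\ g + h = e, g != 0 & h != 0]].
  case: (boolp.EM (exists g h, [/\ idem_in g, idem_in h,
    g ** h = 0, h ** g = 0 & [/\ g + h = e, g != 0 & h != 0]])) => // no.
  case: npe; split=> // g h ig ih gh hg sgh.
  case: (eqVneq g 0) => [->|g0]; first by left.
  case: (eqVneq h 0) => [->|h0]; first by right.
  by case: no; exists g, h.
(* The right ideal of u misses the nonzero element v of the right ideal of e, because u v = 0. *)
have small u v : idem_in u -> idem_in v -> u ** v = 0 -> v ** u = 0 -> u + v = e -> v != 0 ->
    (\dim (peirce u one) <= d)%N.
  move=> iu iv uv vu suv v0; rewrite -ltnS; apply: leq_trans dim_e.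
  have [[uH uu] [vH vv]] := (iu, iv).
  have eu : e ** u = u by rewrite -suv mulDl uu vu addr0.
  have ev : e ** v = v by rewrite -suv mulDl uv vv add0r.
  have sub : (peirce u one <= peirce e one)%VS.
    apply/subvP => x /(peirceP _ iu one_idem)[xH ux _].
    by apply/peirceP; [|exact: one_idem|split; rewrite ?one_r // -ux mul_assoc eu].
  rewrite ltn_neqAle dimvS // andbT; apply: contraNneq v0 => deq.
  have : v \in peirce e one by apply/peirceP; [|exact: one_idem|split; rewrite ?one_r].
  have /eqP <- : peirce u one == peirce e one by rewrite eqEdim sub deq leqnn.
  by case/(peirceP _ iu one_idem) => _ <- _; rewrite uv.
have [s1 [p1 o1 sum1]] := IHd g ig (small g h ig ih gh hg sgh h0).
have [s2 [p2 o2 sum2]] : exists s : seq V,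
    [/\ forall x, x \in s -> primitive x, orth s & \sum_(x <- s) x = h].
  by apply: IHd ih (small h g ih ig hg gh _ g0); rewrite addrC.
(* Each member is fixed by multiplication with the sum of its list, so orthogonality of the two sums
   g and h passes to the members of the two lists. *)
have absorb s u : (forall x, x \in s -> primitive x) -> orth s -> \sum_(x <- s) x = u ->
    forall x, x \in s -> x ** u = x /\ u ** x = x.
  move=> ps os <- x xs.
  have xx : x ** x = x by case: (ps x xs).
  case/splitPr: xs os => q1 q2.
  rewrite /orth pairwise_cat /= => /and4P[/allrelP r1 _ /allP r2 _].
  have z1 y : y \in q1 -> x ** y = 0 /\ y ** x = 0.
    by move=> yq; have /andP[/eqP ? /eqP ?] := r1 y x yq (mem_head _ _).
  have z2 y : y \in q2 -> x ** y = 0 /\ y ** x = 0.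
    by move=> /r2/andP[/eqP ? /eqP ?].
  rewrite big_cat big_cons !mulDr !mulDl xx !mul_sumr !mul_suml.
  rewrite !(@big1_seq _ _ _ _ q1) ?(@big1_seq _ _ _ _ q2) ?addr0 ?add0r //;
    by move=> y /andP[_ yq]; first [have [] := z1 y yq | have [] := z2 y yq].
exists (s1 ++ s2); split; last by rewrite big_cat /= sum1 sum2.
  by move=> x; rewrite mem_cat => /orP[/p1|/p2].
rewrite /orth pairwise_cat; apply/and3P; split=> //.
apply/allrelP => x y xs ys.
have [xg gx] := absorb _ _ p1 o1 sum1 _ xs; have [yh hy] := absorb _ _ p2 o2 sum2 _ ys.
apply/andP; split; apply/eqP.
  by rewrite -xg -hy -!mul_assoc (mul_assoc g) gh zmul mul0.
by rewrite -yh -gx -!mul_assoc (mul_assoc h) hg zmul mul0.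
Qed.

End SemisimpleAlgebra.

(** * Decompositions in the Karoubi envelope *)

Section Karoubi.
Variables (F : closedFieldType) (t : F) (K : diagram_class).
Hypothesis Kstack : stack_closed K.
Local Notation "g ** f" := (cmp t g f) (at level 39, left associativity).
Local Notation Hom := (hom_space F K).

Lemma mx_homP k l (s : 'I_k -> nat) (s' : 'I_l -> nat) (f g : mx_hom F s s') :
  (forall i j, f i j = g i j) -> f = g.
Proof.
move=> fg; apply: boolp.functional_extensionality_dep => i.
by apply: boolp.functional_extensionality_dep => j.
Qed.

Lemma mx_compE k l p (s : 'I_k -> nat) (s' : 'I_l -> nat) (s'' : 'I_p -> nat)
    (g : mx_hom F s' s'') (f : mx_hom F s s') i j :
  mx_comp t g f i j = \sum_h g h j ** f i h.
Proof. by rewrite /mx_comp; apply: eq_bigr => h _; rewrite cmpE. Qed.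

Lemma mx_compA k l p q (s : 'I_k -> nat) (s' : 'I_l -> nat) (s'' : 'I_p -> nat)
    (r : 'I_q -> nat) (h : mx_hom F s'' r) (g : mx_hom F s' s'') (f : mx_hom F s s') :
  mx_comp t h (mx_comp t g f) = mx_comp t (mx_comp t h g) f.
Proof.
apply: mx_homP => i j; rewrite !mx_compE.
under eq_bigr do rewrite mx_compE cmp_sumr.
under [RHS]eq_bigr do rewrite mx_compE cmp_suml.
rewrite exchange_big; apply: eq_bigr => a _; apply: eq_bigr => b _.
exact: cmp_assoc.
Qed.

Lemma mx_comp_in k l p (s : 'I_k -> nat) (s' : 'I_l -> nat) (s'' : 'I_p -> nat)
    (g : mx_hom F s' s'') (f : mx_hom F s s') :
  (forall i j, g i j \in Hom (s' i) (s'' j)) -> (forall i j, f i j \in Hom (s i) (s' j)) ->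
  forall i j, mx_comp t g f i j \in Hom (s i) (s'' j).
Proof. by move=> gK fK i j; rewrite mx_compE; apply: memv_suml => h _; apply: cmp_in. Qed.

Lemma mx_comp_zero_r k l p (s : 'I_k -> nat) (s' : 'I_l -> nat) (s'' : 'I_p -> nat)
    (g : mx_hom F s' s'') : mx_comp t g (fun i j => 0 : hom F (s i) (s' j)) = fun i j => 0.
Proof. by apply: mx_homP => i j; rewrite mx_compE big1 // => h _; rewrite cmp0r. Qed.

Lemma mx_comp_zero_l k l p (s : 'I_k -> nat) (s' : 'I_l -> nat) (s'' : 'I_p -> nat)
    (f : mx_hom F s s') : mx_comp t (fun i j => 0 : hom F (s' i) (s'' j)) f = fun i j => 0.
Proof. by apply: mx_homP => i j; rewrite mx_compE big1 // => h _; rewrite cmp0l. Qed.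

Section KarHom.
Variables (X Y : kar_obj t K) (f : mx_hom F (@kar_sum _ _ _ X) (@kar_sum _ _ _ Y)).
Hypothesis fXY : kar_hom f.

Lemma kar_idem_idem (Z : kar_obj t K) :
  mx_comp t (@kar_idem _ _ _ Z) (@kar_idem _ _ _ Z) = @kar_idem _ _ _ Z.
Proof. by apply: mx_homP; apply: kar_idemP. Qed.

Lemma kar_homE :
  mx_comp t (@kar_idem _ _ _ Y) (mx_comp t f (@kar_idem _ _ _ X)) = f.
Proof. by apply: mx_homP; case: fXY. Qed.

Lemma kar_hom_r : mx_comp t f (@kar_idem _ _ _ X) = f.
Proof. by rewrite -[in LHS]kar_homE -!mx_compA kar_idem_idem kar_homE. Qed.

Lemma kar_hom_l : mx_comp t (@kar_idem _ _ _ Y) f = f.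
Proof. by rewrite -[in LHS]kar_homE mx_compA kar_idem_idem kar_homE. Qed.

End KarHom.

Definition const_mx n (x : hom F n n) : mx_hom F (fun=> n : nat) (fun=> n : nat) :=
  fun (_ _ : 'I_1) => x.

Lemma const_mx_comp n (x y : hom F n n) :
  mx_comp t (const_mx x) (const_mx y) = const_mx (x ** y).
Proof. by apply: mx_homP => i j; rewrite mx_compE big_ord1. Qed.

Lemma mx_const n (f : mx_hom F (fun _ : 'I_1 => n) (fun _ : 'I_1 => n)) :
  f = const_mx (f ord0 ord0).
Proof. by apply: mx_homP => i j; rewrite !ord1. Qed.

Lemma const_mx_idemP n (x : hom F n n) : x ** x = x ->
  forall i j, mx_comp t (const_mx x) (const_mx x) i j = const_mx x i j.
Proof. by move=> xx i j; rewrite const_mx_comp xx. Qed.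

Definition idem_obj n (x : hom F n n) (xK : x \in Hom n n) (xx : x ** x = x) :
  kar_obj t K :=
  @KarObj F t K 1 (fun=> n) (const_mx x) (fun _ _ => xK) (const_mx_idemP xx).

Section DirectSum.
Variables (X : kar_obj t K) (b : nat) (Y : 'I_b -> kar_obj t K).
Variable inj : forall a, mx_hom F (@kar_sum _ _ _ (Y a)) (@kar_sum _ _ _ X).
Variable prj : forall a, mx_hom F (@kar_sum _ _ _ X) (@kar_sum _ _ _ (Y a)).
Arguments inj : clear implicits.
Arguments prj : clear implicits.
Hypothesis injK : forall a, kar_hom (inj a).
Hypothesis prjK : forall a, kar_hom (prj a).
Hypothesis prj_inj : forall a i j, mx_comp t (prj a) (inj a) i j = @kar_idem _ _ _ (Y a) i j.
Hypothesis prj_inj0 : forall a c, a != c -> forall i j, mx_comp t (prj c) (inj a) i j = 0.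

Definition summand_idem a := mx_comp t (inj a) (prj a).

Lemma prj_injE a : mx_comp t (prj a) (inj a) = @kar_idem _ _ _ (Y a).
Proof. exact: mx_homP. Qed.

Lemma summand_idem_in a i j : summand_idem a i j \in Hom (kar_sum i) (kar_sum j).
Proof. by apply: mx_comp_in => i' j'; [case: (injK a)|case: (prjK a)]. Qed.

Lemma summand_idem_idem a :
  mx_comp t (summand_idem a) (summand_idem a) = summand_idem a.
Proof.
rewrite /summand_idem mx_compA -(mx_compA (inj a)) prj_injE.
by rewrite kar_hom_r.
Qed.

Lemma summand_idem_orth a c : a != c ->
  mx_comp t (summand_idem a) (summand_idem c) = fun i j => 0.
Proof.
move=> ac; rewrite /summand_idem mx_compA -(mx_compA (inj a)).
rewrite (_ : mx_comp t (prj a) (inj c) = fun i j => 0).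
  by rewrite mx_comp_zero_r mx_comp_zero_l.
by apply: mx_homP => i j; apply: prj_inj0; rewrite eq_sym.
Qed.

(** The identity of [Y a] is recovered from the idempotent which it induces on [X]; this detects
    zero summands and lifts splittings of the idempotent to splittings of [Y a]. *)
Lemma kar_idem_through a : @kar_idem _ _ _ (Y a) =
  mx_comp t (prj a) (mx_comp t (summand_idem a) (inj a)).
Proof.
by rewrite /summand_idem -mx_compA prj_injE mx_compA prj_injE kar_idem_idem.
Qed.

Lemma summand_idem0 a : summand_idem a = (fun i j => 0) -> kar_zero (Y a).
Proof.
by move=> s0 i j; rewrite kar_idem_through s0 mx_comp_zero_l mx_comp_zero_r.
Qed.

End DirectSum.

Section TensorPower.
Variable n : nat.
Local Notation mulE := (@cmp F t n n n).
Local Notation H := (Hom n n).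
Local Notation idem := (idem_in mulE H).
Local Notation prim := (primitive mulE H).

Lemma idem_obj_indecomposable x (xK : x \in H) (xx : x ** x = x) :
  prim x -> indecomposable (idem_obj xK xx).
Proof.
move=> [_ _ x0 xp]; split; first by move=> z; move/eqP: x0; apply; apply: (z ord0 ord0).
move=> Y [inj [prj [[injK prjK] pi pi0 ip]]].
pose e a := summand_idem inj prj a ord0 ord0.
have eE a : summand_idem inj prj a = const_mx (e a) by apply: mx_const.
have ei a : idem (e a).
  split; first exact: (summand_idem_in injK prjK).
  have := summand_idem_idem injK pi a; rewrite eE const_mx_comp.
  by move/(congr1 (fun f : mx_hom F (fun _ : 'I_1 => n) (fun _ : 'I_1 => n) => f ord0 ord0)).
have eo a c : a != c -> e a ** e c = 0.
  move=> ac; have := summand_idem_orth pi0 ac; rewrite !eE const_mx_comp.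
  by move/(congr1 (fun f : mx_hom F (fun _ : 'I_1 => n) (fun _ : 'I_1 => n) => f ord0 ord0)).
have es : e ord0 + e (lift ord0 ord0) = x.
  by have := ip ord0 ord0; rewrite big_ord_recl big_ord1.
have z a : e a = 0 -> kar_zero (Y a).
  by move=> e0; apply: (summand_idem0 (inj := inj) (prj := prj)) => //; rewrite eE e0.
by case: (xp _ _ (ei ord0) (ei (lift ord0 ord0))); rewrite ?eo //;
  [exists ord0; apply: z|exists (lift ord0 ord0); apply: z].
Qed.

Lemma splits_into_of_decomposition k (E : 'I_k -> hom F n n) :
  primitive_decomposition mulE (id_hom F n) H E -> splits_into t K n k.
Proof.
move=> [[iE oE sE] pE].
exists (fun a => idem_obj (proj1 (iE a)) (proj2 (iE a))); split.
  by move=> a; apply: idem_obj_indecomposable.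
exists (fun a => const_mx (E a)), (fun a => const_mx (E a)).
have idE (x : hom F n n) : mx_comp t (const_mx (id_hom F n)) (const_mx x) = const_mx x.
  by rewrite const_mx_comp cmp_idl.
have EE a : mx_comp t (const_mx (E a)) (const_mx (E a)) = const_mx (E a).
  by rewrite const_mx_comp (proj2 (iE a)).
split.
- split=> a; split=> i j; try exact: (proj1 (iE a)).
    by rewrite /= -/(const_mx (id_hom F n)) EE idE.
  by rewrite /= const_mx_comp cmp_idr EE.
- by move=> a i j; rewrite EE.
- move=> a c ac i j.
  have ca : mx_comp t (const_mx (E c)) (const_mx (E a)) i j = 0.
    by rewrite const_mx_comp /const_mx oE // eq_sym.
  exact: ca.
move=> i j; apply: etrans _ sE; apply: eq_bigr => a _.
have aa : mx_comp t (const_mx (E a)) (const_mx (E a)) i j = E a by rewrite EE.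
exact: aa.
Qed.

(** The summands may be matrices over arbitrary formal sums, but each is determined by an idempotent
    of End(n), and it remains to see that indecomposability makes this idempotent primitive. *)
Lemma decomposition_of_splits_into k : splits_into t K n k ->
  exists E : 'I_k -> hom F n n, primitive_decomposition mulE (id_hom F n) H E.
Proof.
move=> [Y [indY [inj [prj [[injK prjK] pi pi0 ip]]]]].
pose e a := summand_idem inj prj a ord0 ord0.
have eE a : summand_idem inj prj a = const_mx (e a) by apply: mx_const.
have ei a : idem (e a).
  split; first exact: (summand_idem_in injK prjK).
  have := summand_idem_idem injK pi a; rewrite eE const_mx_comp.
  by move/(congr1 (fun f : mx_hom F (fun _ : 'I_1 => n) (fun _ : 'I_1 => n) => f ord0 ord0)).
exists e; split.
  split=> //.
    move=> a c ac; have := summand_idem_orth pi0 ac; rewrite !eE const_mx_comp.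
    by move/(congr1 (fun f : mx_hom F (fun _ : 'I_1 => n) (fun _ : 'I_1 => n) => f ord0 ord0)).
  exact: (ip ord0 ord0).
move=> a; have [eaK eaa] := ei a; split=> //.
  apply/eqP => e0; case: (indY a) => nz _; apply: nz.
  by apply: (summand_idem0 (inj := inj) (prj := prj)) => //; rewrite eE e0.
move=> g h [gK gg] [hK hh] gh hg gha.
pose z (b : 'I_2) := if b == ord0 then g else h.
have zK b : z b \in H by rewrite /z; case: ifP.
have zz b : z b ** z b = z b by rewrite /z; case: ifP.
have zo b c : b != c -> z b ** z c = 0.
  by rewrite /z; case: b c => [[|[|//]] ?] [[|[|//]] ?].
have ez b : e a ** z b = z b.
  by rewrite -gha cmpDl /z; case: ifP => _; rewrite ?gg ?gh ?hg ?hh ?addr0 ?add0r.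
(* The two parts of [Y a] are the images of g and h, seen as objects on n points; restricting the
   projection and the injection of [Y a] to them gives the structure maps. *)
have Dz : direct_sum (Y a) (fun b => idem_obj (zK b) (zz b)).
  exists (fun b => mx_comp t (prj a) (const_mx (z b))).
  exists (fun b => mx_comp t (const_mx (z b)) (inj a)).
  have pej (u v : mx_hom F (fun _ : 'I_1 => n) (fun _ : 'I_1 => n)) :
      mx_comp t (mx_comp t u (inj a)) (mx_comp t (prj a) v) =
      mx_comp t u (mx_comp t (const_mx (e a)) v).
    by rewrite -eE /summand_idem -!mx_compA.
  split.
  - split=> b; split.
    + apply: mx_comp_in; [by case: (prjK a)|by move=> i j; exact: zK].
    + move=> i j /=; rewrite -!mx_compA const_mx_comp zz mx_compA.
      by rewrite (kar_hom_l (prjK a)).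
    + apply: mx_comp_in; [by move=> i j; exact: zK|by case: (injK a)].
    + move=> i j /=; rewrite !mx_compA const_mx_comp zz -mx_compA.
      by rewrite (kar_hom_r (injK a)).
  - by move=> b i j; rewrite pej const_mx_comp ez const_mx_comp zz.
  - by move=> b c bc i j; rewrite pej const_mx_comp ez const_mx_comp zo // eq_sym.
  - move=> i j; rewrite (kar_idem_through pi) eE.
    rewrite big_ord_recl big_ord1.
    have mid (u : hom F n n) : u ** u = u ->
        mx_comp t (mx_comp t (prj a) (const_mx u)) (mx_comp t (const_mx u) (inj a)) =
        mx_comp t (prj a) (mx_comp t (const_mx u) (inj a)).
      by move=> uu; rewrite -mx_compA (mx_compA (const_mx u)) const_mx_comp uu.
    rewrite !mid // !mx_compE -big_split /=; apply: eq_bigr => l _.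
    by rewrite -cmpDr !mx_compE !big_ord1 -cmpDl /const_mx /z /= gha.
case: (indY a) => _ /(_ _ Dz) [b zb].
have {zb} : z b = 0 by apply: (zb ord0 ord0).
by rewrite /z; case: ifP => _ ->; [left|right].
Qed.

Hypothesis ss : semisimple_end t K n.

(** Write 1 = u + w along H x and a complementary left ideal, with u = y x. Then x w = x - x u lies
    in both ideals, so it vanishes and x = x y x. *)
Lemma semisimple_regular x : x \in H -> exists2 y, y \in H & x ** y ** x = x.
Proof.
move=> xH; have iH := id_hom_in F K n.
pose U := (linfun (@cmp_l F t n n n x) @: H)%VS.
have Ux : x \in U.
  by apply/memv_imgP; exists (id_hom F n); rewrite // lfunE /= /cmp_l cmp_idl.
have lU : left_ideal t K U.
  split; first by apply/subvP => _ /memv_imgP[y yH ->]; rewrite lfunE /= /cmp_l; apply: cmp_in.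
  move=> a _ aH /memv_imgP[y yH ->]; rewrite cmpE lfunE /= /cmp_l cmp_assoc.
  by apply/memv_imgP; exists (a ** y); [apply: cmp_in|rewrite lfunE].
have [W [lW UW0 UWH]] := ss lU.
have : id_hom F n \in (U + W)%VS by rewrite UWH.
case/memv_addP => u uU [w wW ide].
have [y yH uE] := memv_imgP uU.
move: uE; rewrite lfunE /= /cmp_l => uE.
have xw : x ** w \in (U :&: W)%VS.
  rewrite memv_cap -!cmpE; apply/andP; split; last by case: lW => _; apply.
  have -> : comp t x w = x - comp t x u.
    by rewrite !cmpE -[X in X - _](cmp_idr t x) ide cmpDr addrC addKr.
  by apply: memvB => //; case: lU => _; apply.
exists y => //; move: xw; rewrite UW0 memv0 => /eqP xw0.
by rewrite -cmp_assoc -uE -[RHS](cmp_idr t x) ide cmpDr xw0 addr0.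
Qed.

End TensorPower.
End Karoubi.

(** * The number of isomorphism classes of summands *)

Section Levels.
Variables (F : closedFieldType) (t : F) (K : diagram_class).
Hypothesis Kstack : stack_closed K.
Hypothesis Kthin : thin K.
Hypothesis Kgen : generic t K.
Local Notation "g ** f" := (cmp t g f) (at level 39, left associativity).
Local Notation Hom := (hom_space F K).
Variable n : nat.
Local Notation mulE := (@cmp F t n n n).
Local Notation H := (Hom n n).
Local Notation prim := (primitive mulE H).
Local Notation decomposition := (primitive_decomposition mulE (id_hom F n) H).

Let mulA x y z : mulE x (mulE y z) = mulE (mulE x y) z := cmp_assoc t x y z.
Let linR x : linear (mulE x) := @cmp_linear_r F t n n n x.
Let linL y : linear (mul_by mulE y) := @cmp_linear_l F t n n n y.
Let idL x : mulE (id_hom F n) x = x := cmp_idl t x.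
Let idR x : mulE x (id_hom F n) = x := cmp_idr t x.
Let idH : id_hom F n \in H := id_hom_in F K n.
Let mulH x y (xH : x \in H) (yH : y \in H) : mulE x y \in H := cmp_in t Kstack xH yH.
Let reg x (xH : x \in H) := semisimple_regular Kstack (@Kgen n) xH.

Definition through j (e : hom F n n) : Prop :=
  exists r (u : 'I_r -> hom F j n) (v : 'I_r -> hom F n j),
    [/\ forall i, u i \in Hom j n, forall i, v i \in Hom n j & e = \sum_i u i ** v i].

Lemma through_self e : e \in H -> through n e.
Proof.
move=> eH; exists 1%N, (fun=> e), (fun=> id_hom F n); split=> //.
by rewrite big_ord1 cmp_idr.
Qed.

Definition level_of j e : Prop := through j e /\ forall i, (i < j)%N -> ~ through i e.

Lemma level_exists e : e \in H -> exists2 j, (j <= n)%N & level_of j e.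
Proof.
move=> eH; have := through_self eH; move: {1 3}n (leqnn n) => m.
elim/ltn_ind: m => m IHm lemn thm.
have [[i lt_im thi]|no] := boolp.EM (exists2 i, (i < m)%N & through i e).
  exact: IHm lt_im (ltnW (leq_trans lt_im lemn)) thi.
by exists m => //; split=> // i im thi; apply: no; exists i.
Qed.

Lemma prim_scalar e x : prim e -> x \in H -> e ** x = x -> x ** e = x ->
  exists a, x = a *: e.
Proof. exact: primitive_scalar. Qed.

Lemma sandwich_scalar e x : prim e -> x \in H -> exists a, e ** x ** e = a *: e.
Proof.
move=> pe xH; have [eH ee _ _] := pe.
apply: prim_scalar => //; first by rewrite !mulH.
  by rewrite !cmp_assoc ee.
by rewrite -!cmp_assoc ee.
Qed.

(** Squeezing the sum expressing e between two copies of e leaves some nonzero term, and the corner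
    of e consists of scalars. *)
Lemma level_factor e j : prim e -> level_of j e ->
  exists u v a, [/\ u \in Hom j n, v \in Hom n j, a != 0 & e ** u ** v ** e = a *: e].
Proof.
move=> pe [[r [u [v [uK vK eE]]]] _]; have [eH ee e0 _] := pe.
have [[i nz]|z] := boolp.EM (exists i, e ** u i ** v i ** e != 0).
  have [a aE] := sandwich_scalar pe (cmp_in t Kstack (uK i) (vK i)).
  exists (u i), (v i), a; split=> //; last by rewrite -aE !cmp_assoc.
  by apply: contraNneq nz => a0; rewrite -!cmp_assoc (cmp_assoc t (u i)) cmp_assoc aE a0 scale0r.
case/eqP: e0; rewrite -ee -{2}ee {2}eE cmp_suml cmp_sumr big1 // => i _.
by apply/eqP/negPn/negP => nz; apply: z; exists i; rewrite -!cmp_assoc in nz *.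
Qed.

(* Modulo morphisms factoring through fewer points, an endomorphism of the j-th
   object is a multiple of the identity. *)
Lemma level_sandwich e j u v a x : prim e -> level_of j e ->
  u \in Hom j n -> v \in Hom n j -> e ** u ** v ** e = a *: e -> x \in Hom j j ->
  e ** u ** x ** v ** e = (x (id_diagram j) * a) *: e.
Proof.
move=> pe [_ minj] uK vK aE xK.
have [eH ee e0 _] := pe.
rewrite {1}(hom_basis x) cmp_sumr !cmp_suml (bigD1 (id_diagram j)) //= big1 ?addr0.
  by rewrite cmpZr !cmpZl -/(id_hom F j) cmp_idr aE scalerA.
move=> D Did; rewrite cmpZr !cmpZl.
case: (eqVneq (x D) 0) => [->|xD]; first by rewrite scale0r.
have KD : K _ _ D by move/hom_spaceP: xK; apply.
have [k' lt_k' [U [V [KU KV eD c0]]]] := Kthin KD (elimN eqP Did).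
have DE : diagram_hom F D = diagram_hom F U ** diagram_hom F V.
  by rewrite cmp_diagram_hom c0 expr0 scale1r eD.
have uU : u ** diagram_hom F U \in Hom k' n by apply: cmp_in => //; apply: diagram_hom_in.
have Vv : diagram_hom F V ** v \in Hom n k' by apply: cmp_in => //; apply: diagram_hom_in.
have [b bE] := sandwich_scalar pe (cmp_in t Kstack uU Vv).
rewrite DE.
have -> : e ** u ** (diagram_hom F U ** diagram_hom F V) ** v ** e = b *: e.
  by rewrite -bE !cmp_assoc.
(* A nonzero b could be divided out, factoring e through k' < j points against the minimality of
   j. *)
case: (eqVneq b 0) => [->|b0]; first by rewrite scale0r scaler0.
case: (minj k' lt_k'); exists 1%N, (fun=> b^-1 *: (e ** (u ** diagram_hom F U))),
  (fun=> diagram_hom F V ** v ** e); split=> [_|_|].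
- by apply/memvZ/cmp_in.
- exact: cmp_in.
rewrite big_ord1 cmpZl -!cmp_assoc; apply: (scalerI b0).
by rewrite scalerA divff // scale1r -bE !cmp_assoc.
Qed.

(** The witness is u v', the passage from f to e through their common j points. It does not vanish
    against e and f because v' f u' has a nonzero coefficient at the identity diagram. *)
Lemma level_linked e f j : prim e -> prim f -> level_of j e -> level_of j f ->
  exists2 x, x \in H & e ** x ** f != 0.
Proof.
move=> pe pf le lf.
have [u [v [a [uK vK a0 aE]]]] := level_factor pe le.
have [u' [v' [b [uK' vK' b0 bE]]]] := level_factor pf lf.
have [[eH ee e0 _] [fH ff f0 _]] := (pe, pf).
exists (u ** v'); first exact: cmp_in.
have vfu : v' ** f ** u' \in Hom j j by rewrite !(cmp_in t Kstack).
(* Sandwiching v' f u' once more between f u' and v' f gives b^2 f directly, and b times the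
   identity coefficient by [level_sandwich]. *)
have coef : (v' ** f ** u') (id_diagram j) = b.
  have := level_sandwich pf lf uK' vK' bE vfu.
  have -> : f ** u' ** (v' ** f ** u') ** v' ** f = b *: (b *: f).
    transitivity (f ** u' ** v' ** f ** (u' ** v' ** f)); first by rewrite !cmp_assoc.
    by rewrite bE cmpZl !cmp_assoc bE.
  rewrite scalerA => /eqP; rewrite -subr_eq0 -scalerBl scaler_eq0 (negPf f0) orbF.
  by rewrite subr_eq0 => /eqP/(mulIf b0)/esym.
have := level_sandwich pe le uK vK aE vfu; rewrite coef => main.
have : (b * a) *: e != 0 by rewrite scaler_eq0 negb_or mulf_neq0.
apply: contraNneq => z; rewrite -main.
by rewrite !cmp_assoc -(cmp_assoc t e u v') z !cmp0l.
Qed.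

Lemma summand_count_level k (E : 'I_k -> hom F n n) : decomposition E ->
  (#|@class_mem K n n| <= k ^ 2)%N /\ (k ^ 2 <= n.+1 * #|@class_mem K n n|)%N.
Proof.
move=> dE; rewrite -(dim_hom_space F K n n); split.
  exact: (dim_algebra_le mulA linR linL idL idR idH mulH reg dE).
have [_ pE] := dE.
have lev a : exists j : 'I_n.+1, level_of j (E a).
  have [EH _ _ _] := pE a; have [j jn lj] := level_exists EH.
  by exists (Ordinal (jn : (j < n.+1)%N)).
have [l lP] := boolp.choice lev.
apply: (dim_algebra_ge mulA linR linL idL idR idH mulH (lev := l) dE) => a c eac.
by apply: (level_linked (pE a) (pE c) (lP a)); rewrite eac.
Qed.

Lemma summand_count_exists : exists k, forall l, splits_into t K n l <-> l = k.
Proof.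
have [k [E dE]] := primitive_decomposition_exists mulA linR linL idR idH mulH.
exists k => l; split=> [/(decomposition_of_splits_into Kstack)[E' dE']|->].
  exact: (primitive_decomposition_unique mulA linR linL idR idH mulH reg dE' dE).
exact: splits_into_of_decomposition dE.
Qed.

End Levels.

Lemma summand_count_bounds (F : closedFieldType) (t : F) (K : diagram_class) :
  stack_closed K -> thin K -> generic t K ->
  exists2 b, summand_count t K b &
    forall n, (#|@class_mem K n n| <= b n ^ 2)%N /\ (b n ^ 2 <= n.+1 * #|@class_mem K n n|)%N.
Proof.
move=> Ks Kt Kg.
have [b bP] := boolp.choice (summand_count_exists Ks Kg).
exists b => [n k|n]; first exact: bP.
have /(decomposition_of_splits_into Ks)[E dE] : splits_into t K n (b n) by apply/bP.
exact: (summand_count_level Ks Kt Kg dE).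
Qed.

(** * Counting planar diagrams *)

Local Open Scope nat_scope.

Section Labels.
Variables m n : nat.
Implicit Types (D E : diagram m n) (x y z : points m n).

Definition label D x : bool * bool :=
  ([exists y, same_block D x y && (boundary_pos y < boundary_pos x)],
   [exists y, same_block D x y && (boundary_pos x < boundary_pos y)]).

Definition consecutive D x y : Prop :=
  [/\ boundary_pos x < boundary_pos y, same_block D x y &
   forall z, boundary_pos x < boundary_pos z -> boundary_pos z < boundary_pos y ->
     ~~ same_block D x z].

Lemma next_in_block D x y : same_block D x y -> boundary_pos x < boundary_pos y ->
  exists2 z, consecutive D x z & boundary_pos z <= boundary_pos y.
Proof.
move=> xy ltxy; pose P z := same_block D x z && (boundary_pos x < boundary_pos z).
have Py : P y by rewrite /P xy.
case: (arg_minnP (@boundary_pos m n) Py) => z /andP[xz ltxz] zmin.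
exists z; last exact: zmin.
split=> // w ltxw ltwz; apply: contraTN ltwz => xw.
by rewrite -leqNgt zmin // /P xw.
Qed.

Lemma previous_in_block D x y : same_block D x y -> boundary_pos x < boundary_pos y ->
  exists2 z, consecutive D z y & boundary_pos x <= boundary_pos z.
Proof.
move=> xy ltxy; pose P z := same_block D z y && (boundary_pos z < boundary_pos y).
have Px : P x by rewrite /P xy.
case: (arg_maxnP (@boundary_pos m n) Px) => z /andP[zy ltzy] zmax.
exists z; last exact: zmax.
split=> // w ltzw ltwy; apply: contraTN ltzw => zw.
rewrite -leqNgt; apply: zmax; rewrite /P ltwy andbT; apply: same_block_trans zy.
by rewrite same_block_sym.
Qed.

Lemma label_smaller D x y : same_block D x y -> boundary_pos x < boundary_pos y ->
  (label D y).1.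
Proof. by move=> xy lt; apply/existsP; exists x; rewrite same_block_sym xy. Qed.

Lemma label_larger D x y : same_block D x y -> boundary_pos x < boundary_pos y ->
  (label D x).2.
Proof. by move=> xy lt; apply/existsP; exists y; rewrite xy. Qed.

Lemma label_previous D y : (label D y).1 -> exists x, consecutive D x y.
Proof.
case/existsP => x /andP[yx lt]; rewrite same_block_sym in yx.
by have [z ? _] := previous_in_block yx lt; exists z.
Qed.

Lemma label_next D x : (label D x).2 -> exists y, consecutive D x y.
Proof.
by case/existsP => y /andP[xy lt]; have [z ? _] := next_in_block xy lt; exists z.
Qed.

(** Bracket matching by induction on the distance. Points strictly between x and y have their
    neighbours in [D] strictly between as well, and these links are shared by [E]. So the
    [E]-predecessor of y and the [E]-successor of x cannot lie strictly between, and beyond the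
    interval they would cross in [E]. *)
Lemma planar_label_consecutive D E x y : planar D -> planar E -> label D =1 label E ->
  consecutive D x y -> consecutive E x y.
Proof.
move=> /planarP plD /planarP plE eqDE.
move: {2}(boundary_pos y - boundary_pos x) (leqnn (boundary_pos y - boundary_pos x)) => d.
elim: d x y => [|d IHd] x y led [ltxy xy gap]; first by move: ltxy led; lia.
have inside_next z : boundary_pos x < boundary_pos z < boundary_pos y ->
    (label D z).2 -> exists2 z', consecutive E z z' & boundary_pos z' < boundary_pos y.
  move=> /andP[ltxz ltzy] /label_next[z' cz]; have [ltzz' zz' _] := cz.
  have ltz'y : boundary_pos z' < boundary_pos y.
    rewrite ltnNge; apply/negP; rewrite leq_eqVlt => /predU1P[/boundary_pos_inj e|lt].
      case/negP: (gap z ltxz ltzy); apply: same_block_trans xy _.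
      by rewrite e same_block_sym.
    by case/negP: (gap z ltxz ltzy); apply: (plD x z y z').
  by exists z' => //; apply: IHd cz; lia.
have inside_prev z : boundary_pos x < boundary_pos z < boundary_pos y ->
    (label D z).1 -> exists2 z', consecutive E z' z & boundary_pos x < boundary_pos z'.
  move=> /andP[ltxz ltzy] /label_previous[z' cz]; have [ltz'z z'z _] := cz.
  have ltxz' : boundary_pos x < boundary_pos z'.
    rewrite ltnNge; apply/negP; rewrite leq_eqVlt => /predU1P[/boundary_pos_inj e|lt].
      by case/negP: (gap z ltxz ltzy); rewrite -e.
    case/negP: (gap z ltxz ltzy); apply: (same_block_trans _ z'z).
    by rewrite same_block_sym; apply: (plD z' x z y).
  by exists z' => //; apply: IHd cz; lia.
have [u cu] : exists u, consecutive E u y.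
  by apply: label_previous; rewrite -eqDE; apply: label_smaller xy ltxy.
have [v cv] : exists v, consecutive E x v.
  by apply: label_next; rewrite -eqDE; apply: label_larger xy ltxy.
have [ltuy uy gapu] := cu; have [ltxv xv gapv] := cv.
case: (ltngtP (boundary_pos u) (boundary_pos x)) => [ltux|ltxu|/boundary_pos_inj <- //].
  have nux : ~~ same_block E u x by apply: gapu.
  case: (ltngtP (boundary_pos v) (boundary_pos y)) => [ltvy|ltyv|/boundary_pos_inj e].
  - have [z' [ltz'v z'v _] ltxz'] : exists2 z', consecutive E z' v & boundary_pos x < boundary_pos z'.
      by apply: inside_prev; rewrite ?ltxv // eqDE; apply: label_smaller xv ltxv.
    case/negP: (gapv z' ltxz' ltz'v); apply: same_block_trans xv _.
    by rewrite same_block_sym.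
  - by case/negP: nux; apply: (plE u x y v).
  - by case/negP: nux; apply: same_block_trans uy _; rewrite -e same_block_sym.
have [z' [ltuz' uz' _] ltz'y] : exists2 z', consecutive E u z' & boundary_pos z' < boundary_pos y.
  by apply: inside_next; rewrite ?ltxu // eqDE; apply: label_larger uy ltuy.
by case/negP: (gapu z' ltuz' ltz'y).
Qed.

Lemma planar_label_sub D E x y : planar D -> planar E -> label D =1 label E ->
  boundary_pos x < boundary_pos y -> same_block D x y -> same_block E x y.
Proof.
move=> plD plE eqDE.
move: {2}(boundary_pos y - boundary_pos x) (leqnn (boundary_pos y - boundary_pos x)) => d.
elim: d x => [|d IHd] x led ltxy xy; first by move: ltxy led; lia.
have [z cz lezy] := next_in_block xy ltxy.
have [ltxz xz _] := cz; have [_ Exz _] := planar_label_consecutive plD plE eqDE cz.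
move: lezy; rewrite leq_eqVlt => /predU1P[/boundary_pos_inj <- //|ltzy].
apply: same_block_trans Exz (IHd z _ ltzy _); first by lia.
by apply: same_block_trans xy; rewrite same_block_sym.
Qed.

Lemma planar_label_inj D E : planar D -> planar E -> label D =1 label E -> D = E.
Proof.
move=> plD plE eqDE.
have sub D' E' x y : planar D' -> planar E' -> label D' =1 label E' ->
    same_block D' x y -> same_block E' x y.
  move=> plD' plE' eqDE'.
  case: (ltngtP (boundary_pos x) (boundary_pos y)) => [lt|lt|/boundary_pos_inj ->].
  - exact: planar_label_sub.
  - rewrite same_block_sym [same_block E' _ _]same_block_sym.
    exact: planar_label_sub.
  - by rewrite !same_block_refl.
apply: same_block_inj => x y; apply/idP/idP; first exact: sub.
by apply: sub.
Qed.

Lemma label_no_three D : no_three D <-> forall x, label D x <> (true, true).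
Proof.
split=> [n3 x|lab].
  case=> /existsP[y /andP[xy ltyx]] /existsP[z /andP[xz ltxz]].
  case/or3P: (n3 _ _ _ xy xz) => /eqP e; move: ltyx ltxz; rewrite e ?ltnn // => ? ?; lia.
have ord3 x y z : boundary_pos x < boundary_pos y -> boundary_pos y < boundary_pos z ->
    same_block D x y -> same_block D y z -> False.
  move=> xy yz sxy syz; apply: (lab y).
  by rewrite [LHS]surjective_pairing (label_smaller sxy xy) (label_larger syz yz).
move=> x y z xy xz; apply/negPn/negP; rewrite !negb_or => /and3P[nxy nxz nyz].
have yz : same_block D y z by apply: same_block_trans xz; rewrite same_block_sym.
have ne (u v : points m n) : u != v -> boundary_pos u != boundary_pos v by rewrite (inj_eq (@boundary_pos_inj _ _)).
have sym u v : same_block D u v -> same_block D v u by rewrite same_block_sym.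
have := ne _ _ nyz; have := ne _ _ nxz; have := ne _ _ nxy.
have [[yx zx] zy] := (sym _ _ xy, sym _ _ xz, sym _ _ yz).
case: (ltngtP (boundary_pos x) (boundary_pos y)) => // lxy _;
case: (ltngtP (boundary_pos x) (boundary_pos z)) => // lxz _;
case: (ltngtP (boundary_pos y) (boundary_pos z)) => // lyz _;
  first [by apply: (ord3 x y z) | by apply: (ord3 x z y) | by apply: (ord3 z x y)
        | by apply: (ord3 y x z) | by apply: (ord3 y z x) | by apply: (ord3 z y x) | lia].
Qed.

Lemma label_no_single D : no_single D <-> forall x, label D x <> (false, false).
Proof.
split=> [n1 x|lab x].
  have [y yx xy] := n1 x; case.
  case: (ltngtP (boundary_pos x) (boundary_pos y)) => [lt|lt|/boundary_pos_inj e].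
  - by have /= -> := label_larger xy lt.
  - by rewrite same_block_sym in xy; have /= -> := label_smaller xy lt.
  - by rewrite e eqxx in yx.
case: (pickP (fun y => (y != x) && same_block D x y)) => [y /andP[]|no]; first by exists y.
case: (lab x); congr (_, _); apply/existsP => -[y /andP[xy lt]];
  by move: (no y); rewrite xy andbT => /negbFE/eqP e; rewrite e ltnn in lt.
Qed.

Lemma label_no_same_bottom D :
  no_same_bottom D <-> forall i : 'I_m, (label D (inl i)).1 = false.
Proof.
split=> [nb i|lab i j ij].
  apply/existsP => -[[j|j] /andP[ij]]; first by rewrite (nb _ _ ij) ltnn.
  by rewrite /=; have := ltn_ord i; lia.
case: (ltngtP i j) => [lt|lt|/val_inj //].
  by have := label_smaller ij lt; rewrite lab.
by rewrite same_block_sym in ij; have := label_smaller ij lt; rewrite lab.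
Qed.

Lemma label_no_same_top D :
  no_same_top D <-> forall i : 'I_n, (label D (inr i)).2 = false.
Proof.
split=> [nb i|lab i j ij].
  apply/existsP => -[[j|j] /andP[ij]]; last by rewrite (nb _ _ ij) ltnn.
  by rewrite /=; have := ltn_ord j; lia.
have pos (a b : 'I_n) : a < b -> boundary_pos (inr b : points m n) < boundary_pos (inr a : points m n).
  by rewrite /=; have := ltn_ord b; lia.
case: (ltngtP i j) => [/pos lt|/pos lt|/val_inj //].
  by rewrite same_block_sym in ij; have := label_larger ij lt; rewrite lab.
by have := label_larger ij lt; rewrite lab.
Qed.

End Labels.

(** * Noncrossing relations from height profiles *)

Section LevelRelation.
Variable f : nat -> int.

(** Two positions joined by a horizontal segment running below the graph of f. The list omits the
    larger position, where f already has the common value. *)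
Definition same_level p q : bool :=
  (f p == f q) && all (fun r => f p <= f r)%R (iota (minn p q) (maxn p q - minn p q)).

Lemma same_levelP p q : reflect
  (f p = f q /\ forall r, minn p q <= r <= maxn p q -> (f p <= f r)%R) (same_level p q).
Proof.
apply: (iffP andP) => [[/eqP e /allP le]|[e le]]; split=> //.
- move=> r /andP[lr rl]; case: (ltngtP r (maxn p q)) rl => // [lt|->] _.
    by apply: le; rewrite mem_iota lr; lia.
  by case: (leqP p q) => _ //; rewrite ?e.
- exact/eqP.
- by apply/allP => r; rewrite mem_iota => ?; apply: le; lia.
Qed.

Lemma same_level_refl p : same_level p p.
Proof. by apply/same_levelP; split=> // r; rewrite minnn maxnn -eqn_leq => /eqP ->. Qed.

Lemma same_level_sym p q : same_level p q = same_level q p.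
Proof.
apply/same_levelP/same_levelP => -[e le]; split=> // r; rewrite minnC maxnC -e;
  exact: le.
Qed.

Lemma same_level_trans p q r : same_level p q -> same_level q r -> same_level p r.
Proof.
move=> /same_levelP[e le] /same_levelP[e' le']; apply/same_levelP.
split=> [|s hs]; first by rewrite e.
have [h|h] : (minn p q <= s <= maxn p q) \/ (minn q r <= s <= maxn q r) by lia.
  exact: le.
by rewrite e; apply: le'.
Qed.

(** Since b lies between a and c, and c between b and d, f a <= f b <= f c = f a. *)
Lemma same_level_noncrossing a b c d : a < b -> b < c -> c < d ->
  same_level a c -> same_level b d -> same_level a b.
Proof.
move=> ab bc cd /same_levelP[ac lea] /same_levelP[bd leb].
have ab' : (f a <= f b)%R by apply: lea; lia.
have ba' : (f b <= f c)%R by apply: leb; lia.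
have e : f a = f b by apply: le_anti; rewrite ab' ac ba'.
by apply/same_levelP; split=> // r hr; apply: lea; lia.
Qed.

End LevelRelation.

(** A letter records whether the block goes on to the left and to the right: an opening point raises
    the height by 1, a closing one lowers it, and middle and isolated points keep it. *)
Definition step (l : bool * bool) : int := ((l.2 : nat)%:Z - (l.1 : nat)%:Z)%R.

Definition height (s : seq (bool * bool)) i : int := (\sum_(l <- take i s) step l)%R.

Definition letter s i : bool * bool := nth (false, false) s i.

Lemma height0 s : height s 0 = 0%R.
Proof. by rewrite /height take0 big_nil. Qed.

Lemma heightS s i : i < size s -> height s i.+1 = (height s i + step (letter s i))%R.
Proof. by move=> lt; rewrite /height (take_nth (false, false)) // big_rcons. Qed.

(* Heights of a word of opening, closing, middle and isolated points: the points
   of a block have the height of the block and all points and heights between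
   them are at least as high. Even positions of the profile are the heights
   between the points, odd positions those of the points. *)
Definition profile s p : int :=
  if odd p then (height s p./2 + (~~ (letter s p./2).1 : nat)%:Z)%R else height s p./2.

Lemma profile_even s i : profile s i.*2 = height s i.
Proof. by rewrite /profile odd_double doubleK. Qed.

Lemma profile_odd s i :
  profile s i.*2.+1 = (height s i + (~~ (letter s i).1 : nat)%:Z)%R.
Proof. by rewrite /profile /= odd_double /= uphalf_double. Qed.

(** The last condition matters for middle letters, which leave the height unchanged and need a block
    that is already open. *)
Record ballot (s : seq (bool * bool)) : Prop := Ballot {
  ballot_ge0 : forall i, (0 <= height s i)%R;
  ballot_total : height s (size s) = 0%R;
  ballot_middle : forall i, i < size s -> (letter s i).1 -> (0 < height s i)%R }.

Section WordRelation.
Variables (s : seq (bool * bool)).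
Hypothesis bs : ballot s.

Lemma step_bound l : (-1 <= step l <= 1)%R.
Proof. by case: l => [[] []]. Qed.

Lemma height_le_profile i : (height s i <= profile s i.*2.+1)%R.
Proof. by rewrite profile_odd lerDl; case: (letter s i).1. Qed.

Lemma level_pos i : i < size s -> (0 < profile s i.*2.+1)%R.
Proof.
move=> lt; rewrite profile_odd; case l1 : (letter s i).1 => /=.
  by rewrite addr0; apply: ballot_middle bs _ lt l1.
by have := ballot_ge0 bs i; lia.
Qed.

(** The related point is the last one of the block: the letter just before the height first falls
    below the level of i. Such a fall exists, since this level is positive and the word ends at
    height 0. *)
Lemma related_next i : i < size s -> (letter s i).2 ->
  exists2 j, i < j < size s & same_level (profile s) i.*2.+1 j.*2.+1.
Proof.
move=> lti l2; set L := profile s i.*2.+1.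
have Lpos : (0 < L)%R := level_pos lti.
have h1 : (L <= height s i.+1)%R.
  by rewrite heightS // /L profile_odd /step l2; case: (letter s i).1; lia.
have ex : exists k, (i < k) && (height s k < L)%R.
  by exists (size s); rewrite lti (ballot_total bs).
have := ex_minnP ex => -[k /andP[ltik hk] kmin].
have kS : i.+1 < k.
  rewrite ltn_neqAle ltik andbT; apply: contraTneq hk => <-.
  by rewrite -leNgt.
have k1 : k = k.-1.+1 by lia.
have above r : i < r < k -> (L <= height s r)%R.
  move=> /andP[lt1 lt2]; rewrite leNgt; apply/negP => hr.
  by have := kmin r; rewrite lt1 hr => /(_ isT); lia.
have ksz : k.-1 < size s.
  have : k <= size s by apply: kmin; rewrite lti (ballot_total bs).
  by lia.
have hk1 : (L <= height s k.-1)%R by apply: above; lia.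
have st : height s k = (height s k.-1 + step (letter s k.-1))%R.
  by rewrite {1}k1 heightS.
have eL : profile s k.-1.*2.+1 = L.
  have := step_bound (letter s k.-1); rewrite profile_odd.
  move: st hk hk1; rewrite /step; case: (letter s k.-1) => [[] []] /=; lia.
exists k.-1; first by lia.
apply/same_levelP; split; first by rewrite eL.
move=> r hr; rewrite -/L.
have [e|h1'|[j [ltj1 ej]]] : [\/ r = i.*2.+1, r = k.-1.*2.+1 |
    exists j, i < j < k /\ (r = j.*2 \/ r = j.*2.+1)].
  have := odd_double_half r; case: (odd r) => /= er.
    case: (ltngtP r./2 i) => [?|?|?]; [lia| |by constructor 1; lia].
    case: (ltngtP r./2 k.-1) => [?|?|e]; [|lia|by constructor 2; lia].
    by constructor 3; exists r./2; split; [lia|right; lia].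
  by constructor 3; exists r./2; split; [lia|left; lia].
- by rewrite e.
- by rewrite h1' eL.
have := above j ltj1; have := height_le_profile j.
by case: ej => ->; rewrite ?profile_even; lia.
Qed.

(** Symmetrically, the related point is the opening one: the last position up to i whose height is
    below the level of i, which exists because the word starts at height 0. *)
Lemma related_previous i : i < size s -> (letter s i).1 ->
  exists2 j, j < i & same_level (profile s) j.*2.+1 i.*2.+1.
Proof.
move=> lti l1; set L := profile s i.*2.+1.
have Lpos : (0 < L)%R := level_pos lti.
have h1 : L = height s i by rewrite /L profile_odd l1 /= addr0.
have ex : exists k, (k <= i) && (height s k < L)%R.
  by exists 0; rewrite leq0n height0.
have bound k : (k <= i) && (height s k < L)%R -> k <= i by case/andP.
have := ex_maxnP ex bound => -[k /andP[leki hk] kmax].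
have ki : k < i.
  by rewrite ltn_neqAle leki andbT; apply: contraTneq hk => ->; rewrite h1 ltxx.
have above r : k < r <= i -> (L <= height s r)%R.
  move=> /andP[lt1 lt2]; rewrite leNgt; apply/negP => hr.
  by have := kmax r; rewrite lt2 hr => /(_ isT); lia.
have ksz : k < size s by apply: ltn_trans lti.
have hk1 : (L <= height s k.+1)%R by apply: above; lia.
have st : height s k.+1 = (height s k + step (letter s k))%R by rewrite heightS.
have eL : profile s k.*2.+1 = L.
  rewrite profile_odd; move: st hk hk1; rewrite /step.
  by case: (letter s k) => [[] []] /=; lia.
exists k => //; apply/same_levelP; split; first by rewrite eL.
move=> r hr; rewrite eL.
have [e|h1'|[j [ltj1 ej]]] : [\/ r = k.*2.+1, r = i.*2.+1 |
    exists j, k < j <= i /\ (r = j.*2 \/ r = j.*2.+1)].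
  have := odd_double_half r; case: (odd r) => /= er.
    case: (ltngtP r./2 k) => [?|?|?]; [lia| |by constructor 1; lia].
    case: (ltngtP r./2 i) => [?|?|e]; [|lia|by constructor 2; lia].
    by constructor 3; exists r./2; split; [lia|right; lia].
  by constructor 3; exists r./2; split; [lia|left; lia].
- by rewrite e eL.
- by rewrite h1'.
have := above j ltj1; have := height_le_profile j.
by case: ej => ->; rewrite ?profile_even; lia.
Qed.

Lemma related_letter i j : i < j < size s ->
  same_level (profile s) i.*2.+1 j.*2.+1 -> (letter s i).2 /\ (letter s j).1.
Proof.
move=> /andP[ltij ltj] /same_levelP[e le].
have lti : i < size s by apply: ltn_trans ltj.
have h1 : (profile s i.*2.+1 <= height s i.+1)%R by rewrite -profile_even; apply: le; lia.
have h2 : (profile s i.*2.+1 <= height s j)%R by rewrite -profile_even; apply: le; lia.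
split; last by move: h2; rewrite e profile_odd; case: (letter s j).1 => //=; lia.
move: h1; rewrite heightS // profile_odd /step.
by case: (letter s i) => [[] []] //=; lia.
Qed.

End WordRelation.

Lemma boundary_pos_lt m n (x : points m n) : boundary_pos x < m + n.
Proof. by case: x => i /=; have := ltn_ord i; lia. Qed.

Lemma boundary_pos_surj m n j : j < m + n -> exists x : points m n, boundary_pos x = j.
Proof.
move=> lt; case: (ltnP j m) => [ltm|lem]; first by exists (inl (Ordinal ltm)).
have lt' : (m + n - j).-1 < n by lia.
by exists (inr (Ordinal lt')) => /=; lia.
Qed.

Section WordDiagram.
Variables (m n : nat) (s : seq (bool * bool)).

Definition word_diagram : diagram m n :=
  fiber_diagram (fun x : points m n =>
    [set y : points m n |
      same_level (profile s) (boundary_pos x).*2.+1 (boundary_pos y).*2.+1]).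

Lemma same_block_word x y : same_block word_diagram x y =
  same_level (profile s) (boundary_pos x).*2.+1 (boundary_pos y).*2.+1.
Proof.
rewrite same_block_fiber; apply/eqP/idP => [/setP/(_ y)|xy].
  by rewrite !inE same_level_refl.
apply/setP => z; rewrite !inE; apply/idP/idP; apply: same_level_trans => //.
by rewrite same_level_sym.
Qed.

Lemma planar_word : planar word_diagram.
Proof.
apply/planarP => a b c d ab bc cd; rewrite !same_block_word.
by apply: same_level_noncrossing; lia.
Qed.

Hypothesis bs : ballot s.
Hypothesis sz : size s = m + n.

Lemma label_word x : label word_diagram x = letter s (boundary_pos x).
Proof.
have lts (y : points m n) : boundary_pos y < size s by rewrite sz boundary_pos_lt.
rewrite [RHS]surjective_pairing; congr (_, _).
  apply/existsP/idP => [[y /andP[]]|l1].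
    rewrite same_block_word same_level_sym => sl lt.
    have lt' : boundary_pos y < boundary_pos x < size s by rewrite lt lts.
    by case: (related_letter lt' sl).
  have [j ltj sl] := related_previous bs (lts x) l1.
  have [|y ey] := @boundary_pos_surj m n j; first by rewrite -sz; apply: ltn_trans (lts x).
  by exists y; rewrite same_block_word same_level_sym ey sl.
apply/existsP/idP => [[y /andP[]]|l2].
  rewrite same_block_word => sl lt.
  have lt' : boundary_pos x < boundary_pos y < size s by rewrite lt lts.
  by case: (related_letter lt' sl).
have [j /andP[ltj ltjs] sl] := related_next bs (lts x) l2.
have [|y ey] := @boundary_pos_surj m n j; first by rewrite -sz.
by exists y; rewrite same_block_word ey sl.
Qed.

End WordDiagram.

(** * Rotation of balanced words to nonnegative ones *)

Lemma height_take_drop s r i : height s (r + i) = (height s r + height (drop r s) i)%R.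
Proof. by rewrite /height takeD big_cat. Qed.

Lemma height_oversize s i : size s <= i -> height s i = height s (size s).
Proof. by move=> le; rewrite /height take_oversize // take_size. Qed.

Lemma height_cat s1 s2 i : height (s1 ++ s2) i =
  if i < size s1 then height s1 i else (height s1 (size s1) + height s2 (i - size s1))%R.
Proof.
by rewrite /height take_cat; case: ltnP => // _; rewrite big_cat take_size.
Qed.

Lemma height_size_cat s1 s2 : height (s1 ++ s2) (size (s1 ++ s2)) =
  (height s1 (size s1) + height s2 (size s2))%R.
Proof. by rewrite /height !take_size big_cat. Qed.

(* Cut a balanced circular word where its height is minimal. *)
Lemma rotation_ge0 s : height s (size s) = 0%R ->
  exists2 r, r <= size s & forall i, (0 <= height (rot r s) i)%R.
Proof.
move=> tot.
have [r _ rmin] := @Order.TotalTheory.arg_minP _ _ 'I_(size s).+1 ord0 predT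
  (fun r : 'I_(size s).+1 => height s r) isT.
have {}rmin i : (height s r <= height s i)%R.
  case: (ltnP i (size s).+1) => [lt|le]; first exact: (rmin (Ordinal lt)).
  by rewrite (height_oversize (ltnW le)) //; exact: (rmin ord_max isT).
have lers : r <= size s by rewrite -ltnS.
exists r => // i; rewrite /rot height_cat size_drop; case: ltnP => [lt|le].
  have := rmin (r + i); rewrite height_take_drop.
  by rewrite lerDl.
have := rmin (minn (i - (size s - r)) r).
have -> : height (drop r s) (size s - r) = (- height s r)%R.
  have := height_take_drop s r (size s - r); rewrite subnKC // tot => /esym/eqP.
  by rewrite addrC addr_eq0 => /eqP.
have -> : height (take r s) (i - (size s - r)) = height s (minn (i - (size s - r)) r).
  by rewrite /height take_min.
by rewrite addrC subr_ge0.
Qed.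

Lemma height_cons l s i : height (l :: s) i.+1 = (step l + height s i)%R.
Proof. by rewrite /height /= big_cons. Qed.

Lemma height_bound s i : (- (size s)%:Z <= height s i <= (size s)%:Z)%R.
Proof.
elim: s i => [|l s IHs] i; first by rewrite /height big_nil.
case: i => [|i]; first by rewrite height0.
by rewrite height_cons /=; have := IHs i; have := step_bound l; lia.
Qed.

Definition nonneg s : bool :=
  (height s (size s) == 0%R) && all (fun i => 0 <= height s i)%R (iota 0 (size s)).

Lemma nonnegP s : reflect (height s (size s) = 0%R /\ forall i, (0 <= height s i)%R) (nonneg s).
Proof.
apply: (iffP andP) => [[/eqP tot /allP ge]|[tot ge]]; last first.
  by split; [apply/eqP|apply/allP => i _].
split=> // i; case: (ltnP i (size s)) => [lt|le]; first by apply: ge; rewrite mem_iota.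
by rewrite height_oversize // tot.
Qed.

Definition swap (l : bool * bool) := (l.2, l.1).

Lemma step_swap l : step (swap l) = (- step l)%R.
Proof. by rewrite /step opprB. Qed.

Section Alphabet.
Variables (T : finType) (dec : T -> bool * bool) (sw : T -> T).
Hypothesis dec_inj : injective dec.
Hypothesis dec_sw : forall a, dec (sw a) = swap (dec a).

Definition nonneg_words N : {set N.-tuple T} := [set s : N.-tuple T | nonneg (map dec s)].

Lemma sw_inj : injective sw.
Proof.
move=> a b /(congr1 dec); rewrite !dec_sw => -[e1 e2]; apply: dec_inj.
by rewrite [LHS]surjective_pairing e1 e2 -surjective_pairing.
Qed.

Lemma height_sw (u : seq T) : height (map dec (map sw u)) (size u) = (- height (map dec u) (size u))%R.
Proof.
rewrite /height !take_oversize ?size_map // !big_map -sumrN.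
by apply: eq_bigr => a _; rewrite dec_sw step_swap.
Qed.

(** Two words of length n with equal total height give a balanced word, the first followed by the
    swapped second. Totals take at most 2n + 1 values, which by Cauchy-Schwarz costs one factor 2n +
    1; remembering the rotation that makes the word nonnegative costs the other. *)
Lemma nonneg_words_ge n :
  (#|T| ^ n) ^ 2 <= (n + n).+1 ^ 2 * #|nonneg_words (n + n)|.
Proof.
pose tot (u : n.-tuple T) : int := height (map dec u) n.
pose f u : 'I_(n + n).+1 := inord (absz (tot u + n%:Z)%R).
have totb u : (- n%:Z <= tot u <= n%:Z)%R.
  by have := height_bound (map dec u) n; rewrite size_map size_tuple.
have fE u v : f u = f v -> tot u = tot v.
  move/(congr1 val); rewrite /= !inordK; have := totb u; have := totb v; lia.
have := square_card_le f; rewrite card_tuple card_ord => /leq_trans; apply.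
rewrite expnS expn1 -mulnA leq_mul2l /=.
set P := [set p | _].
have ex p : exists q : 'I_(n + n).+1 * (n + n).-tuple T, p \in P ->
    q.2 \in nonneg_words (n + n) /\
    p.1 ++ map sw p.2 = rotr q.1 q.2 :> seq T.
  case: (boolP (p \in P)) => [|_]; last first.
    (* An arbitrary value outside [P], so that choice yields a total function. *)
    by exists (ord0, cat_tuple p.1 p.2).
  case: p => u v; rewrite inE /= => /eqP /fE euv.
  pose s := [tuple of u ++ [tuple of map sw v]].
  have tot0 : height (map dec s) (size (map dec s)) = 0%R.
    rewrite /= map_cat height_size_cat !size_map !size_tuple.
    have := height_sw v; rewrite size_tuple => ->.
    by rewrite -/(tot u) -/(tot v) euv subrr.
  have [r ler ge] := rotation_ge0 tot0.
  have ltr : r < (n + n).+1 by move: ler; rewrite size_map size_tuple.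
  exists (Ordinal ltr, [tuple of rot r s]) => _ /=; split; last by rewrite rotK.
  rewrite inE; apply/nonnegP; rewrite /= map_rot -[_ ++ _]/(val s); split=> //.
  by apply: etrans tot0; rewrite /height !take_size; apply: perm_big; rewrite perm_rot.
have [g gP] := boolp.choice ex.
have ginj : {in P &, injective g}.
  move=> [u v] [u' v'] pP pP' eg.
  have [_ e] := gP _ pP; have [_ e'] := gP _ pP'.
  have := e; rewrite eg -e' => /eqP; rewrite /= eqseq_cat ?size_tuple // => /andP[/eqP eu /eqP ev].
  by congr (_, _); apply: val_inj => //; apply: inj_map ev; apply: sw_inj.
rewrite -(card_in_imset ginj) -[X in X * _]card_ord -cardsT -cardsX.
apply: subset_leq_card; apply/subsetP => _ /imsetP[p pP ->].
by rewrite inE in_setT; have [] := gP _ pP.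
Qed.

End Alphabet.

Section ClassCount.
Variables (m n : nat).

(** The decoding may depend on the point, as rook and permutation diagrams allow different labels at
    the bottom and at the top. *)
Lemma card_planar_le (T : finType) (dec : points m n -> T -> bool * bool)
    (P : pred (diagram m n)) :
  (forall D, P D -> planar D /\ forall x, exists a, label D x = dec x a) ->
  #|P| <= #|T| ^ (m + n).
Proof.
move=> PP; pose lab (D : diagram m n) := [ffun x => label D x].
have labinj : {in [set D | P D] &, injective lab}.
  move=> D E; rewrite !inE => /PP[plD _] /PP[plE _] /ffunP e.
  by apply: planar_label_inj => // x; have := e x; rewrite !ffunE.
rewrite -cardsE -(card_in_imset labinj).
have -> : #|T| ^ (m + n) = #|[set: {ffun points m n -> T}]|.
  by rewrite cardsT card_ffun card_sum !card_ord.
apply: leq_trans (leq_imset_card (fun g : {ffun points m n -> T} => [ffun x => dec x (g x)]) _).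
apply: subset_leq_card; apply/subsetP => _ /imsetP[D + ->]; rewrite inE => /PP[_ ex].
have [g gP] := boolp.choice ex.
apply/imsetP; exists [ffun x => g x]; first by rewrite inE.
by apply/ffunP => x; rewrite !ffunE gP.
Qed.

Lemma card_words_le (U : finType) (W : {set U}) (word : U -> seq (bool * bool))
    (P : pred (diagram m n)) :
  {in W &, injective word} -> (forall u, u \in W -> ballot (word u)) ->
  (forall u, u \in W -> size (word u) = m + n) ->
  (forall u, u \in W -> P (word_diagram m n (word u))) -> #|W| <= #|P|.
Proof.
move=> winj wb wsz wP; pose D u := word_diagram m n (word u).
have Dinj : {in W &, injective D}.
  move=> u v uW vW e; apply: winj => //.
  apply: (@eq_from_nth _ (false, false)); first by rewrite !wsz.
  move=> i; rewrite wsz // => lti; have [x <-] := @boundary_pos_surj m n i lti.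
  have := label_word (wb u uW) (wsz u uW) x; rewrite -/(D u) e.
  by rewrite (label_word (wb v vW) (wsz v vW)) => /esym.
rewrite -(card_in_imset Dinj) -(cardsE P); apply: subset_leq_card.
by apply/subsetP => _ /imsetP[u uW ->]; rewrite inE; apply: wP.
Qed.

End ClassCount.

Lemma letter_map (T : Type) (dec : T -> bool * bool) (s : seq T) i :
  i < size s -> exists a, letter (map dec s) i = dec a.
Proof.
case: s => // a s lt; exists (nth a (a :: s) i).
by rewrite /letter (nth_map a).
Qed.

Lemma nonneg_ballot s : nonneg s ->
  (forall i, i < size s -> letter s i <> (true, true)) -> ballot s.
Proof.
case/nonnegP => tot ge no; split=> // i lti l1.
have := ge i.+1; rewrite heightS //; have := no i lti; move: l1.
by case: (letter s i) => [[] []] //= _ _; rewrite /step /=; lia.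
Qed.

(** One polynomial factor serves all classes: (2n + 1)^2 pays for balancing and rotating words, and
    16 = 4^2 for the two letters given up in planar partitions. *)
Definition growth (K : diagram_class) (c : nat) : Prop := forall n,
  #|@class_mem K n n| <= c ^ (n + n) /\
  c ^ (n + n) <= (4 * (n + n).+1) ^ 2 * #|@class_mem K n n|.

Lemma card_class_gt0 (K : diagram_class) n : 0 < #|@class_mem K n n|.
Proof. by apply/card_gt0P; exists (id_diagram n); apply: class_id. Qed.

Lemma growth_of_words (K : diagram_class) (T : finType) (dec : T -> bool * bool) (sw : T -> T) :
  injective dec -> (forall a, dec (sw a) = swap (dec a)) ->
  (forall a, dec a <> (true, true)) ->
  (forall n (D : diagram n n), K _ _ D <->
     planar D /\ forall x, exists a, label D x = dec a) ->
  growth K #|T|.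
Proof.
move=> dinj dsw d11 KP n; split.
  by apply: (card_planar_le (dec := fun=> dec)) => D /KP.
have := nonneg_words_ge dinj dsw n; rewrite -expnM muln2 -addnn => /leq_trans; apply.
apply: leq_mul; first by rewrite leq_exp2r // leq_pmull.
apply: (card_words_le (word := fun s : (n + n).-tuple T => map dec s)).
- by move=> u v _ _ /(inj_map dinj) /val_inj.
- move=> u; rewrite inE => nn; apply: nonneg_ballot => // i.
  by rewrite size_map => lti; have [a ->] := letter_map dec lti.
- by move=> u _; rewrite size_map size_tuple.
move=> u; rewrite inE => nn; apply/KP; split; first exact: planar_word.
have sz : size (map dec u) = n + n by rewrite size_map size_tuple.
move=> x; rewrite (label_word _ sz).
  apply: letter_map; rewrite size_tuple; exact: boundary_pos_lt.
apply: nonneg_ballot => // i; rewrite size_map => lti.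
by have [a ->] := letter_map dec lti.
Qed.

Lemma growth_motzkin : growth motzkin 3.
Proof.
pose dec (a : option bool) := if a is Some b then (b, ~~ b) else (false, false).
have -> : 3 = #|{: option bool}| by rewrite card_option card_bool.
apply: (@growth_of_words _ _ dec (omap negb)).
- by move=> [[]|] [[]|].
- by move=> [[]|].
- by move=> [[]|].
move=> n D; rewrite motzkinP label_no_three; split=> -[plD lab]; split=> // x.
  have := lab x; case: (label D x) => [[] []] // _.
  - by exists (Some true).
  - by exists (Some false).
  - by exists None.
by have [[[]|] ->] := lab x.
Qed.

Lemma growth_temperley_lieb : growth temperley_lieb 2.
Proof.
pose dec (b : bool) := (b, ~~ b).
have -> : 2 = #|{: bool}| by rewrite card_bool.
apply: (@growth_of_words _ _ dec negb); try by case.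
  by move=> [] [].
move=> n D; rewrite temperley_liebP.
split=> [[plD /label_no_three l3 /label_no_single l1]|[plD lab]]; split=> //.
- move=> x; have := l3 x; have := l1 x; case: (label D x) => [[] []] // _ _.
    by exists true.
  by exists false.
- by apply/label_no_three => x; have [[] ->] := lab x.
- by apply/label_no_single => x; have [[] ->] := lab x.
Qed.

(** A nonnegative word may have a middle letter at height 0. Placed between an opening and a closing
    letter, its inner heights grow by 1 and it becomes a ballot word. *)
Lemma growth_planar_partition : growth planar_partition 4.
Proof.
move=> n; split.
  have -> : 4 = #|{: bool * bool}| by rewrite card_prod card_bool.
  apply: (card_planar_le (dec := fun _ a => a)) => D plD.
  by split=> // x; exists (label D x).
(* The enclosing letters need at least two points, so n = 0 is separate; otherwise the inner word
   has two letters fewer, whence the factor 16. *)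
case: n => [|n].
  by rewrite expn0 muln_gt0 expn_gt0 card_class_gt0.
have ge : 4 ^ (n + n) <= (n + n).+1 ^ 2 * #|nonneg_words id (n + n)|.
  have := @nonneg_words_ge _ id swap (fun _ _ e => e) (fun=> erefl) n.
  by rewrite card_prod card_bool -expnM (muln2 n) -(addnn n).
apply: (@leq_trans (16 * ((n + n).+1 ^ 2 * #|nonneg_words id (n + n)|))).
  by rewrite addSn addnS (expnS 4) (expnS 4) mulnA leq_mul2l ge orbT.
rewrite mulnA; apply: leq_mul.
  rewrite -[16]/(4 ^ 2) -expnMn leq_exp2r // leq_mul2l /=; lia.
pose word (s : (n + n).-tuple (bool * bool)) := (false, true) :: rcons (map id s) (true, false).
have sz s : size (word s) = n.+1 + n.+1 by rewrite /= size_rcons size_map size_tuple; lia.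
have wb (s : (n + n).-tuple (bool * bool)) : nonneg (map id s) -> ballot (word s).
  case/nonnegP => tot ge0.
  have hin i : i <= n + n -> height (word s) i.+1 = (1 + height (map id s) i)%R.
    move=> le; rewrite /height /= big_cons -cats1 take_cat size_map size_tuple.
    case: ltnP => // ge1; have -> : i = n + n by lia.
    by rewrite subnn take0 cats0 take_oversize // size_map size_tuple.
  have hlast : height (word s) (n.+1 + n.+1) = 0%R.
    rewrite /height take_oversize ?sz // big_cons -cats1 big_cat big_seq1 /=.
    by move: tot; rewrite /height take_size => ->.
  split.
  - move=> [|i]; first by rewrite height0.
    case: (leqP i (n + n)) => [le|lt]; first by rewrite hin //; have := ge0 i; lia.
    by rewrite height_oversize ?sz ?hlast //; lia.
  - by rewrite sz.
  move=> [|i] //; rewrite sz => lti l1.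
  by rewrite hin; [have := ge0 i; lia|lia].
apply: (card_words_le (word := word)).
- by move=> u v _ _ [] /rcons_inj[]; rewrite !map_id => /val_inj.
- by move=> u; rewrite inE => /wb.
- by move=> u _; apply: sz.
by move=> u; rewrite inE => /wb ?; apply: planar_word.
Qed.

(** Rotation would mix bottom and top letters, but bottom points only open and top points only
    close. Openings thus precede closings, and equal numbers of both suffice for a ballot word. *)
Lemma growth_planar_rook : growth planar_rook 2.
Proof.
move=> n; split.
  have -> : 2 = #|{: bool}| by rewrite card_bool.
  pose dec (x : points n n) b := if x is inl _ then (false, b) else (b, false).
  apply: (card_planar_le (dec := dec)) => D /planar_rookP[plD].
  move=> /label_no_same_bottom lb /label_no_same_top lt; split=> // -[i|i].
    by exists (label D (inl i)).2; rewrite [LHS]surjective_pairing lb.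
  by exists (label D (inr i)).1; rewrite [LHS]surjective_pairing lt.
pose f (u : n.-tuple bool) : 'I_n.+1 := inord (count id u).
have cle (u : n.-tuple bool) : count id u < n.+1.
  by rewrite ltnS -[X in _ <= X](size_tuple u) count_size.
have := square_card_le f; rewrite card_tuple card_ord card_bool -expnM muln2 -addnn.
move=> /leq_trans; apply; set P := [set p | _].
apply: leq_mul; first by rewrite expnS expn1; apply: leq_trans (leq_pmulr _ _); lia.
pose wb (u : seq bool) := [seq (false, b) | b <- u].
pose wt (u : seq bool) := [seq (b, false) | b <- u].
pose word (p : n.-tuple bool * n.-tuple bool) := wb p.1 ++ wt p.2.
have sz p : size (word p) = n + n by rewrite size_cat !size_map !size_tuple.
have hb (u : seq bool) i : height (wb u) i = Posz (count id (take i u)).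
  rewrite /height -map_take big_map; elim: (take i u) => [|b v IHv] /=.
    by rewrite big_nil.
  by rewrite big_cons IHv /step /= subr0 PoszD.
have ht (u : seq bool) i : height (wt u) i = (- Posz (count id (take i u)))%R.
  rewrite /height -map_take big_map; elim: (take i u) => [|b v IHv] /=.
    by rewrite big_nil.
  by rewrite big_cons IHv /step /= sub0r PoszD opprD.
have eqc p : p \in P -> count id p.1 = count id p.2.
  by rewrite inE => /eqP /(congr1 val) /=; rewrite !inordK.
have letl p i : i < n -> (letter (word p) i).1 = false.
  move=> lt; rewrite /letter nth_cat size_map size_tuple lt.
  by rewrite (nth_map false) ?size_tuple.
have letr p i : n <= i -> (letter (word p) i).2 = false.
  move=> le; rewrite /letter nth_cat size_map size_tuple ltnNge le /=.
  case: (ltnP (i - n) n) => [lt|le']; first by rewrite (nth_map false) ?size_tuple.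
  by rewrite nth_default // size_map size_tuple.
have wbal p : p \in P -> ballot (word p).
  move=> pP; apply: nonneg_ballot.
    apply/nonnegP; split=> [|i].
      rewrite height_size_cat hb ht !take_oversize ?size_map //.
      by rewrite eqc // subrr.
    rewrite height_cat hb ht size_map size_tuple; case: ltnP => // le.
    rewrite hb take_oversize ?size_tuple // eqc //.
    have := count_cat id (take (i - n) p.2) (drop (i - n) p.2).
    by rewrite cat_take_drop subr_ge0 lez_nat => ->; rewrite leq_addr.
  move=> i _; case: (ltnP i n) => [lt|le] e.
    by have := letl p i lt; rewrite e.
  by have := letr p i le; rewrite e.
apply: (card_words_le (word := word)) => //.
  move=> [u v] [u' v'] _ _ /eqP; rewrite /word eqseq_cat ?size_map ?size_tuple //=.
  move=> /andP[/eqP /inj_map eu /eqP /inj_map ev].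
  by congr (_, _); apply: val_inj; [apply: eu|apply: ev] => a b [].
move=> p pP; apply/planar_rookP; split; first exact: planar_word.
  by apply/label_no_same_bottom => i; rewrite (label_word (wbal p pP) (sz p)) letl //= ltn_ord.
by apply/label_no_same_top => i; rewrite (label_word (wbal p pP) (sz p)) letr //= leq_addr.
Qed.

Lemma growth_planar_symmetric : growth planar_symmetric 1.
Proof.
move=> n; rewrite !exp1n; split; last first.
  by rewrite muln_gt0 expn_gt0 muln_gt0 card_class_gt0.
have -> : 1 = #|{: unit}| ^ (n + n) by rewrite card_unit exp1n.
pose dec (x : points n n) (_ : unit) := if x is inl _ then (false, true) else (true, false).
apply: (card_planar_le (dec := dec)) => D /planar_symmetricP[plD].
move=> /label_no_same_bottom lb /label_no_same_top lt /label_no_single l1.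
split=> // x; exists tt; have := l1 x.
case: x => i /=; [have := lb i|have := lt i]; by case: (label D _) => [[] []].
Qed.

(** * Asymptotics *)

Local Open Scope ring_scope.

Lemma linear_le_expR (R : realType) (e : R) : 0 < e ->
  exists N, forall n, (N <= n)%N -> (4 * (n + n).+1)%:R <= expR (n%:R * e).
Proof.
(* By exp x >= 1 + x^2 / 2 it is enough that 12 n <= n^2 e^2 / 2, that is n >= 24 / e^2. The
   successor ensures n >= 1, so that 8 n + 4 <= 12 n. *)
move=> e0; pose N := Num.bound (24 / e ^+ 2); exists N.+1 => n leNn.
have n1 : 1 <= n%:R :> R by rewrite ler1n; apply: leq_trans leNn.
have nN : 24 / e ^+ 2 <= n%:R.
  apply: (@le_trans _ _ N%:R); last by rewrite ler_nat ltnW.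
  by apply/ltW/archi_boundP; rewrite divr_ge0 // exprn_ge0 // ltW.
have n24 : 24 <= n%:R * e ^+ 2 by rewrite -ler_pdivrMr // exprn_gt0.
apply: (@le_trans _ _ (12 * n%:R)).
  rewrite (_ : (4 * (n + n).+1 = 8 * n + 4)%N); last by lia.
  by rewrite natrD natrM; lra.
apply: le_trans (expR_ge1Dxn 1 _); last by rewrite mulr_ge0 // ltW.
rewrite (_ : (2`!)%N = 2) // exprMn.
have := ler_wpM2r (ler0n R n) n24; rewrite expr2 => h.
by lra.
Qed.

(** The logarithm of [b n] differs from n ln c by at most the logarithm of a linear factor, which is
    below n e for large n whatever e > 0 is. *)
Lemma asymptotic_nth_root (R : realType) (b : nat -> nat) (c : nat) : (0 < c)%N ->
  (forall n, c ^ n <= (4 * (n + n).+1) * b n)%N ->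
  (forall n, b n <= n.+1 * c ^ n)%N ->
  asymptotic (fun n => nth_root n ((b n)%:R : R)) (fun=> c%:R).
Proof.
move=> c0 lo hi.
have b0 n : (0 < b n)%N.
  by rewrite lt0n; apply/eqP => bn; have := lo n; rewrite bn muln0 leqn0 expn_eq0 eqn0Ngt c0.
have cR : 0 < c%:R :> R by rewrite ltr0n.
have bR n : 0 < (b n)%:R :> R by rewrite ltr0n.
pose d n : R := n%:R^-1 * ln (b n)%:R - ln c%:R.
have dE n : nth_root n ((b n)%:R : R) / c%:R = expR (d n).
  rewrite /nth_root /powR gt_eqF // /d expRB; congr (_ / _).
  by rewrite lnK // posrE.
have dlim : (d n @[n --> \oo] --> (0 : R))%classic.
  apply/cvgr0Pnorm_le => e e0.
  have [N NP] := linear_le_expR e0.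
  exists N.+1 => // n /= ltNn.
  have n0 : 0 < n%:R :> R by rewrite ltr0n; apply: leq_trans ltNn.
  have pe := NP n (ltnW ltNn).
  have dn : d n = n%:R^-1 * (ln (b n)%:R - n%:R * ln c%:R).
    by rewrite /d mulrBr mulKf ?gt_eqF.
  have lnc : n%:R * ln c%:R = ln (c ^ n)%:R :> R.
    by rewrite natrX lnXn // mulr_natl.
  rewrite dn normrM normfV (gtr0_norm n0) ler_pdivrMl // lnc ler_norml.
  have up (x y : nat) : (0 < x)%N -> (0 < y)%N -> (x <= (4 * (n + n).+1) * y)%N ->
      ln x%:R <= n%:R * e + ln y%:R :> R.
    move=> x0 y0 xy; rewrite -ler_expR expRD !lnK ?posrE ?ltr0n //.
    apply: (@le_trans _ _ ((4 * (n + n).+1) * y)%:R); first by rewrite ler_nat.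
    by rewrite natrM ler_wpM2r.
  have h1 := up (b n) (c ^ n)%N (b0 n).
  have h2 := up (c ^ n)%N (b n).
  rewrite expn_gt0 c0 /= in h1 h2.
  have {}h1 : ln (b n)%:R <= n%:R * e + ln (c ^ n)%:R.
    by apply: h1 => //; apply: leq_trans (hi n) _; rewrite leq_mul2r; apply/orP; right; lia.
  have {}h2 := h2 isT (b0 n) (lo n).
  by apply/andP; split; lra.
rewrite /asymptotic (_ : (fun n => _) = expR \o d); last first.
  by apply: boolp.funext => n; rewrite dE.
rewrite -(@expR0 R); apply: cvg_comp dlim _.
exact: continuous_expR.
Qed.

(** The dimension estimates concern the square of [b n], so the required inequalities are compared
    after squaring. *)
Lemma growth_summands (R : realType) (t : R[i]) (K : diagram_class) c : (0 < c)%N ->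
  stack_closed K -> thin K -> growth K c -> generic t K ->
  exists b : nat -> nat, summand_count t K b /\
    asymptotic (fun n => nth_root n ((b n)%:R : R)) (fun=> c%:R).
Proof.
move=> c0 Ks Kt Kg Kgen; have [b bP bK] := summand_count_bounds Ks Kt Kgen.
exists b; split=> //; apply: asymptotic_nth_root => // n.
  rewrite -(@leq_exp2r _ _ 2) // -expnM muln2 -addnn.
  have [_ /leq_trans] := Kg n; apply; rewrite [X in (_ <= X)%N]expnMn leq_mul2l.
  by have [-> _] := bK n; rewrite orbT.
rewrite -(@leq_exp2r _ _ 2) //; have [_ /leq_trans] := bK n; apply.
rewrite expnMn -expnM muln2 -addnn; apply: leq_mul.
  by rewrite expnS expn1 leq_pmulr.
by have [] := Kg n.
Qed.

Local Open Scope complex_scope.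

Theorem mainTheorem5 (R : realType) (t : R[i]) :
  [/\ generic t planar_partition ->
        exists b : nat -> nat, summand_count t planar_partition b /\
          asymptotic (fun n => nth_root n ((b n)%:R : R)) (fun=> 4),
      generic t motzkin ->
        exists b : nat -> nat, summand_count t motzkin b /\
          asymptotic (fun n => nth_root n ((b n)%:R : R)) (fun=> 3),
      generic t temperley_lieb ->
        exists b : nat -> nat, summand_count t temperley_lieb b /\
          asymptotic (fun n => nth_root n ((b n)%:R : R)) (fun=> 2),
      generic t planar_rook ->
        exists b : nat -> nat, summand_count t planar_rook b /\
          asymptotic (fun n => nth_root n ((b n)%:R : R)) (fun=> 2)
    & generic t planar_symmetric ->
        exists b : nat -> nat, summand_count t planar_symmetric b /\
          asymptotic (fun n => nth_root n ((b n)%:R : R)) (fun=> 1)].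
Proof.
split.
- exact: growth_summands planar_partition_stack thin_planar_partition growth_planar_partition.
- exact: growth_summands motzkin_stack thin_motzkin growth_motzkin.
- exact: growth_summands temperley_lieb_stack thin_temperley_lieb growth_temperley_lieb.
- exact: growth_summands planar_rook_stack thin_planar_rook growth_planar_rook.
- exact: growth_summands planar_symmetric_stack thin_planar_symmetric growth_planar_symmetric.
Qed.
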